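(* For every oval or CPPOS $C$, $$\delta_{\operatorname{ART}}(C)\le\frac{2\pi}{3\sqrt3}.$$
   Context: Smooth setting. An oval is a smooth ($C^\infty$), strictly convex simple closed curve $C\subset\mathbb{R}^2$ with positive curvature; $\operatorname{int}(C)$ is the open region it bounds. For $x\in C$, $\iota_C(x)\in C$ is the unique point different from $x$ whose tangent line is parallel to $T_xC$. $\Phi_C$ sends a line $\overline{xy}$ ($x\ne y\in C$) to $\overline{\iota_C(x)\iota_C(y)}$. Polygonal setting. A CPPOS is a positively oriented convex polygon $P=(P_0,\dots,P_{2n-1})$, indices modulo $2n$, consecutive edge vectors $e_i=P_{i+1}-P_i$ linearly independent, and $e_{i+n}\parallel e_i$. Its boundary involution is $\sigma_P(P_i+se_i)=P_{i+n}+se_{i+n}$, $0\le s\le1$. For a line $\ell$ meeting $\operatorname{int}(P)$ with boundary points $x_\ell,y_\ell$, $\Phi_P(\ell)=\overline{\sigma_P(x_\ell)\sigma_P(y_\ell)}$. In both settings let $C$ be the oval or CPPOS and $p\in\operatorname{int}(C)$, and let $\Lambda_p$ be the pencil of lines through $p$. Put $n(\theta)=(\cos\theta,\sin\theta)$, $\tau(\theta)=(-\sin\theta,\cos\theta)$. For each $\theta$ there is exactly one line of $\Phi_C(\Lambda_p)$ with normal $n(\theta)$, written $n(\theta)\cdot(z-p)=q_p(\theta)$, with $q_p(\theta+\pi)=-q_p(\theta)$; $q_p$ is smooth for an oval, and continuous and piecewise smooth for a CPPOS. The affine reflection transform $\operatorname{ART}_C(p)$ is the closed front $X(\theta)=p+q_pn+q_p'\tau$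 (the envelope of these lines), $\theta\in[0,\pi]$, where in the CPPOS case, at each angle where $q_p'$ jumps, the oriented segment joining the two one-sided points $X^-$ to $X^+$ is included. Its oriented area is $A^*=\frac12\oint[X,dX]$ with $[u,v]=\det(u,v)$. Energy: $\mathcal E_C(p)=-A^*(\operatorname{ART}_C(p))$ for $p\in\operatorname{int}(C)$ and $\mathcal E_C(p)=0$ for $p$ on the boundary. With $A(C)$ the enclosed area, $\delta_{\operatorname{ART}}(C)=\max_{p\in\overline{\operatorname{int}(C)}}\mathcal E_C(p)/A(C)$. *)

(* Defs.v *)
From mathcomp Require Import all_boot all_order all_algebra.
From mathcomp Require Import all_classical all_reals all_analysis.

Set Implicit Arguments.
Unset Strict Implicit.
Unset Printing Implicit Defensive.

Import Order.TTheory GRing.Theory Num.Theory.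
Import numFieldNormedType.Exports.

Local Open Scope classical_set_scope.
Local Open Scope ring_scope.

(* Everything lives in the plane R * R. Both settings are reduced to a pair
   (C, s): a closed curve C, as a set of points, with an involution s of C. *)

Section Plane.
Context {R : realType}.
Implicit Types (u v x y z p : R * R) (l C : set (R * R)).

Definition det2 u v : R := u.1 * v.2 - u.2 * v.1.
Definition dot2 u v : R := u.1 * v.1 + u.2 * v.2.
Definition norm2 u : R := Num.sqrt (dot2 u u).

Definition normal (t : R) : R * R := (cos t, sin t).
Definition tau (t : R) : R * R := (- sin t, cos t).

Definition line x y : set (R * R) := [set z | det2 (y - x) (z - x) = 0].

Definition pencil p : set (set (R * R)) :=
  [set l | exists2 y, y <> p & l = line p y].

(* The region bounded by a closed curve: the union of the bounded connected
   components of its complement. *)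
Definition region C : set (R * R) :=
  [set z | ~ C z /\ bounded_set (connected_component (~` C) z)].

Definition area C : R :=
  fine ((@lebesgue_measure R \x @lebesgue_measure R)%E (region C)).

(* \int_a^b [X, dX] along a parametrised path. *)
Definition det_form (X : R -> R * R) (a b : R) : R :=
  \int[lebesgue_measure]_(t in `[a, b]) det2 (X t) (derive1 X t).

(* lim itself does not find a pointed topological structure on R * R. *)
Definition lim_pt (F : set_system (R * R)) : R * R :=
  lim_in ((R * R)%type : normedModType R) F.

Definition segment x y (r : R) : R * R := x + r *: (y - x).

End Plane.

Section ART.
Context {R : realType}.
Variables (C : set (R * R)) (s : R * R -> R * R).

Definition Phi (l : set (R * R)) : set (R * R) :=
  [set z | exists x y, [/\ (C `&` l) x, (C `&` l) y, x <> y &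
                           line (s x) (s y) z]].

Variable p : R * R.

Definition q_ (t : R) : R :=
  get [set c | (Phi @` pencil p) [set z | dot2 (normal t) (z - p) = c]].

Definition front (t : R) : R * R :=
  p + q_ t *: normal t + derive1 q_ t *: tau t.

(* Since front is pi-periodic, the angles of the half-open interval ]0, pi]
   represent each jump of the closed front exactly once. *)
Definition jumps : set R :=
  [set t | t \in `]0, pi] /\
           lim (derive1 q_ u @[u --> t^'-]) <> lim (derive1 q_ u @[u --> t^'+])].

(* front is differentiable off a finite set, so its junk derivative there does
   not affect the integral over [0, pi]. *)
Definition oriented_area : R :=
  2^-1 * (det_form front 0 pi +
    \sum_(t \in jumps)
      det_form (segment (lim_pt (front u @[u --> t^'-]))
                        (lim_pt (front u @[u --> t^'+]))) 0 1).

Definition energy : R := if p \in region C then - oriented_area else 0.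

End ART.

(* The maximum of energy / area, as a supremum in the extended reals, so that no
   junk value arises when boundedness or attainment is not known in advance. *)
Definition delta_ART {R : realType} (C : set (R * R)) (s : R * R -> R * R) :
    \bar R :=
  ereal_sup [set (energy C s p / area C)%:E | p in closure (region C)].

Section Oval.
Context {R : realType}.
Variables (g : R -> R * R) (T : R).

Definition curvature (t : R) : R :=
  det2 (derive1 g t) (derive1n 2 g t) / norm2 (derive1 g t) ^+ 3.

(* g is a counterclockwise parametrisation with period T of the oval range g;
   strict convexity: the curve lies strictly to the left of each of its tangent
   lines, apart from the point of contact. *)
Record is_oval : Prop := IsOval {
  oval_period_gt0 : 0 < T;
  oval_periodic : forall t, g (t + T) = g t;
  oval_simple : {in `[0, T[ &, injective g};
  oval_smooth : forall (k : nat) t, derivable (derive1n k g) t 1;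
  oval_regular : forall t, derive1 g t <> 0;
  oval_strictly_convex :
    forall t u, g u <> g t -> 0 < det2 (derive1 g t) (g u - g t);
  oval_curvature_gt0 : forall t, 0 < curvature t }.

Definition oval_inv (x : R * R) : R * R :=
  get [set y | exists t u, [/\ x = g t, y = g u, y <> x &
                               det2 (derive1 g t) (derive1 g u) = 0]].

End Oval.

Section CPPOS.
Context {R : realType}.
Variables (n : nat) (P : nat -> R * R).

Definition edge (i : nat) : R * R := P i.+1 - P i.

(* Indices modulo 2n are encoded by a 2n-periodic sequence. Injectivity of the
   vertices excludes polygons that wind around several times. *)
Record is_cppos : Prop := IsCPPOS {
  cppos_gt0 : (0 < n)%N;
  cppos_periodic : forall i, P (i + n.*2)%N = P i;
  cppos_inj : forall i j, (i < n.*2)%N -> (j < n.*2)%N -> P i = P j -> i = j;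
  cppos_convex : forall i j, 0 <= det2 (edge i) (P j - P i);
  cppos_indep : forall i, det2 (edge i) (edge i.+1) <> 0;
  cppos_parallel : forall i, det2 (edge i) (edge (i + n)%N) = 0 }.

Definition polygon : set (R * R) :=
  [set z | exists i (r : R), 0 <= r <= 1 /\ z = P i + r *: edge i].

Definition cppos_inv (x : R * R) : R * R :=
  get [set y | exists i (r : R), [/\ 0 <= r <= 1, x = P i + r *: edge i &
                                    y = P (i + n)%N + r *: edge (i + n)%N]].

End CPPOS.

(* Main.v *)
Require Import Defs.
From mathcomp Require Import all_boot all_order all_algebra.
From mathcomp Require Import all_classical all_reals all_analysis.
From mathcomp Require Import measurable_realfun.
From mathcomp Require Import ring lra zify.

Set Implicit Arguments.
Unset Strict Implicit.
Unset Printing Implicit Defensive.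

Import Order.TTheory GRing.Theory Num.Theory.
Import numFieldNormedType.Exports.

Local Open Scope classical_set_scope.
Local Open Scope ring_scope.

(** Why the bound holds.  The stronger inequality E_C(p) <= A(C) is proved for
    every p in the region; the constant exceeds 1 since pi >= 21/8 and
    sqrt 3 <= 7/4.

    Ovals and polygons are treated together.  The curve C is given by two
    periodic parametrisations [x] and [a], where [a t] is the image of [x t]
    under the involution; both have a C^2 germ on either side of every parameter,
    and all one-sided tangents are support lines of C (record [ccurve]).  For an
    oval, [a] runs through the points with opposite tangents; for a polygon, [x]
    runs through each edge in unit time and [a t = x (t + n)].

    Fix p in the region and let [u t] be the parameter at which the line through
    [x t] and p meets C again.  The image of that line carries the chord from
    [a (u t)] to [a t].  These chords rotate strictly counterclockwise
    ([chord_rotating]), so each direction [tau th] belongs to exactly one of them;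
    let c(th) be its end in that direction, so that c(th + pi) is the other end
    and q_p(th) = n(th) . (c(th) - p) ([q_E]).

    Put alpha = c - p, beta(th) = alpha(th + pi), m = (alpha + beta) / 2, and let
    X be the front.  Among the triangles inscribed in C choose one, with vertices
    P1, P2, P3, of maximal area.  By maximality an affine function that is
    nonnegative on C takes on C at most the sum of its values at P1, P2, P3
    ([max_triangle]).  For the supporting functions of C at the two ends of a
    chord this yields, by an identity in the frame (n, tau), the pointwise bound
      - [X, X'] <= [alpha, alpha'] + [beta, beta'] + Z'
    with Z = [X - p, m] - [p, X] - [W, m] and W = P1 + P2 + P3 - 3 p
    ([rate_bound]).  At a corner of q_p, the jump of Z is minus the form of the
    segment inserted in the front ([jump_cancel]), and Z takes the same value at
    0 and pi ([potential_pi]).  Hence -2 A^* is at most the integral of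
    [alpha, alpha'] + [beta, beta'] over [0, pi], which is twice the area swept by
    the segments from p to the two ends of the chords.  Different directions give
    disjoint segments in the region, so that area is at most A(C).

    The last integral is never formed.  Cousin's lemma ([cousin]) reduces the
    inequality on [0, pi] to short intervals at one end of which th is fixed;
    there the swept area is compared with the areas of triangles contained in
    the corresponding sector of the region ([triangle_in_sector],
    [measure_triangle]). *)

(** * Functions of one variable *)

Section Toolkit.
Context {R : realType}.
Implicit Types (f g F G : R -> R) (s t : R) (k : nat) (b : bool).

(** Glues one-sided local information along a parameter interval; it stands in
    for compactness of the interval and for integration. The proof takes the
    supremum of the points reached from [a]. *)
Lemma cousin (P : R -> R -> Prop) (a b : R) : a <= b ->
  (forall s t r, a <= s -> s <= t -> t <= r -> r <= b ->
     P s t -> P t r -> P s r) ->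
  (forall t, a <= t -> t <= b -> \forall s \near t,
     (a <= s -> s <= t -> P s t) /\ (t <= s -> s <= b -> P t s)) ->
  P a b.
Proof.
move=> ab Padd Ploc.
pose E := [set t | a <= t <= b /\ P a t].
have Ea : E a.
  by split; [rewrite lexx | have [H _] := nbhs_singleton (Ploc a (lexx a) ab); apply: H].
have supE : has_sup E by split; [exists a | exists b => t [/andP[]]].
set c := sup E.
have ac : a <= c by apply: sup_upper_bound.
have cb : c <= b by apply: ge_sup; [exists a | move=> t [/andP[]]].
have /nbhs_ballP[e /= e0 He] := Ploc c ac cb.
have [t [/andP[at_ tb] Pat] tc] := sup_adherent e0 supE.
have tlec : t <= c by apply: sup_upper_bound => //; split => //; apply/andP.
have Pac : P a c.
  have Ht : ball c e t by rewrite /ball /= ger0_norm ?subr_ge0// ltrBlDr addrC -ltrBlDr.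
  by apply: (Padd a t c) => //; have [H _] := He t Ht; apply: H.
move: cb; rewrite le_eqVlt => /predU1P[<-//|cb].
pose r := Num.min (c + e / 2) b.
have e2 : 0 < e / 2 by rewrite divr_gt0.
have cr : c < r by rewrite /r lt_min cb andbT ltrDl.
have rb : r <= b by rewrite /r ge_min lexx orbT.
have Hr : ball c e r.
  rewrite /ball /= ltr0_norm ?subr_lt0// opprB ltrBlDr.
  have : r <= c + e / 2 by rewrite /r ge_min lexx.
  lra.
have Par : P a r.
  by apply: (Padd a c r) => //; [exact: ltW | have [_ H] := He r Hr; apply: H => //; exact: ltW].
have : r <= c.
  apply: sup_upper_bound => //; split => //; apply/andP; split => //.
  by apply: (le_trans ac); exact: ltW.
by rewrite leNgt cr.
Qed.

(** Every derivative is required to exist on a neighbourhood, so that this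
    pointwise notion is stable under composition and local inversion. *)
Fixpoint Ck k f t : Prop :=
  if k is k'.+1 then (\forall s \near t, derivable f s 1) /\ Ck k' (derive1 f) t
  else \forall s \near t, {for s, continuous f}.

Lemma derivable_cont f t : derivable f t 1 -> {for t, continuous f}.
Proof. by move=> /derivable1_diffP; exact: differentiable_continuous. Qed.

Lemma near_near t (P : set R) :
  (\forall s \near t, P s) -> \forall s \near t, \forall r \near s, P r.
Proof. exact: nbhs_interior. Qed.

Lemma near_eq_derive1 f g t :
  (\forall s \near t, f s = g s) -> derive1 f t = derive1 g t.
Proof. by move=> fg; rewrite !derive1E; exact: near_eq_derive. Qed.

Lemma near_eq_continuous f g t :
  (\forall s \near t, f s = g s) -> {for t, continuous f} -> {for t, continuous g}.
Proof.
move=> fg cf; have cf' : f s @[s --> t] --> f t by exact: cf.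
suff : g s @[s --> t] --> g t by [].
rewrite -(nbhs_singleton fg); apply: cvg_trans cf'.
by apply: near_eq_cvg; apply: filterS fg => s /esym.
Qed.

Lemma Ck_D k f t : Ck k.+1 f t -> Ck k (derive1 f) t.
Proof. by case. Qed.

Lemma Ck_near k f g t : (\forall s \near t, f s = g s) -> Ck k f t -> Ck k g t.
Proof.
elim: k f g => [|k IH] f g fg /=.
  move=> cf; near=> s; apply: (@near_eq_continuous f); last by near: s.
  by near: s; exact: near_near.
move=> [df Cf]; split.
  near=> s; apply: (@near_eq_derivable _ _ _ f); last by near: s.
  by near: s; exact: near_near.
apply: IH Cf; near=> s; apply: near_eq_derive1.
by near: s; exact: near_near.
Unshelve. all: by end_near. Qed.

Lemma Ck_is_derive k f t :
  Ck k.+1 f t -> \forall s \near t, is_derive (s : R) 1 f (derive1 f s).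
Proof.
move=> [df _]; near=> s; rewrite derive1E; apply/derivableP.
by near: s.
Unshelve. all: by end_near. Qed.

Lemma Ck_derive1 k f t : Ck k.+1 f t -> is_derive (t : R) 1 f (derive1 f t).
Proof. by move=> /Ck_is_derive/nbhs_singleton. Qed.

Lemma is_derive_Ck k f g t :
  (\forall s \near t, is_derive (s : R) 1 f (g s)) -> Ck k g t -> Ck k.+1 f t.
Proof.
move=> fg Cg; split; first by near=> s; have [] : is_derive (s : R) 1 f (g s) by near: s.
apply: Ck_near Cg; near=> s; rewrite derive1E; apply/esym/derive_val.
by near: s.
Unshelve. all: by end_near. Qed.

Lemma Ck_cont k f t : Ck k f t -> \forall s \near t, {for s, continuous f}.
Proof.
case: k => //= k [df _]; near=> s; apply: derivable_cont.
by near: s.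
Unshelve. all: by end_near. Qed.

Lemma Ck_cont1 k f t : Ck k f t -> {for t, continuous f}.
Proof. by move=> /Ck_cont/nbhs_singleton. Qed.

Lemma Ck_pred k f t : Ck k.+1 f t -> Ck k f t.
Proof.
elim: k f => [|k IH] f; first exact: Ck_cont.
by move=> [df Cf]; split => //; exact: IH.
Qed.

Lemma Ck_le j k f t : (j <= k)%N -> Ck k f t -> Ck j f t.
Proof.
move=> /subnK <-; elim: (k - j)%N => [|i IH]; rewrite ?add0n// addSn.
by move=> /Ck_pred.
Qed.

Lemma Ck_nbhs k f t : Ck k f t -> \forall s \near t, Ck k f s.
Proof.
elim: k f => [|k IH] f /=; first exact: near_near.
move=> [df /IH Cf]; near=> s; split; last by near: s.
by near: s; exact: near_near.
Unshelve. all: by end_near. Qed.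

Lemma Ck_cst k c t : Ck k (fun=> c) t.
Proof.
elim: k c => [|k IH] c.
  by near=> s; exact: cst_continuous.
apply: (@is_derive_Ck _ _ (fun=> 0)) => //.
by near=> s; exact: is_derive_cst.
Unshelve. all: by end_near. Qed.

Lemma Ck_id k t : Ck k (fun s => s) t.
Proof.
case: k => [|k]; first by near=> s; exact: cvg_id.
apply: (@is_derive_Ck _ _ (fun=> 1)); last exact: Ck_cst.
by near=> s; exact: is_derive_id.
Unshelve. all: by end_near. Qed.

Lemma isd_eq f t df df' : is_derive (t : R) 1 f df -> df = df' -> is_derive (t : R) 1 f df'.
Proof. by move=> + <-. Qed.

Lemma isdD f g t df dg : is_derive (t : R) 1 f df -> is_derive (t : R) 1 g dg ->
  is_derive (t : R) 1 (fun s => f s + g s) (df + dg).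
Proof. by move=> ? ?; exact: is_deriveD. Qed.

Lemma isdN f t df : is_derive (t : R) 1 f df -> is_derive (t : R) 1 (fun s => - f s) (- df).
Proof. by move=> ?; exact: is_deriveN. Qed.

Lemma isdB f g t df dg : is_derive (t : R) 1 f df -> is_derive (t : R) 1 g dg ->
  is_derive (t : R) 1 (fun s => f s - g s) (df - dg).
Proof. by move=> ? ?; exact: is_deriveB. Qed.

Lemma isdM f g t df dg : is_derive (t : R) 1 f df -> is_derive (t : R) 1 g dg ->
  is_derive (t : R) 1 (fun s => f s * g s) (df * g t + f t * dg).
Proof.
move=> ? ?; rewrite addrC [df * _]mulrC; exact: is_deriveM.
Qed.

Lemma isdV f t df : f t != 0 -> is_derive (t : R) 1 f df ->
  is_derive (t : R) 1 (fun s => (f s)^-1) (- df * ((f t)^-1 * (f t)^-1)).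
Proof.
move=> ft fd; apply: isd_eq (is_deriveV ft fd) _.
by rewrite -[LHS]/(_ * _) expr2 invfM; ring.
Qed.

Lemma isd_comp f g t df dg : is_derive ((g t) : R) 1 f df -> is_derive (t : R) 1 g dg ->
  is_derive (t : R) 1 (fun s => f (g s)) (df * dg).
Proof. by move=> ? ?; exact: is_derive1_comp. Qed.

Lemma isd_derive1 f t df : is_derive (t : R) 1 f df -> derive1 f t = df.
Proof. by move=> H; rewrite derive1E; exact: derive_val. Qed.

Lemma CkD k f g t : Ck k f t -> Ck k g t -> Ck k (fun s => f s + g s) t.
Proof.
elim: k f g => [|k IH] f g Cf Cg.
  by near=> s; apply: continuousD; [have : {for s, continuous f} by near: s | have : {for s, continuous g} by near: s] => H; exact: H.
apply: (@is_derive_Ck _ _ (fun s => derive1 f s + derive1 g s)).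
  near=> s; apply: isdD; near: s; [exact: Ck_is_derive Cf | exact: Ck_is_derive Cg].
by apply: IH; [case: Cf | case: Cg].
Unshelve. all: by end_near. Qed.

Lemma CkM k f g t : Ck k f t -> Ck k g t -> Ck k (fun s => f s * g s) t.
Proof.
elim: k f g => [|k IH] f g Cf Cg.
  by near=> s; apply: continuousM; [have : {for s, continuous f} by near: s | have : {for s, continuous g} by near: s] => H; exact: H.
apply: (@is_derive_Ck _ _ (fun s => derive1 f s * g s + f s * derive1 g s)).
  near=> s; apply: isdM; near: s; [exact: Ck_is_derive Cf | exact: Ck_is_derive Cg].
by apply: CkD; apply: IH; (try by case: Cf); (try by case: Cg); exact: Ck_pred.
Unshelve. all: by end_near. Qed.

Lemma CkN k f t : Ck k f t -> Ck k (fun s => - f s) t.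
Proof.
move=> Cf; apply: (@Ck_near _ (fun s => -1 * f s)).
  by near=> s; rewrite mulN1r.
by apply: CkM => //; exact: Ck_cst.
Unshelve. all: by end_near. Qed.

Lemma CkB k f g t : Ck k f t -> Ck k g t -> Ck k (fun s => f s - g s) t.
Proof. by move=> Cf Cg; apply: CkD => //; exact: CkN. Qed.

Lemma near_neq0 f t : {for t, continuous f} -> f t != 0 -> \forall s \near t, f s != 0.
Proof.
move=> cf ft.
have /open_nbhs_nbhs H : open_nbhs (f t) [set y | y != 0].
  by split => //; have := @open_neq R 0; apply.
exact: cf H.
Qed.

Lemma near_gt0 f t : {for t, continuous f} -> 0 < f t -> \forall s \near t, 0 < f s.
Proof. by move=> cf ft; apply: (cf [set y | 0 < y]); exact: lt_nbhsr. Qed.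

Lemma CkV k f t : f t != 0 -> Ck k f t -> Ck k (fun s => (f s)^-1) t.
Proof.
move=> ft; elim: k => [|k IH] Cf.
  have f0 : \forall s \near t, f s != 0 by apply: near_neq0 => //; exact: Ck_cont1 Cf.
  by near=> s; apply: continuousV; [near: s | near: s].
apply: (@is_derive_Ck _ _ (fun s => - derive1 f s * ((f s)^-1 * (f s)^-1))).
  have f0 : \forall s \near t, f s != 0 by apply: near_neq0 => //; exact: Ck_cont1 Cf.
  near=> s; apply: isdV; first by near: s.
  by near: s; exact: Ck_is_derive Cf.
have CV : Ck k (fun s => (f s)^-1) t by apply: IH; exact: Ck_pred.
by apply: CkM; [apply: CkN; case: Cf | apply: CkM].
Unshelve. all: by end_near. Qed.

Lemma Ck_comp k f g t : Ck k f (g t) -> Ck k g t -> Ck k (fun s => f (g s)) t.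
Proof.
elim: k f g => [|k IH] f g Cf Cg.
  have cg := Ck_cont1 Cg.
  have Cf' := cg _ Cf.
  near=> s; apply: (@continuous_comp _ _ _ g f); first by near: s.
  by near: s.
have cg := Ck_cont1 Cg.
have Cf' := cg _ (Ck_is_derive Cf).
apply: (@is_derive_Ck _ _ (fun s => derive1 f (g s) * derive1 g s)).
  near=> s; apply: isd_comp; first by near: s.
  by near: s; exact: Ck_is_derive Cg.
by apply: CkM; [apply: IH; [case: Cf | exact: Ck_pred] | case: Cg].
Unshelve. all: by end_near. Qed.

Lemma Ck_sincos k t : Ck k sin t /\ Ck k cos t.
Proof.
elim: k => [|k [IHs IHc]].
  by split; near=> s; [exact: continuous_sin | exact: continuous_cos].
split.
  by apply: (@is_derive_Ck _ _ cos) => //; near=> s; exact: is_derive_sin.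
apply: (@is_derive_Ck _ _ (fun s => - sin s)); last exact: CkN.
by near=> s; exact: is_derive_cos.
Unshelve. all: by end_near. Qed.

Lemma Ck_sin k t : Ck k sin t. Proof. by case: (Ck_sincos k t). Qed.
Lemma Ck_cos k t : Ck k cos t. Proof. by case: (Ck_sincos k t). Qed.

Lemma near_itv t (P : set R) : (\forall s \near t, P s) ->
  exists2 e, 0 < e & forall s, t - e <= s <= t + e -> P s.
Proof.
move=> /nbhs_ballP[e /= e0 He]; exists (e / 2); first by rewrite divr_gt0.
move=> s /andP[s1 s2]; apply: He; rewrite /ball /=.
have : 0 < e / 2 by rewrite divr_gt0.
by move=> ?; apply/ltr_normlP; split; lra.
Qed.

Lemma itv_near t e (P : set R) : 0 < e ->
  (forall s, t - e < s < t + e -> P s) -> \forall s \near t, P s.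
Proof.
move=> e0 H; apply/nbhs_ballP; exists e => //= s; rewrite /ball /= => hs.
apply: H; move/ltr_normlP: hs => [h1 h2]; apply/andP; split; lra.
Qed.

(** The inverse is chosen on an interval where [f] increases. Its derivative
    is [1 / f' (g y)], which raises the order of smoothness of [g] one step at
    a time. *)
Lemma Ck_inverse k f t : Ck k.+1 f t -> 0 < derive1 f t ->
  exists g, [/\ Ck k.+1 g (f t), g (f t) = t,
    \forall y \near f t, f (g y) = y,
    0 < derive1 g (f t) &
    \forall y \near f t, (f t <= y -> t <= g y) /\ (y <= f t -> g y <= t)].
Proof.
move=> Cf f't.
have Cf' : Ck k (derive1 f) t by case: Cf.
have posf' : \forall s \near t, 0 < derive1 f s.
  by apply: near_gt0 => //; exact: Ck_cont1 Cf'.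
have /near_itv[e e0 He] : \forall s \near t,
    [/\ 0 < derive1 f s, is_derive (s : R) 1 f (derive1 f s) & {for s, continuous f}].
  near=> s; split; near: s => //; [exact: Ck_is_derive Cf | exact: Ck_cont Cf].
have incf x y : t - e <= x -> x < y -> y <= t + e -> f x < f y.
  move=> x1 xy y1; apply: (@gtr0_derive1_incr _ f (t - e) (t + e)) => //.
  - move=> z; rewrite in_itv/= => /andP[z1 z2].
    have hz : t - e <= z <= t + e by apply/andP; split; lra.
    by have [_ [d _] _] := He z hz.
  - move=> z; rewrite in_itv/= => /andP[z1 z2].
    have hz : t - e <= z <= t + e by apply/andP; split; lra.
    by have [d _ _] := He z hz.
  - apply: continuous_in_subspaceT => z; rewrite inE/= in_itv/= => z12.
    by have [] := He z z12.
pose g y := xget t [set s | t - e <= s <= t + e /\ f s = y].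
have fK : {near t, cancel f g}.
  apply: (@itv_near _ e) => // s /andP[s1 s2]; rewrite /g.
  apply: xget_unique => [|r [/andP[r1 r2] frs]]; first by split => //; apply/andP; split; lra.
  have [rs|sr|//] := ltgtP r s.
    by have := incf r s r1 rs (ltW s2); rewrite frs ltxx.
  by have := incf s r (ltW s1) sr r2; rewrite frs ltxx.
have cf : {near t, continuous f} by exact: Ck_cont Cf.
have [cg gK] := near_can_continuousAcan_sym fK cf.
have gft : g (f t) = t by exact: nbhs_singleton fK.
have cgt : {for f t, continuous g} by exact: nbhs_singleton cg.
have nearg (P : set R) : (\forall s \near t, P s) -> \forall y \near f t, P (g y).
  by rewrite -{1}gft => H; exact: cgt H.
have dg : \forall y \near f t, is_derive (y : R) 1 g (derive1 f (g y))^-1.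
  near=> y.
  have fgy : f (g y) = y by near: y.
  have h1 : {near g y, cancel f g} by near: y; exact: (nearg _ (near_near fK)).
  have h2 : {near g y, continuous f} by near: y; exact: (nearg _ (near_near cf)).
  have h3 : is_derive (g y : R) 1 f (derive1 f (g y)).
    by near: y; exact: (nearg _ (Ck_is_derive Cf)).
  have h4 : derive1 f (g y) != 0.
    by apply/lt0r_neq0; near: y; exact: (nearg _ posf').
  by have := is_derive_inverse h1 h2 h3 h4; rewrite fgy.
have Cg j : (j <= k.+1)%N -> Ck j g (f t).
  elim: j => [_|j IH jk]; first exact: cg.
  apply: (is_derive_Ck dg); apply: CkV; first by rewrite gft gt_eqF.
  apply: Ck_comp; last by apply: IH; exact: ltnW.
  by rewrite gft; apply: Ck_le Cf'; rewrite -ltnS.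
exists g; split => //.
- exact: Cg.
- by rewrite (isd_derive1 (nbhs_singleton dg)) gft invr_gt0.
- have nearge : \forall y \near f t, t - e <= g y <= t + e.
    apply: (nearg (fun s => t - e <= s <= t + e)); apply: (@itv_near _ e) => // s /andP[? ?].
    apply/andP; split; lra.
  near=> y.
  have /andP[y1 y2] : t - e <= g y <= t + e by near: y.
  have fgy : f (g y) = y by near: y.
  split => H; rewrite leNgt; apply/negP => H'.
    have := incf (g y) t y1 H'; rewrite fgy ltNge H => /(_ _)/negP; apply => //.
    by rewrite lerDl ltW.
  have := incf t (g y) _ H' y2; rewrite fgy ltNge H => /(_ _)/negP; apply => //.
  by rewrite gerBl ltW.
Unshelve. all: by end_near. Qed.

End Toolkit.

Global Opaque Ck.

(** * One-sided germs *)

Section Germs.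
Context {R : realType}.
Implicit Types (f g F G : R -> R) (r s t : R) (k : nat) (b : bool).

Lemma isd_estimate f t d e : is_derive (t : R) 1 f d -> 0 < e ->
  \forall s \near t, `|f s - f t - d * (s - t)| <= e * `|s - t|.
Proof.
move=> /is_derive1_caratheodory[h [fE hc ht]] e0.
have /cvgrPdist_le/(_ e e0) H : h s @[s --> t] --> h t by exact: hc.
near=> s.
rewrite fE -ht -mulrBl normrM distrC; apply: ler_wpM2r => //.
by near: s; exact: H.
Unshelve. all: by end_near. Qed.

Lemma isd_incr f t d : is_derive (t : R) 1 f d -> 0 < d ->
  \forall s \near t, (t < s -> f t < f s) /\ (s < t -> f s < f t).
Proof.
move=> fd d0; have d2 : 0 < d / 2 by rewrite divr_gt0.
near=> s.
have : `|f s - f t - d * (s - t)| <= d / 2 * `|s - t|.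
  by near: s; exact: isd_estimate fd d2.
move=> /ler_normlP[h1 h2]; split => st.
  by move: h1 h2; rewrite gtr0_norm ?subr_gt0//; nra.
by move: h1 h2; rewrite ltr0_norm ?subr_lt0//; nra.
Unshelve. all: by end_near. Qed.

Definition side b t s := if b then t <= s else s <= t.

Lemma side_refl b t : side b t t. Proof. by case: b => /=. Qed.

(** The side is the right one when [b] is true. Requiring [F] to be smooth on
    both sides of [t] makes the whole calculus of [Ck] available at a corner
    of [f]; a piecewise smooth function is one that has a germ on each side of
    every point. *)
Definition germ b k f F t :=
  Ck k F t /\ \forall s \near t, side b t s -> f s = F s.

Lemma germ_at b k f F t : germ b k f F t -> f t = F t.
Proof. by move=> [_ /nbhs_singleton]; apply; exact: side_refl. Qed.

Lemma germ_le b j k f F t : (j <= k)%N -> germ b k f F t -> germ b j f F t.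
Proof. by move=> jk [CF fF]; split => //; exact: Ck_le CF. Qed.

Lemma germ_Ck b k f t : Ck k f t -> germ b k f f t.
Proof. by move=> Cf; split => //; near=> s. Unshelve. all: by end_near. Qed.

Lemma germ_cont k f F G t :
  germ true k f F t -> germ false k f G t -> {for t, continuous f}.
Proof.
move=> fF fG; have ftF := germ_at fF; have ftG := germ_at fG.
suff : f s @[s --> t] --> f t by [].
apply/cvgrPdist_le => e e0.
have /cvgrPdist_le/(_ e e0) HF : F s @[s --> t] --> F t by have [/Ck_cont1] := fF.
have /cvgrPdist_le/(_ e e0) HG : G s @[s --> t] --> G t by have [/Ck_cont1] := fG.
near=> s; have [ts|st] := leP t s.
  have -> : f s = F s by move: ts; near: s; have [] := fF.
  by rewrite ftF; near: s.
have -> : f s = G s by move/ltW: st; near: s; have [] := fG.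
by rewrite ftG; near: s.
Unshelve. all: by end_near. Qed.

Lemma near_side b t (P : set R) : (\forall s \near t, P s) ->
  exists s, [/\ P s, side b t s & s != t].
Proof.
move=> /near_itv[e e0 He]; exists (if b then t + e else t - e).
case: b => /=; split.
- by apply: He; apply/andP; split; lra.
- by rewrite lerDl ltW.
- by apply/eqP; lra.
- by apply: He; apply/andP; split; lra.
- by rewrite gerBl ltW.
- by apply/eqP; lra.
Qed.

(** Along the given side both germs have the difference quotients of [f]. *)
Lemma germ_unique b f F G t : germ b 1 f F t -> germ b 1 f G t ->
  derive1 F t = derive1 G t.
Proof.
move=> [CF fF] [CG fG].
have dF := Ck_derive1 CF; have dG := Ck_derive1 CG.
apply/eqP; rewrite -subr_eq0 -normr_le0; apply/ler_addgt0Pl => e e0.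
rewrite addr0.
have e2 : 0 < e / 2 by rewrite divr_gt0.
have [s [[[h1 h2] [h3 h4]] bs st]] := near_side b
  (filterI (filterI fF fG) (filterI (isd_estimate dF e2) (isd_estimate dG e2))).
have FG : F s = G s by rewrite -h1 // h2.
have FGt : F t = G t.
  have := nbhs_singleton fF (side_refl _ _).
  by have := nbhs_singleton fG (side_refl _ _) => -> ->.
have st0 : 0 < `|s - t| by rewrite normr_gt0 subr_eq0.
rewrite -(ler_pM2r st0) -normrM.
have -> : (derive1 F t - derive1 G t) * (s - t) =
  (G s - G t - derive1 G t * (s - t)) - (F s - F t - derive1 F t * (s - t)).
  by rewrite FG FGt; ring.
apply: le_trans (ler_normB _ _) _.
have : e * `|s - t| = e / 2 * `|s - t| + e / 2 * `|s - t| by field.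
by move: h3 h4; lra.
Qed.

Lemma germ_comp b k f F g G t : germ b k f F (g t) -> germ b k g G t ->
  (\forall s \near t, side b t s -> side b (g t) (g s)) ->
  germ b k (fun s => f (g s)) (fun s => F (G s)) t.
Proof.
move=> [CF fF] gG mono; have gt := germ_at gG; have [CG gG'] := gG.
split; first by apply: Ck_comp => //; rewrite -gt.
have cG : {for t, continuous G} by exact: Ck_cont1 CG.
have fF' : \forall s \near G t, side b (g t) s -> f s = F s by rewrite -gt.
have {}fF' := cG _ fF'.
near=> s => bs.
have gGs : g s = G s by move: bs; near: s.
rewrite gGs.
have : side b (g t) (G s) by rewrite -gGs; move: bs; near: s.
by near: s; exact: fF'.
Unshelve. all: by end_near. Qed.

Lemma germD b k f F g G t : germ b k f F t -> germ b k g G t ->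
  germ b k (fun s => f s + g s) (fun s => F s + G s) t.
Proof.
move=> [CF fF] [CG gG]; split; first exact: CkD.
by apply: filterS2 fF gG => s h1 h2 bs; rewrite h1 // h2.
Qed.

Lemma germN b k f F t : germ b k f F t -> germ b k (fun s => - f s) (fun s => - F s) t.
Proof.
move=> [CF fF]; split; first exact: CkN.
by apply: filterS fF => s h1 bs; rewrite h1.
Qed.

Lemma germB b k f F g G t : germ b k f F t -> germ b k g G t ->
  germ b k (fun s => f s - g s) (fun s => F s - G s) t.
Proof. by move=> fF gG; apply: germD => //; exact: germN. Qed.

Lemma ivt0 f s t : s <= t -> (forall r, s <= r <= t -> {for r, continuous f}) ->
  f s * f t <= 0 -> exists2 r, s <= r <= t & f r = 0.
Proof.
move=> st cf fst.
have cf' : {within `[s, t], continuous f}.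
  by apply: continuous_in_subspaceT => z; rewrite inE/= in_itv/= => /cf.
have [|r] := @IVT _ f s t 0 st cf'; last by rewrite in_itv/=; exists r.
have [fs0|fs0] := leP (f s) 0; have [ft0|ft0] := leP (f t) 0.
- rewrite ge_min fs0 /= le_max; apply/orP.
  have [?|fs1] := leP 0 (f s); first by left.
  by right; rewrite leNgt; apply/negP => ft1; move: fst; rewrite leNgt nmulr_rgt0 ?ft1.
- by rewrite ge_min fs0 /= le_max (ltW ft0) orbT.
- by rewrite ge_min ft0 orbT /= le_max (ltW fs0).
- by move: fst; rewrite leNgt mulr_gt0.
Qed.

Implicit Types (X Y x y : R -> R * R) (u v w z p : R * R).

Lemma fstZ (c : R) u : (c *: u).1 = c * u.1. Proof. by []. Qed.
Lemma sndZ (c : R) u : (c *: u).2 = c * u.2. Proof. by []. Qed.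
Definition pairZ := (fstZ, sndZ).

Lemma det2C u v : det2 u v = - det2 v u. Proof. by rewrite /det2; ring. Qed.
Lemma det2vv u : det2 u u = 0. Proof. by rewrite /det2; ring. Qed.
Lemma det2Dl u v w : det2 (u + v) w = det2 u w + det2 v w.
Proof. by rewrite /det2 /=; ring. Qed.
Lemma det2Dr u v w : det2 w (u + v) = det2 w u + det2 w v.
Proof. by rewrite /det2 /=; ring. Qed.
Lemma det2Br u v w : det2 w (u - v) = det2 w u - det2 w v.
Proof. by rewrite /det2 /=; ring. Qed.
Lemma det2Nl u v : det2 (- u) v = - det2 u v.
Proof. by rewrite /det2 /=; ring. Qed.
Lemma det2Nr u v : det2 u (- v) = - det2 u v.
Proof. by rewrite /det2 /=; ring. Qed.
Lemma det2Zl (c : R) u v : det2 (c *: u) v = c * det2 u v.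
Proof. by rewrite /det2 !pairZ; ring. Qed.
Lemma det2Zr (c : R) u v : det2 u (c *: v) = c * det2 u v.
Proof. by rewrite det2C det2Zl (det2C u); ring. Qed.

Definition Ck2 k X t := Ck k (fun s => (X s).1) t /\ Ck k (fun s => (X s).2) t.
Definition der X t : R * R :=
  (derive1 (fun s => (X s).1) t, derive1 (fun s => (X s).2) t).
Definition germ2 b k x X t :=
  germ b k (fun s => (x s).1) (fun s => (X s).1) t /\
  germ b k (fun s => (x s).2) (fun s => (X s).2) t.
Definition isd2 X t v :=
  is_derive (t : R) 1 (fun s => (X s).1) v.1 /\
  is_derive (t : R) 1 (fun s => (X s).2) v.2.

End Germs.

(** * Plane curves *)

Section PlaneCurves.
Context {R : realType}.
Implicit Types (f g F G : R -> R) (r s t : R) (k : nat) (b : bool).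
Implicit Types (X Y x y : R -> R * R) (u v w z p : R * R).

Lemma isd2_det X Y t v w : isd2 X t v -> isd2 Y t w ->
  is_derive (t : R) 1 (fun s => det2 (X s) (Y s)) (det2 v (Y t) + det2 (X t) w).
Proof.
move=> [X1 X2] [Y1 Y2]; apply: isd_eq (isdB (isdM X1 Y2) (isdM X2 Y1)) _.
by rewrite /det2; ring.
Qed.

Lemma isd2_dot X Y t v w : isd2 X t v -> isd2 Y t w ->
  is_derive (t : R) 1 (fun s => dot2 (X s) (Y s)) (dot2 v (Y t) + dot2 (X t) w).
Proof.
move=> [X1 X2] [Y1 Y2]; apply: isd_eq (isdD (isdM X1 Y1) (isdM X2 Y2)) _.
by rewrite /dot2; ring.
Qed.

Lemma isd2_cst v t : isd2 (fun=> v) t 0.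
Proof. by split; exact: is_derive_cst. Qed.

Lemma isd2D X Y t v w : isd2 X t v -> isd2 Y t w ->
  isd2 (fun s => X s + Y s) t (v + w).
Proof. by move=> [X1 X2] [Y1 Y2]; split; exact: isdD. Qed.

Lemma isd2B X Y t v w : isd2 X t v -> isd2 Y t w ->
  isd2 (fun s => X s - Y s) t (v - w).
Proof. by move=> [X1 X2] [Y1 Y2]; split; exact: isdB. Qed.

Lemma isd2Z f X t d v : is_derive (t : R) 1 f d -> isd2 X t v ->
  isd2 (fun s => f s *: X s) t (d *: X t + f t *: v).
Proof. by move=> fd [X1 X2]; split; apply: isd_eq (isdM fd _) _. Qed.

Lemma isd2_comp X f t d v : isd2 X (f t) v -> is_derive (t : R) 1 f d ->
  isd2 (fun s => X (f s)) t (d *: v).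
Proof.
move=> [X1 X2] fd; split.
  by apply: isd_eq (isd_comp X1 fd) _; rewrite mulrC.
by apply: isd_eq (isd_comp X2 fd) _; rewrite mulrC.
Qed.

Lemma isd2_eq X t v w : isd2 X t v -> v = w -> isd2 X t w.
Proof. by move=> + <-. Qed.

Lemma isd2_der X t v : isd2 X t v -> der X t = v.
Proof.
by move=> [X1 X2]; rewrite /der (isd_derive1 X1) (isd_derive1 X2); case: v {X1 X2}.
Qed.

Lemma Ck2_isd2 k X t : Ck2 k.+1 X t -> isd2 X t (der X t).
Proof. by move=> [X1 X2]; split; [exact: Ck_derive1 X1 | exact: Ck_derive1 X2]. Qed.

Lemma Ck_det2 k X Y t : Ck2 k X t -> Ck2 k Y t -> Ck k (fun s => det2 (X s) (Y s)) t.
Proof. by move=> [X1 X2] [Y1 Y2]; apply: CkB; apply: CkM. Qed.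

Lemma Ck_dot2 k X Y t : Ck2 k X t -> Ck2 k Y t -> Ck k (fun s => dot2 (X s) (Y s)) t.
Proof. by move=> [X1 X2] [Y1 Y2]; apply: CkD; apply: CkM. Qed.

Lemma Ck2_cst k v t : Ck2 k (fun=> v) t.
Proof. by split; exact: Ck_cst. Qed.

Lemma Ck2D k X Y t : Ck2 k X t -> Ck2 k Y t -> Ck2 k (fun s => X s + Y s) t.
Proof. by move=> [X1 X2] [Y1 Y2]; split; apply: CkD. Qed.

Lemma Ck2B k X Y t : Ck2 k X t -> Ck2 k Y t -> Ck2 k (fun s => X s - Y s) t.
Proof. by move=> [X1 X2] [Y1 Y2]; split; apply: CkB. Qed.

Lemma Ck2Z k f Y t : Ck k f t -> Ck2 k Y t -> Ck2 k (fun s => f s *: Y s) t.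
Proof. by move=> Cf [Y1 Y2]; split; apply: CkM. Qed.

Lemma Ck2_comp k X f t : Ck2 k X (f t) -> Ck k f t -> Ck2 k (fun s => X (f s)) t.
Proof.
by move=> [X1 X2] Cf; split; [exact: (Ck_comp X1) | exact: (Ck_comp X2)].
Qed.

Lemma germ2_Ck2 b k x X t : germ2 b k x X t -> Ck2 k X t.
Proof. by move=> [[? _] [? _]]; split. Qed.

Lemma germ2_near b k x X t : germ2 b k x X t ->
  \forall s \near t, side b t s -> x s = X s.
Proof.
move=> [[_ h1] [_ h2]]; apply: filterS2 h1 h2 => s h1 h2 bs.
by rewrite [LHS]surjective_pairing h1 // h2 // -surjective_pairing.
Qed.

Lemma germ2P b k x X t : Ck2 k X t ->
  (\forall s \near t, side b t s -> x s = X s) -> germ2 b k x X t.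
Proof.
by move=> [C1 C2] H; split; split => //; apply: filterS H => s H bs; rewrite H.
Qed.

Lemma germ2_at b k x X t : germ2 b k x X t -> x t = X t.
Proof. by move=> /germ2_near/nbhs_singleton; apply; exact: side_refl. Qed.

Lemma germ2_le b j k x X t : (j <= k)%N -> germ2 b k x X t -> germ2 b j x X t.
Proof. by move=> jk [x1 x2]; split; [exact: germ_le x1 | exact: germ_le x2]. Qed.

Lemma germ2_unique b x X Y t : germ2 b 1 x X t -> germ2 b 1 x Y t ->
  der X t = der Y t.
Proof.
move=> [X1 X2] [Y1 Y2].
by rewrite /der (germ_unique X1 Y1) (germ_unique X2 Y2).
Qed.

Lemma germ2_comp b k x X g G t : germ2 b k x X (g t) -> germ b k g G t ->
  (\forall s \near t, side b t s -> side b (g t) (g s)) ->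
  germ2 b k (fun s => x (g s)) (fun s => X (G s)) t.
Proof.
by move=> [x1 x2] gG mono; split; [exact: (germ_comp x1) | exact: (germ_comp x2)].
Qed.

Lemma germ2B b k x X y Y t : germ2 b k x X t -> germ2 b k y Y t ->
  germ2 b k (fun s => x s - y s) (fun s => X s - Y s) t.
Proof. by move=> [x1 x2] [y1 y2]; split; apply: germB. Qed.

Lemma germ2_eq b k x y X t : germ2 b k x X t ->
  (\forall s \near t, side b t s -> y s = x s) -> germ2 b k y X t.
Proof.
move=> /[dup] /germ2_Ck2 CX /germ2_near xX xy; apply: germ2P => //.
by apply: filterS2 xX xy => s h1 h2 bs; rewrite h2 // h1.
Qed.

Lemma isd_side f t d b : is_derive (t : R) 1 f d -> 0 < d ->
  \forall s \near t, side b t s -> side b (f t) (f s).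
Proof.
move=> fd d0; apply: filterS (isd_incr fd d0) => s [h1 h2]; case: b => /=.
  by rewrite le_eqVlt => /predU1P[->//|/h1/ltW].
by rewrite le_eqVlt => /predU1P[->//|/h2/ltW].
Qed.

(** The tangent of the angle from [v] to [X s]: it replaces directions by a
    real parameter, to which inversion in one variable applies. *)
Definition slope v X s := det2 v (X s) / dot2 v (X s).

Lemma dot2_gt0 v : v != 0 -> 0 < dot2 v v.
Proof.
move=> v0; rewrite /dot2 lt_neqAle eq_sym addr_ge0 ?andbT -?expr2 ?sqr_ge0//.
apply: contra v0; rewrite paddr_eq0 ?sqr_ge0// !expf_eq0/= => /andP[/eqP v1 /eqP v2].
by apply/eqP; rewrite [v]surjective_pairing v1 v2.
Qed.

Lemma slopeP k v X s c : Ck2 k.+1 X s -> X s = c *: v -> c != 0 ->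
  0 < det2 (X s) (der X s) ->
  [/\ Ck k.+1 (slope v X) s, slope v X s = 0 & 0 < derive1 (slope v X) s].
Proof.
move=> CX Xs c0 dX.
have v0 : v != 0.
  by apply: contraTN dX => /eqP v0; rewrite Xs v0 scaler0 /det2 !mul0r subrr ltxx.
have vv := dot2_gt0 v0.
have dvX : dot2 v (X s) = c * dot2 v v.
  by rewrite Xs /dot2 !pairZ; ring.
have dvX0 : dot2 v (X s) != 0 by rewrite dvX mulf_neq0// gt_eqF.
have detvX : det2 v (X s) = 0 by rewrite Xs det2Zr det2vv mulr0.
split.
- apply: CkM; first by apply: Ck_det2 => //; exact: Ck2_cst.
  by apply: CkV => //; apply: Ck_dot2 => //; exact: Ck2_cst.
- by rewrite /slope detvX mul0r.
- have dX' := Ck2_isd2 CX.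
  have := isdM (isd2_det (isd2_cst v s) dX') (@isdV _ (fun s => dot2 v (X s)) _ _ dvX0 (isd2_dot (isd2_cst v s) dX')).
  move=> /isd_derive1 ->; rewrite detvX mul0r addr0.
  have -> : det2 0 (X s) = 0 by rewrite /det2 !mul0r subrr.
  rewrite add0r dvX invfM; move: dX; rewrite Xs det2Zl => dX.
  have -> : det2 v (der X s) * (c^-1 / dot2 v v) =
     (c * det2 v (der X s)) * (c^-1 * c^-1) / dot2 v v by field; rewrite c0 gt_eqF.
  by rewrite divr_gt0// mulr_gt0// -expr2 exprn_even_gt0// invr_eq0.
Qed.

(** Near a pair of parallel vectors of two counterclockwise curves, the
    solution of [f (r t)] parallel to [e t] is the local inverse of the slope
    of [F] composed with the slope of [E]. Both slopes increase, so [r]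
    preserves the side; the sign of [c] tells parallel from antiparallel
    vectors. *)
Lemma solve_germ b k (f F e E : R -> R * R) (s0 t0 c : R) :
  germ2 b k.+1 f F s0 -> 0 < det2 (F s0) (der F s0) ->
  germ2 b k.+1 e E t0 -> 0 < det2 (E t0) (der E t0) ->
  f s0 = c *: e t0 -> c != 0 ->
  exists r : R -> R, [/\ Ck k.+1 r t0, r t0 = s0, 0 < derive1 r t0 &
    \forall t \near t0, side b t0 t ->
      [/\ side b s0 (r t), det2 (f (r t)) (e t) = 0 &
          0 < c * dot2 (f (r t)) (e t)]].
Proof.
move=> fF dF eE dE fe c0.
have CF := germ2_Ck2 fF; have CE := germ2_Ck2 eE.
have ft := germ2_at fF; have et := germ2_at eE.
have [CmF mF0 mF'] := slopeP CF (etrans (esym ft) fe) c0 dF.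
have Ee : E t0 = 1 *: e t0 by rewrite scale1r.
have [CmE mE0 mE'] := slopeP CE Ee (oner_neq0 _) dE.
have [G [CG G0 GK G' Gside]] := Ck_inverse CmF mF'.
rewrite mF0 in CG G0 GK G' Gside.
pose r t := G (slope (e t0) E t).
have Cr : Ck k.+1 r t0 by apply: Ck_comp => //; rewrite mE0.
have rt0 : r t0 = s0 by rewrite /r mE0.
have cr : {for t0, continuous r} by exact: Ck_cont1 Cr.
have cE : {for t0, continuous (slope (e t0) E)} by exact: Ck_cont1 CmE.
have e0 : e t0 != 0.
  by apply: contraTN dE => /eqP v0; rewrite -et v0 /det2 !mul0r subrr ltxx.
exists r; split => //.
  have d1 : is_derive (slope (e t0) E t0) 1 G (derive1 G 0).
    by rewrite mE0; exact: Ck_derive1 CG.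
  by rewrite (isd_derive1 (isd_comp d1 (Ck_derive1 CmE))) mulr_gt0.
have cdot : {for t0, continuous (fun t => c * dot2 (F (r t)) (E t))}.
  apply: (@Ck_cont1 _ k.+1); apply: CkM; first exact: Ck_cst.
  by apply: Ck_dot2 => //; apply: Ck2_comp => //; rewrite rt0.
have dot0 : 0 < c * dot2 (F (r t0)) (E t0).
  rewrite rt0 -ft fe -et.
  have -> : c * dot2 (c *: e t0) (e t0) = c ^+ 2 * dot2 (e t0) (e t0).
    by rewrite /dot2 !pairZ; ring.
  by rewrite mulr_gt0// ?dot2_gt0// exprn_even_gt0.
have n1 := near_gt0 cdot dot0.
have nF0 : {for s0, continuous (fun s => dot2 (e t0) (F s))}.
  by apply: (@Ck_cont1 _ k.+1); apply: Ck_dot2 => //; exact: Ck2_cst.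
have nE0 : {for t0, continuous (fun s => dot2 (e t0) (E s))}.
  by apply: (@Ck_cont1 _ k.+1); apply: Ck_dot2 => //; exact: Ck2_cst.
have n2 : \forall t \near t0, dot2 (e t0) (F (r t)) != 0.
  have H : \forall s \near r t0, dot2 (e t0) (F s) != 0.
    rewrite rt0; apply: near_neq0 => //.
    rewrite -ft fe /dot2 !pairZ.
    have -> : (e t0).1 * (c * (e t0).1) + (e t0).2 * (c * (e t0).2) =
       c * dot2 (e t0) (e t0) by rewrite /dot2; ring.
    by rewrite mulf_neq0// ?gt_eqF// ?dot2_gt0//.
  exact: cr _ H.
have n3 : \forall t \near t0, dot2 (e t0) (E t) != 0.
  by apply: near_neq0 => //; rewrite -et gt_eqF// dot2_gt0.
have n4 : \forall t \near t0, slope (e t0) F (r t) = slope (e t0) E t.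
  have H : \forall y \near slope (e t0) E t0, slope (e t0) F (G y) = y.
    by rewrite mE0; exact: GK.
  exact: cE _ H.
have n5 : \forall t \near t0, side b s0 (r t) -> f (r t) = F (r t).
  have H : \forall s \near r t0, side b s0 s -> f s = F s.
    by rewrite rt0; exact: germ2_near fF.
  exact: cr _ H.
have n6 : \forall t \near t0, side b t0 t -> side b s0 (r t).
  have n61 := isd_side b (Ck_derive1 CmE) mE'.
  have n62 : \forall t \near t0, let y := slope (e t0) E t in
      (0 <= y -> s0 <= G y) /\ (y <= 0 -> G y <= s0).
    have H : \forall y \near slope (e t0) E t0, (0 <= y -> s0 <= G y) /\ (y <= 0 -> G y <= s0).
      by rewrite mE0.
    exact: cE _ H.
  apply: filterS2 n61 n62 => t h1 [h2 h3] /h1; rewrite mE0 /r.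
  by case: (b) => /= [/h2|/h3].
have n7 := germ2_near eE.
near=> t => bt.
have bs : side b s0 (r t) by move: bt; near: t.
have -> : f (r t) = F (r t) by move: bs; near: t.
have -> : e t = E t by move: bt; near: t.
split => //; last by near: t.
have a1 : dot2 (e t0) (F (r t)) != 0 by near: t.
have a2 : dot2 (e t0) (E t) != 0 by near: t.
have : slope (e t0) F (r t) = slope (e t0) E t by near: t.
move/eqP; rewrite /slope eqr_div// => /eqP H.
have : dot2 (e t0) (e t0) * det2 (F (r t)) (E t) = 0.
  have -> : dot2 (e t0) (e t0) * det2 (F (r t)) (E t) =
    det2 (e t0) (E t) * dot2 (e t0) (F (r t)) - det2 (e t0) (F (r t)) * dot2 (e t0) (E t).
    by rewrite /dot2 /det2; ring.
  by rewrite H subrr.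
move/eqP; rewrite mulf_eq0 gt_eqF ?dot2_gt0//=.
by move/eqP.
Unshelve. all: by end_near. Qed.

End PlaneCurves.

(** * Curves that rotate about the origin *)

Section Periodic.
Context {R : realType}.
Implicit Types (r s t : R) (b : bool).

Lemma perZ {A : Type} (T : R) (h : R -> A) : (forall t, h (t + T) = h t) ->
  forall (n : int) t, h (t + n%:~R * T) = h t.
Proof.
move=> hT n t.
have H (m : nat) u : h (u + m%:R * T) = h u.
  elim: m => [|m IH]; first by rewrite mul0r addr0.
  by rewrite -natr1 mulrDl mul1r addrA hT IH.
case: n => n; first by rewrite -pmulrn H.
by rewrite NegzE mulrNz -[LHS](H n.+1) -addrA -pmulrn mulNr addNr addr0.
Qed.

Lemma shift_itv (T : R) : 0 < T -> forall t a,
  exists n : int, a <= t + n%:~R * T < a + T.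
Proof.
move=> T0 t a; exists (- Num.floor ((t - a) / T)).
have := floor_itv ((t - a) / T); set n := Num.floor _ => /andP[].
rewrite ler_pdivlMr// ltr_pdivrMr// intrD mulrDl mul1r mulrNz mulNr => h1 h2.
by apply/andP; split; lra.
Qed.

Lemma int_mul_small (T : R) (n : int) : 0 < T ->
  0 <= n%:~R * T -> n%:~R * T < T -> n = 0.
Proof.
move=> T0; rewrite pmulr_lge0// -{2}[T]mul1r ltr_pM2r// ler0z ltrz1 => n0 n1.
by apply/eqP; rewrite eq_le n0 andbT -ltzD1.
Qed.

Lemma det2_0P (u v : R * R) : v != 0 -> det2 u v = 0 ->
  u = (dot2 u v / dot2 v v) *: v.
Proof.
move=> v0 uv; have vv : dot2 v v != 0 by rewrite gt_eqF// dot2_gt0.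
apply: (@scalerI _ _ (dot2 v v)) => //; rewrite scalerA mulrC divfK//.
move: uv; rewrite /det2 /dot2 => /eqP; rewrite subr_eq0 => /eqP uv.
rewrite [LHS]surjective_pairing [RHS]surjective_pairing !pairZ; congr pair.
  have -> : (v.1 * v.1 + v.2 * v.2) * u.1 = v.1 * v.1 * u.1 + v.2 * (u.1 * v.2) by ring.
  by rewrite uv; ring.
have -> : (v.1 * v.1 + v.2 * v.2) * u.2 = v.1 * (u.2 * v.1) + v.2 * v.2 * u.2 by ring.
by rewrite -uv; ring.
Qed.

Lemma dot2Zl (c : R) u v : dot2 (c *: u) v = c * dot2 u v.
Proof. by rewrite /dot2 !pairZ; ring. Qed.

Implicit Types f : R -> R * R.

Lemma germs_cont1 f t : (forall b, exists F, germ2 b 2 f F t) ->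
  {for t, continuous (fun s => (f s).1)}.
Proof.
move=> fgerm; have [F [F1 _]] := fgerm true; have [G [G1 _]] := fgerm false.
exact: (germ_cont F1 G1).
Qed.

Lemma germs_cont2 f t : (forall b, exists F, germ2 b 2 f F t) ->
  {for t, continuous (fun s => (f s).2)}.
Proof.
move=> fgerm; have [F [_ F1]] := fgerm true; have [G [_ G1]] := fgerm false.
exact: (germ_cont F1 G1).
Qed.

Lemma germs_cont_det f v t : (forall b, exists F, germ2 b 2 f F t) ->
  {for t, continuous (fun s => det2 v (f s))}.
Proof.
move=> fgerm; apply: (@continuousB _ _ _ (fun s => v.1 * (f s).2) (fun s => v.2 * (f s).1) t).
  by apply: continuousM; [exact: cst_continuous | exact: germs_cont2].
by apply: continuousM; [exact: cst_continuous | exact: germs_cont1].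
Qed.

(** Closed curves that turn once about the origin per period: [rot_pos] makes
    the angle increase and [rot_inj] excludes a second turn. *)
Record rotating (T : R) (f : R -> R * R) : Prop := Rotating {
  rot_T0 : 0 < T;
  rot_per : forall t, f (t + T) = f t;
  rot_germ : forall t b, exists F, germ2 b 2 f F t;
  rot_pos : forall t b F, germ2 b 1 f F t -> 0 < det2 (f t) (der F t);
  rot_inj : forall t s (c : R),
    0 < c -> f s = c *: f t -> t <= s -> s < t + T -> s = t }.

Variables (T : R) (f : R -> R * R).
Hypothesis Hf : rotating T f.

Let T0 : 0 < T. Proof. by case: Hf. Qed.
Let fT : forall t, f (t + T) = f t. Proof. by case: Hf. Qed.
Let fgerm : forall t b, exists F, germ2 b 2 f F t. Proof. by case: Hf. Qed.
Let frot : forall t b F, germ2 b 1 f F t -> 0 < det2 (f t) (der F t).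
Proof. by case: Hf. Qed.
Let finj : forall t s (c : R), 0 < c -> f s = c *: f t -> t <= s -> s < t + T -> s = t.
Proof. by case: Hf. Qed.

Let fn0 t : f t != 0.
Proof.
have [F /(germ2_le (isT : (1 <= 2)%N)) /frot] := fgerm t true.
by apply: contraTneq => ->; rewrite /det2 !mul0r subrr ltxx.
Qed.

Lemma rot_side t : exists2 e, 0 < e & forall s,
  (t < s -> s <= t + e -> 0 < det2 (f t) (f s)) /\
  (t - e <= s -> s < t -> det2 (f t) (f s) < 0).
Proof.
have key b F : germ2 b 2 f F t -> \forall s \near t,
    (t < s -> 0 < det2 (f t) (F s)) /\ (s < t -> det2 (f t) (F s) < 0).
  move=> fF; have CF := Ck2_isd2 (germ2_Ck2 fF).
  have d := frot (germ2_le (isT : (1 <= 2)%N) fF).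
  have := isd_incr (isd_eq (isd2_det (isd2_cst (f t) t) CF) (erefl _)).
  rewrite [X in 0 < X + _]/det2 !mul0r subrr add0r -(germ2_at fF) det2vv.
  exact.
have [F fF] := fgerm t true; have [G fG] := fgerm t false.
have [e e0 He] := near_itv (filterI (filterI (germ2_near fF) (germ2_near fG))
  (filterI (key _ _ fF) (key _ _ fG))).
exists e => // s; split => h1 h2.
  have [|[h3 _] [[h5 _] _]] := He s; first by apply/andP; split; lra.
  by rewrite h3 /=; [exact: h5 | exact: ltW].
have [|[_ h3] [_ [_ h5]]] := He s; first by apply/andP; split; lra.
by rewrite h3 /=; [exact: h5 | exact: ltW].
Qed.

Let paral t s : det2 (f t) (f s) = 0 -> exists2 c, c != 0 & f s = c *: f t.
Proof.
move=> d; exists (dot2 (f s) (f t) / dot2 (f t) (f t)).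
  apply: contraNneq (fn0 s) => c0; rewrite (@det2_0P (f s) (f t)) ?c0 ?scale0r//.
  by rewrite det2C d oppr0.
by apply: det2_0P => //; rewrite det2C d oppr0.
Qed.

Definition is_opp t s := [/\ t < s, s < t + T & exists2 c, c < 0 & f s = c *: f t].

(** The function [det2 (f t)] along the curve is positive just after [t] and
    negative just before [t + T]. At a zero in between the two vectors are
    parallel, and [rot_inj] leaves only opposite directions. *)
Lemma opp_ex t : exists s, is_opp t s.
Proof.
have [e e0 He] := rot_side t; have [e' e'0 He'] := rot_side (t + T).
pose d := Num.min e (Num.min e' (T / 3)).
have d0 : 0 < d by rewrite !lt_min e0 e'0 divr_gt0.
have de : d <= e by rewrite ge_min lexx.
have de' : d <= e' by rewrite !ge_min lexx !orbT.
have dT : d <= T / 3 by rewrite !ge_min lexx !orbT.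
have p1 : 0 < det2 (f t) (f (t + d)) by apply: (He _).1; lra.
have p2 : det2 (f t) (f (t + T - d)) < 0 by rewrite -{1}fT; apply: (He' _).2; lra.
have [|||s /andP[s1 s2] /paral[c c0 fs]] := @ivt0 _ (fun s => det2 (f t) (f s)) (t + d) (t + T - d).
- by lra.
- by move=> r _; exact: germs_cont_det (fgerm r).
- by rewrite pmulr_rle0// ltW.
exists s; split; [lra | lra |]; exists c => //.
rewrite lt_neqAle c0 /= leNgt; apply/negP => c1.
have := finj c1 fs; lra.
Qed.

Lemma inj_mod t s c : 0 < c -> f s = c *: f t -> exists n : int, s = t + n%:~R * T.
Proof.
move=> c0 fs; have [n /andP[n1 n2]] := shift_itv T0 s t.
exists (- n); have := finj c0 _ n1 n2; rewrite (perZ fT) => /(_ fs) <-.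
by rewrite mulrNz mulNr addrK.
Qed.

Lemma is_opp_uniq t s s' : is_opp t s -> is_opp t s' -> s = s'.
Proof.
wlog ss' : s s' / s <= s'.
  move=> H; have [h|h] := leP s s' => h1 h2; first exact: H.
  by apply/esym/H => //; exact: ltW.
move=> [h1 h2 [c c0 fs]] [h3 h4 [c' c'0 fs']].
apply/esym/(@finj s s' (c' / c)) => //; last by lra.
  by rewrite nmulr_rgt0// invr_lt0.
by rewrite fs' fs scalerA divfK// lt_eqF.
Qed.

Definition opp t := xget t [set s | is_opp t s].

Lemma oppP t : is_opp t (opp t).
Proof. exact: (@xgetPex _ t [set s | is_opp t s] (opp_ex t)). Qed.

Lemma opp_uniq t s : is_opp t s -> opp t = s.
Proof. by move=> h; exact: is_opp_uniq (oppP t) h. Qed.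

Lemma opp_opp t : opp (opp t) = t + T.
Proof.
have [h1 h2 [c c0 fs]] := oppP t.
apply: opp_uniq; split; [by []|by rewrite ltrD2r|].
exists c^-1; first by rewrite invr_lt0.
by rewrite fT fs scalerA mulVf ?scale1r// lt_eqF.
Qed.

Lemma opp_per t : opp (t + T) = opp t + T.
Proof.
have [h1 h2 [c c0 fs]] := oppP t.
apply: opp_uniq; split; [by rewrite ltrD2r|by rewrite ltrD2r|].
by exists c => //; rewrite !fT.
Qed.

Lemma opp_sign t r : t < r -> r < opp t -> 0 < det2 (f t) (f r).
Proof.
move=> tr rt; have [h1 h2 [c c0 fs]] := oppP t.
have nz s : t < s -> s < opp t -> det2 (f t) (f s) != 0.
  move=> ts st; apply/eqP => /paral[c' c'0 fs'].
  have [c1|c1] := ltP 0 c'; first by have := finj c1 fs'; lra.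
  have : opp t = s.
    apply: opp_uniq; split; [by []|lra|].
    by exists c' => //; rewrite lt_neqAle c'0.
  by move=> H; move: st; rewrite H ltxx.
rewrite ltNge; apply/negP => dr.
have [e e0 He] := rot_side t.
pose s := Num.min (t + e) r.
have ts : t < s by rewrite lt_min tr ltrDl e0.
have se : s <= t + e by rewrite ge_min lexx.
have sr : s <= r by rewrite ge_min lexx orbT.
have p1 : 0 < det2 (f t) (f s) by apply: (He _).1.
have [||q /andP[q1 q2] /eqP] := @ivt0 _ (fun s => det2 (f t) (f s)) s r sr.
- by move=> q _; exact: germs_cont_det (fgerm q).
- by rewrite pmulr_rle0.
by apply/negP/nz; lra.
Qed.

(** From [0] to [opp 0] the curve makes half a turn, hence meets the line of
    [v]; if it does so on the wrong ray, the opposite parameter is on the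
    right one. *)
Lemma ray_ex v : v != 0 -> exists t, exists2 c, 0 < c & f t = c *: v.
Proof.
move=> v0; have [h1 h2 [c c0 fs]] := oppP 0.
have [||s _ sv] := @ivt0 _ (fun s => det2 v (f s)) 0 (opp 0) (ltW h1).
- by move=> r _; exact: germs_cont_det (fgerm r).
- by rewrite fs det2Zr mulrCA -expr2 mulr_le0_ge0 ?sqr_ge0// ltW.
have fv : f s = (dot2 (f s) v / dot2 v v) *: v by apply: det2_0P => //; rewrite det2C sv oppr0.
move: fv; set d := _ / _ => fv.
have d0 : d != 0 by apply: contraNneq (fn0 s) => d0; rewrite fv d0 scale0r.
have [d1|d1] := ltP 0 d; first by exists s, d.
have [_ _ [c' c'0 fs']] := oppP s.
exists (opp s), (c' * d); last by rewrite fs' fv scalerA.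
by rewrite nmulr_rgt0// lt_neqAle d0.
Qed.

Lemma opp_germ t b : exists r : R -> R, [/\ germ b 2 opp r t, 0 < derive1 r t &
  \forall s \near t, side b t s -> side b (opp t) (opp s)].
Proof.
have [h1 h2 [c c0 fs]] := oppP t.
have [F fF] := fgerm (opp t) b; have [E fE] := fgerm t b.
have dF := frot (germ2_le (isT : (1 <= 2)%N) fF).
have dE := frot (germ2_le (isT : (1 <= 2)%N) fE).
rewrite (germ2_at fF) in dF; rewrite (germ2_at fE) in dE.
have c0' : c != 0 by rewrite lt_eqF.
have [r [Cr rt r' Hr]] := solve_germ fF dF fE dE fs c0'.
have Cr1 : Ck 2 (fun s => r s - s) t by apply: CkB Cr _; exact: Ck_id.
have cr := Ck_cont1 Cr1.
have n1 : \forall s \near t, 0 < r s - s.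
  by apply: (near_gt0 cr); rewrite rt subr_gt0.
have Cr2 : Ck 2 (fun s => T - (r s - s)) t by apply: CkB Cr1; exact: Ck_cst.
have cr2 := Ck_cont1 Cr2.
have n2 : \forall s \near t, 0 < T - (r s - s).
  by apply: (near_gt0 cr2); rewrite rt; lra.
have Hopp : \forall s \near t, side b t s -> opp s = r s.
  apply: filterS3 n1 n2 Hr => s m1 m2 Hs /Hs[_ d1 d2].
  apply: opp_uniq; split; [lra|lra|].
  exists (dot2 (f (r s)) (f s) / dot2 (f s) (f s)); last exact: det2_0P.
  by move: d2; rewrite nmulr_rgt0// => d2; rewrite pmulr_llt0// invr_gt0 dot2_gt0.
exists r; split => //.
apply: filterS2 Hopp Hr => s Ho Hs bs; rewrite Ho//.
by have [] := Hs bs.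
Qed.

End Periodic.

(** * Convex curves and their interiors *)

Lemma vec_eq (A B : Type) (u v : A * B) : u.1 = v.1 -> u.2 = v.2 -> u = v.
Proof. by case: u v => [? ?] [? ?] /= -> ->. Qed.

Lemma fstD (A B : zmodType) (u v : A * B) : (u + v).1 = u.1 + v.1. Proof. by []. Qed.
Lemma sndD (A B : zmodType) (u v : A * B) : (u + v).2 = u.2 + v.2. Proof. by []. Qed.
Lemma fstN (A B : zmodType) (u : A * B) : (- u).1 = - u.1. Proof. by []. Qed.
Lemma sndN (A B : zmodType) (u : A * B) : (- u).2 = - u.2. Proof. by []. Qed.
Definition pairE {R : realType} := (@fstZ R, @sndZ R, @fstD R R, @sndD R R, @fstN R R, @sndN R R).

Ltac vring := apply: vec_eq; rewrite ?pairE /=; ring.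

Section ConvexCurves.
Context {R : realType}.
Implicit Types (r s t : R) (b : bool) (X Y : R -> R * R) (z w p v : R * R).

(** Convexity is imposed on the two one-sided tangents at each parameter,
    through the derivatives of the germs; this covers smooth points and
    corners alike. *)
Record ccurve (T : R) (x : R -> R * R) (C : set (R * R)) : Prop := CCurve {
  cc_T0 : 0 < T;
  cc_per : forall t, x (t + T) = x t;
  cc_C : C = range x;
  cc_inj : forall t s, x s = x t -> t <= s -> s < t + T -> s = t;
  cc_germ : forall t b, exists X, germ2 b 2 x X t;
  cc_reg : forall t b X, germ2 b 1 x X t -> der X t != 0;
  cc_conv : forall t b X s, germ2 b 1 x X t -> 0 <= det2 (der X t) (x s - x t) }.

Definition inside (x : R -> R * R) z :=
  forall t b X, germ2 b 1 x X t -> 0 < det2 (der X t) (z - x t).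

Lemma germ2_shift b (x : R -> R * R) X t c : (forall s, x (s - c) = x s) -> germ2 b 1 x X t ->
  germ2 b 1 x (fun s => X (s - c)) (t + c) /\ der (fun s => X (s - c)) (t + c) = der X t.
Proof.
move=> xc xX; split.
  have Cg : Ck 1 (fun s => s - c) (t + c) by apply: CkB; [exact: Ck_id | exact: Ck_cst].
  have -> : x = (fun s => x (s - c)) by apply/funext => s; rewrite xc.
  apply: (@germ2_comp _ b 1 x X (fun s => s - c)); first by rewrite addrK.
    exact: germ_Ck.
  by near=> s; rewrite addrK; case: b {xX} => /=; lra.
have dX : isd2 X (t + c - c) (der X t) by rewrite addrK; exact: Ck2_isd2 (germ2_Ck2 xX).
have dc : is_derive (t + c : R) 1 (fun s => s - c) 1.
  by apply: isd_eq (isdB (is_derive_id _ _) (is_derive_cst c _ _)) _; rewrite subr0.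
by rewrite (isd2_der (@isd2_comp _ X (fun s => s - c) _ _ _ dX dc)) scale1r.
Unshelve. all: by end_near. Qed.

Lemma germ2_nearby b k (x : R -> R * R) X t : germ2 b k x X t ->
  \forall r \near t, side b t r -> r != t ->
    (\forall q \near r, x q = X q) /\ (forall b', germ2 b' k x X r).
Proof.
move=> xX; have CX := germ2_Ck2 xX.
have [e e0 He] := near_itv (germ2_near xX).
have [nC1 nC2] := CX.
near=> r => br rt.
have Cr1 : Ck k (fun s => (X s).1) r by near: r; exact: Ck_nbhs.
have Cr2 : Ck k (fun s => (X s).2) r by near: r; exact: Ck_nbhs.
have /andP[r1 r2] : t - e < r < t + e by near: r; apply: (itv_near e0).
have xXr : \forall q \near r, x q = X q.
  case: b {xX} He br => /= He br.
    have tr : t < r by rewrite lt_neqAle eq_sym rt.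
    pose d := Num.min (r - t) (t + e - r).
    have d0 : 0 < d by rewrite lt_min; apply/andP; split; lra.
    apply: (itv_near d0) => q /andP[q1 q2].
    have dd : d <= r - t by rewrite ge_min lexx.
    have dd' : d <= t + e - r by rewrite ge_min lexx orbT.
    by apply: He; [apply/andP; split|]; lra.
  have tr : r < t by rewrite lt_neqAle rt.
  pose d := Num.min (t - r) (r - (t - e)).
  have d0 : 0 < d by rewrite lt_min; apply/andP; split; lra.
  apply: (itv_near d0) => q /andP[q1 q2].
  have dd : d <= t - r by rewrite ge_min lexx.
  have dd' : d <= r - (t - e) by rewrite ge_min lexx orbT.
  by apply: He; [apply/andP; split|]; lra.
split => // b'; apply: germ2P => //.
by near=> q => _; near: q.
Unshelve. all: by end_near. Qed.

Variables (T : R) (x : R -> R * R) (C : set (R * R)).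
Hypothesis Hx : ccurve T x C.

Let T0 := cc_T0 Hx.

Lemma cc_memP z : C z <-> exists t, z = x t.
Proof.
by rewrite (cc_C Hx); split=> [[t _ <-]|[t ->]]; exists t.
Qed.

Lemma cc_mem t : C (x t). Proof. by apply/cc_memP; exists t. Qed.

Lemma cc_conv_C t b X z : C z -> germ2 b 1 x X t -> 0 <= det2 (der X t) (z - x t).
Proof. by move=> /cc_memP[s ->]; exact: (cc_conv Hx). Qed.

Lemma inside_notC z : inside x z -> ~ C z.
Proof.
move=> zi /cc_memP[t zt]; have [X /(germ2_le (isT : (1 <= 2)%N)) xX] := cc_germ Hx t true.
by have := zi t true X xX; rewrite zt subrr /det2 !mulr0 subrr ltxx.
Qed.

(** From a point that is not strictly to the left of some tangent, the ray
    that leaves this tangent orthogonally to the right goes to infinity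
    without meeting [C], so the component of the point is unbounded. *)
Lemma region_inside z : region C z -> inside x z.
Proof.
move=> [nCz bz] t b X xX; rewrite ltNge; apply/negP => dz.
pose v := der X t; pose d : R * R := (v.2, - v.1).
have vd : det2 v d < 0.
  have := dot2_gt0 (cc_reg Hx xX); rewrite -/v /det2 /dot2 /d /=; lra.
pose L := [set z + l *: d | l in `[0, +oo[%classic].
have cL : connected L.
  apply: connected_continuous_connected.
    by apply/connected_intervalP; exact: interval_is_interval.
  apply: continuous_subspaceT => l; apply: cvgD; first exact: cvg_cst.
  by apply: cvgZl; exact: cvg_id.
have Lz : L z by exists 0; rewrite /= ?in_itv/= ?lexx// scale0r addr0.
have LC : L `<=` ~` C.
  move=> _ [l /= + <-] Cl; rewrite in_itv/= andbT le_eqVlt => /predU1P[l0|l0].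
    by move: Cl; rewrite -l0 scale0r addr0.
  have := cc_conv_C Cl xX; rewrite addrAC det2Dr det2Zr leNgt => /negP; apply.
  have : l * det2 v d < 0 by rewrite pmulr_rlt0.
  by rewrite -/v; move: dz; rewrite -/v; lra.
have LK := connected_component_max Lz LC cL.
have [M [_ HM]] := bz.
have bd l : 0 <= l -> `|z + l *: d| <= M + 1.
  move=> l0; apply: (HM (M + 1)); first by lra.
  by apply: LK; exists l => //=; rewrite in_itv/= l0.
have d0 : d != 0.
  by apply: contraTneq vd => ->; rewrite /det2 !mulr0 subrr ltxx.
have nd : 0 < `|d| by rewrite normr_gt0.
have M0 : 0 <= M + 1 + `|z|.
  by apply: addr_ge0 => //; apply: le_trans (bd 0 (lexx _)); exact: normr_ge0.
have l0 : 0 <= (M + 1 + `|z| + 1) / `|d| by rewrite divr_ge0// ler_wpDr.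
have := bd _ l0.
have : `|(M + 1 + `|z| + 1) / `|d| *: d| <= `|z + (M + 1 + `|z| + 1) / `|d| *: d| + `|z|.
  by rewrite -{1}[_ *: d](addKr z) addrC; apply: le_trans (ler_normD _ _) _; rewrite normrN.
rewrite normrZ ger0_norm// divfK ?gt_eqF//; lra.
Qed.

Section WithP.
Variable p : R * R.
Hypothesis pin : inside x p.

Definition from_pt t := x t - p.

Lemma from_pt_per t : from_pt (t + T) = from_pt t.
Proof. by rewrite /from_pt (cc_per Hx). Qed.

Lemma germ2_cst b k v t : germ2 b k (fun=> v) (fun=> v) t.
Proof. by split; apply: germ_Ck; exact: Ck_cst. Qed.

Lemma from_pt_germ t b : exists F, germ2 b 2 from_pt F t.
Proof.
have [X xX] := cc_germ Hx t b; exists (fun s => X s - p).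
by apply: germ2B => //; exact: germ2_cst.
Qed.

Lemma from_pt_der t b F : germ2 b 1 from_pt F t -> exists2 X, germ2 b 1 x X t & der F t = der X t.
Proof.
move=> fF; have [X xX] := cc_germ Hx t b.
have xX1 := germ2_le (isT : (1 <= 2)%N) xX.
exists X => //.
rewrite (germ2_unique fF (germ2B xX1 (germ2_cst b 1 p t))).
by rewrite (isd2_der (isd2B (Ck2_isd2 (germ2_Ck2 xX1)) (isd2_cst p t))) subr0.
Qed.

Lemma from_pt_rot t b F : germ2 b 1 from_pt F t -> 0 < det2 (from_pt t) (der F t).
Proof.
move=> /from_pt_der[X xX ->]; rewrite det2C -det2Nr opprB.
exact: pin xX.
Qed.

(** The support line at [x t] separates [p] from whatever lies beyond [x t] on
    the ray from [p]. *)
Lemma from_pt_le1 t s c : from_pt s = c *: from_pt t -> c <= 1.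
Proof.
move=> fs; have [X /(germ2_le (isT : (1 <= 2)%N)) xX] := cc_germ Hx t true.
have h1 := pin xX; have := cc_conv Hx s xX.
have -> : x s - x t = (1 - c) *: (p - x t).
  have -> : x s - x t = from_pt s - from_pt t by rewrite /from_pt; vring.
  by rewrite fs /from_pt; vring.
by rewrite det2Zr pmulr_lge0// subr_ge0.
Qed.

Lemma from_pt_inj t s c : 0 < c -> from_pt s = c *: from_pt t -> t <= s -> s < t + T -> s = t.
Proof.
move=> c0 fs; apply: (cc_inj Hx).
have c1 := from_pt_le1 fs.
have : c^-1 <= 1 by apply: (@from_pt_le1 s t); rewrite fs scalerA mulVf ?scale1r// gt_eqF.
rewrite invf_le1// => c2.
have cE : c = 1 by apply/eqP; rewrite eq_le c1 c2.
by move: fs; rewrite cE scale1r /from_pt => /addIr.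
Qed.

(** The curve turns counterclockwise about [p] because [p] lies strictly to
    the left of all tangents. *)
Lemma from_pt_rotating : rotating T from_pt.
Proof. by split; [exact: T0 | exact: from_pt_per | exact: from_pt_germ | exact: from_pt_rot | exact: from_pt_inj]. Qed.

Lemma from_pt_ray v : v != 0 -> exists t, exists2 c, 0 < c & from_pt t = c *: v.
Proof. exact: ray_ex from_pt_rotating v. Qed.

(** The point of [C] on the ray from [p] through [z] cannot come before [z].
    If it comes after, then [z] is a proper convex combination of it and [p].
    *)
Lemma hull_split z :
  (forall t b X, germ2 b 1 x X t -> 0 <= det2 (der X t) (z - x t)) -> C z \/ inside x z.
Proof.
move=> zh.
have [->|zp] := eqVneq z p; first by right.
have zp0 : z - p != 0 by rewrite subr_eq0.
have [r [c c0 fr]] := from_pt_ray zp0.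
have xr : x r = p + c *: (z - p) by rewrite -fr /from_pt addrC subrK.
have dz t b X : germ2 b 1 x X t ->
   c * det2 (der X t) (z - x t) =
   det2 (der X t) (x r - x t) + (c - 1) * det2 (der X t) (p - x t).
  by move=> _; rewrite xr /det2 !pairE; ring.
have c1 : 1 <= c.
  have [X /(germ2_le (isT : (1 <= 2)%N)) xX] := cc_germ Hx r true.
  have := dz _ _ _ xX; rewrite subrr [X in _ = X + _]/det2 !mulr0 subrr add0r => H.
  have h1 := pin xX; have h2 := zh _ _ _ xX.
  have : 0 <= (c - 1) * det2 (der X r) (p - x r) by rewrite -H mulr_ge0// ltW.
  by rewrite pmulr_lge0// subr_ge0.
move: c1; rewrite le_eqVlt => /predU1P[c1|c1].
  by left; apply/cc_memP; exists r; rewrite xr -c1 scale1r addrC subrK.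
right => t b X xX; have := dz _ _ _ xX => H.
rewrite -(pmulr_rgt0 _ c0) H; apply: ltr_wpDl; first exact: (cc_conv Hx) xX.
by apply: mulr_gt0; [rewrite subr_gt0 | exact: pin xX].
Qed.

End WithP.
End ConvexCurves.

Lemma cont_det2 {R : realType} (A : topologicalType) (f g : A -> R * R) :
  continuous f -> continuous g -> continuous (fun q => det2 (f q) (g q)).
Proof.
move=> cf cg q.
have f1 : (f r).1 @[r --> q] --> (f q).1.
  by apply: (@continuous_comp _ _ _ f fst); [exact: cf | exact: cvg_fst].
have f2 : (f r).2 @[r --> q] --> (f q).2.
  by apply: (@continuous_comp _ _ _ f snd); [exact: cf | exact: cvg_snd].
have g1 : (g r).1 @[r --> q] --> (g q).1.
  by apply: (@continuous_comp _ _ _ g fst); [exact: cg | exact: cvg_fst].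
have g2 : (g r).2 @[r --> q] --> (g q).2.
  by apply: (@continuous_comp _ _ _ g snd); [exact: cg | exact: cvg_snd].
exact: cvgB (cvgM f1 g2) (cvgM f2 g1).
Qed.

Lemma cont_sub2 {R : realType} (A : topologicalType) (f g : A -> R * R) :
  continuous f -> continuous g -> continuous (fun q => f q - g q).
Proof. by move=> cf cg q; exact: (@cvgB _ (R * R)%type _ _ _ _ _ _ _ (cf q) (cg q)). Qed.

Section Inside.
Context {R : realType}.
Implicit Types (r s t : R) (b : bool) (X Y : R -> R * R) (z w p v : R * R).
Variables (T : R) (x : R -> R * R) (C : set (R * R)).
Hypothesis Hx : ccurve T x C.

Let T0 := cc_T0 Hx.

Lemma cc_cont : continuous x.
Proof.
move=> t.
have h1 : (x s).1 @[s --> t] --> (x t).1 by exact: (germs_cont1 (cc_germ Hx t)).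
have h2 : (x s).2 @[s --> t] --> (x t).2 by exact: (germs_cont2 (cc_germ Hx t)).
have H : ((x s).1, (x s).2) @[s --> t] --> ((x t).1, (x t).2) by exact: cvg_pair h1 h2.
have E : (fun s => ((x s).1, (x s).2)) = x by apply/funext => s; case: (x s).
by rewrite E -surjective_pairing in H.
Qed.

Lemma cc_compact : compact C.
Proof.
have -> : C = x @` `[0, T]%classic.
  rewrite (cc_C Hx); apply/seteqP; split => [_ [t _ <-]|_ [t _ <-]]; last by exists t.
  have [n /andP[n1 n2]] := shift_itv T0 t 0.
  exists (t + n%:~R * T); last by rewrite (perZ (cc_per Hx)).
  by rewrite /= in_itv/=; apply/andP; split; lra.
apply: continuous_compact; last exact: segment_compact.
by apply: continuous_subspaceT; exact: cc_cont.
Qed.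

(** The tangents considered at the ends [s] and [t] are the ones on the side
    of the interval; this makes the property additive in the sense of
    [cousin]. *)
Let unif z s t := exists2 e, 0 < e & forall z' : R * R,
  `|z'.1 - z.1| < e -> `|z'.2 - z.2| < e ->
  forall r b X, s <= r -> r <= t -> (if b then r < t else s < r) ->
    germ2 b 1 x X r -> 0 < det2 (der X r) (z' - x r).

Let unif_loc z t b : inside x z -> exists2 d, 0 < d & exists2 e, 0 < e &
  forall z' : R * R, `|z'.1 - z.1| < e -> `|z'.2 - z.2| < e ->
  forall r, side b t r -> `|r - t| <= d ->
  forall b' X, (r = t -> b' = b) -> germ2 b' 1 x X r -> 0 < det2 (der X r) (z' - x r).
Proof.
move=> zi; have [X xX2] := cc_germ Hx t b; have xX := germ2_le (isT : (1 <= 2)%N) xX2.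
have [CX1 CX2] := germ2_Ck2 xX2.
pose h r := det2 (der X r) (z - X r).
have CdX : Ck2 1 (der X) t by split; apply: Ck_D.
have Ch : Ck 1 h t.
  exact: Ck_det2 CdX (Ck2B (Ck2_cst 1 z t) (germ2_Ck2 xX)).
have ch := Ck_cont1 Ch.
have [CdX1 CdX2] := CdX.
have c1 := Ck_cont1 CdX1; have c2 := Ck_cont1 CdX2.
set m := h t.
have m0 : 0 < m by have := zi _ _ _ xX; rewrite (germ2_at xX).
pose M := `|(der X t).1| + `|(der X t).2| + 1.
have M0 : 0 < M by rewrite ltr_wpDl// addr_ge0.
have nh : \forall r \near t, m / 2 < h r.
  by apply: (ch [set y | m / 2 < y]); apply: lt_nbhsr; rewrite -/m; lra.
have nbd (f : R -> R) : {for t, continuous f} -> `|f t| < M -> \forall r \near t, `|f r| < M.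
  move=> cf fM; have : {for t, continuous (fun r => `|f r|)} by apply: cvg_norm.
  by move=> H; apply: (H [set y | y < M]); exact: lt_nbhsl.
have n1 : \forall r \near t, `|(der X r).1| < M.
  by apply: nbd => //; rewrite /M; have := normr_ge0 (der X t).2; lra.
have n2 : \forall r \near t, `|(der X r).2| < M.
  by apply: nbd => //; rewrite /M; have := normr_ge0 (der X t).1; lra.
have [d d0 Hd] := near_itv (filterI (germ2_nearby xX) (filterI nh (filterI n1 n2))).
exists d => //; exists (m / (4 * M)); first by rewrite divr_gt0// mulr_gt0.
move=> z' z1 z2 r br rd b' Y rtb xY.
have [|near_ [h1 [h2 h3]]] := Hd r.
  by move/ler_normlP: rd => [? ?]; apply/andP; split; lra.
have [dE xE] : der Y r = der X r /\ x r = X r.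
  have [rt|rt] := eqVneq r t.
    rewrite rt in xY rtb *; rewrite (rtb erefl) in xY.
    by rewrite (germ2_unique xY xX) (germ2_at xX).
  have [_ /(_ b') xXr] := near_ br rt.
  by rewrite (germ2_unique xY xXr) (germ2_at xXr).
rewrite dE xE.
have -> : det2 (der X r) (z' - X r) = h r + det2 (der X r) (z' - z).
  by rewrite /h /det2 !pairE; ring.
set e := m / (4 * M) in z1 z2.
have eM : 2 * (M * e) = m / 2 by rewrite /e; field; rewrite gt_eqF.
have e0 : 0 < e by rewrite divr_gt0// mulr_gt0.
have b1 : `|(der X r).1 * (z'.2 - z.2)| <= M * e by rewrite normrM ler_pM// ltW.
have b2 : `|(der X r).2 * (z'.1 - z.1)| <= M * e by rewrite normrM ler_pM// ltW.
rewrite /det2 !pairE.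
by move/ler_normlP: b1 => [? ?]; move/ler_normlP: b2 => [? ?]; lra.
Qed.

Lemma inside_unif z : inside x z -> exists2 e, 0 < e & forall z' : R * R,
  `|z'.1 - z.1| < e -> `|z'.2 - z.2| < e -> inside x z'.
Proof.
move=> zi.
have [e e0 He] : unif z 0 T.
  apply: (@cousin _ (unif z)); first exact: ltW.
    move=> s t r _ st tr _ [e1 e10 H1] [e2 e20 H2].
    exists (Num.min e1 e2) => [|z']; first by rewrite lt_min e10.
    rewrite !lt_min => /andP[a1 a2] /andP[a3 a4] q b X sq qr bq xX.
    case: b bq xX => /= bq xX.
      by have [qt|tq] := ltP q t; [apply: (H1 _ a1 a3 _ true) | apply: (H2 _ a2 a4 _ true)];
        rewrite // ltW.
    by have [qt|tq] := leP q t; [apply: (H1 _ a1 a3 _ false) | apply: (H2 _ a2 a4 _ false)];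
        rewrite // ltW.
  move=> t _ _.
  have [d1 d10 [e1 e10 H1]] := unif_loc t true zi.
  have [d2 d20 [e2 e20 H2]] := unif_loc t false zi.
  have dd : 0 < Num.min d1 d2 by rewrite lt_min d10.
  apply: (itv_near dd) => s /andP[s1 s2].
  have m1 : Num.min d1 d2 <= d1 by rewrite ge_min lexx.
  have m2 : Num.min d1 d2 <= d2 by rewrite ge_min lexx orbT.
  split => h1 h2.
    exists e2 => // z' a1 a2 r b X sr rt br xX.
    apply: (H2 _ a1 a2 _ _ _ b X) => //.
      by rewrite ler_norml; apply/andP; split; lra.
    by move=> E; move: br; case: (b) => //; rewrite E ltxx.
  exists e1 => // z' a1 a2 r b X sr rt br xX.
  apply: (H1 _ a1 a2 _ _ _ b X) => //.
    by rewrite ler_norml; apply/andP; split; lra.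
  by move=> E; move: br; case: (b) => //; rewrite E ltxx.
exists e => // z' a1 a2 t b X xX.
have [n /andP[n1 n2]] := shift_itv T0 t 0.
have xc m s : x (s - (m%:~R * T)) = x s.
  by rewrite -(perZ (cc_per Hx) m) subrK.
case: b xX => xX.
  have [xX' dX'] := germ2_shift (c := n%:~R * T) (xc n) xX.
  have := He z' a1 a2 _ true _ n1 _ _ xX'; rewrite dX' add0r in n2 *.
  by rewrite (perZ (cc_per Hx)); apply => //; exact: ltW.
have [n0|n0] := eqVneq (t + n%:~R * T) 0.
  have [xX' dX'] := germ2_shift (c := (n + 1)%:~R * T) (xc _) xX.
  have E : t + (n + 1)%:~R * T = T by rewrite intrD mulrDl mul1r addrA n0 add0r.
  have := He z' a1 a2 _ false _ _ _ _ xX'; rewrite dX' E.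
  have -> : x T = x t by rewrite -E (perZ (cc_per Hx)).
  by apply => //; exact: ltW.
have [xX' dX'] := germ2_shift (c := n%:~R * T) (xc n) xX.
have := He z' a1 a2 _ false _ n1 _ _ xX'; rewrite dX' add0r in n2 *.
rewrite (perZ (cc_per Hx)); apply; first exact: ltW.
by rewrite lt_neqAle eq_sym n0.
Qed.

Lemma inside_open : open (inside x).
Proof.
rewrite openE => z /inside_unif[e e0 He]; rewrite /interior.
apply/nbhs_ballP; exists e => //= z' [] /=; rewrite /ball /= => h1 h2.
by apply: He; rewrite distrC.
Qed.

(** The component of [z] stays inside, because the inside is open and, by
    [hull_split], closed in the complement of [C]. The inside is bounded: its
    points lie between [p] and a point of the compact set [C]. *)
Lemma inside_region p z : inside x p -> inside x z -> region C z.
Proof.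
move=> pin zi; split; first exact: inside_notC Hx _ zi.
set K := connected_component _ _.
have KC : K `<=` ~` C by exact: connected_component_sub.
have Kz : K z by apply: connected_component_refl; exact: inside_notC Hx _ zi.
pose hull : set (R * R) := [set w | forall t b X, germ2 b 1 x X t -> 0 <= det2 (der X t) (w - x t)].
have chull : closed hull.
  have -> : hull = \bigcap_(q in [set q : R * bool * (R -> R * R) | germ2 q.1.2 1 x q.2 q.1.1])
      [set w | 0 <= det2 (der q.2 q.1.1) (w - x q.1.1)].
    apply/seteqP; split => w H; first by move=> [[t b] X] /= xX; exact: H xX.
    by move=> t b X xX; exact: (H (t, b, X)).
  apply: closed_bigI => -[[t b] X] /= _.
  apply: (@preimage_closed _ _ (fun w : R * R => det2 (der X t) (w - x t)) [set y | 0 <= y]); last exact: closed_ge.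
  move=> w _; move: w; apply: cont_det2; first exact: cst_continuous.
  by apply: cont_sub2; [move=> ?; exact: cvg_id | exact: cst_continuous].
have Kin : K `<=` inside x.
  have <- : K `&` inside x = K; last by move=> w [].
  apply: (component_connected (A := ~` C) (x := z)).
  - by exists z.
  - by exists (inside x) => //; exact: inside_open.
  - exists hull => //; apply/seteqP; split => w [Kw wi]; split => //.
      by move=> t b X xX; exact: ltW (wi _ _ _ xX).
    by have [/(KC _ Kw)//|//] := hull_split Hx pin wi.
have [M HM] : exists M, forall t, `|x t| <= M.
  have /compact_bounded[M [_ HM]] := cc_compact.
  exists (M + 1) => t; apply: HM; first by rewrite ltrDl.
  exact: (cc_mem Hx).
exists (`|p| + (M + `|p|)); split; first by rewrite num_real.
move=> N hN w /Kin wi; apply: le_trans (ltW hN).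
have [->|wp] := eqVneq w p; first by rewrite lerDl addr_ge0// (le_trans _ (HM 0)).
have wp0 : w - p != 0 by rewrite subr_eq0.
have [t [c c0 ft]] := from_pt_ray Hx pin wp0.
have c1 : 1 <= c.
  have [X /(germ2_le (isT : (1 <= 2)%N)) xX] := cc_germ Hx t true.
  have h1 := wi _ _ _ xX; have h2 := pin _ _ _ xX.
  have xr : x t = p + c *: (w - p) by rewrite -ft /from_pt addrC subrK.
  have : c * det2 (der X t) (w - x t) = (c - 1) * det2 (der X t) (p - x t).
    by rewrite xr /det2 !pairE; ring.
  have : 0 < c * det2 (der X t) (w - x t) by rewrite mulr_gt0.
  by move=> + E; rewrite E pmulr_lgt0// subr_gt0 => /ltW.
have -> : w = p + c^-1 *: (x t - p).
  by rewrite -/(from_pt x p t) ft scalerA mulVf ?gt_eqF// scale1r addrC subrK.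
apply: le_trans (ler_normD _ _) _; rewrite lerD2l normrZ.
apply: (@le_trans _ _ (1 * `|x t - p|)).
  apply: ler_wpM2r => //; have ci : 0 <= c^-1 by rewrite invr_ge0 ltW.
  by rewrite ger0_norm// invf_le1.
by rewrite mul1r; apply: le_trans (ler_normB _ _) _; rewrite lerD2r.
Qed.

(** In an inscribed triangle of maximal area, every barycentric coordinate of
    a point [w] of [C] is at most one, since replacing a vertex by [w] does
    not increase the area. The supporting function at [x t] is affine and
    nonnegative at the three vertices, hence its value at [w] is at most the
    sum of its values there. *)
Lemma max_triangle p : inside x p -> exists A B D : R * R, [/\ C A, C B & C D] /\ 
  forall (t : R) (b : bool) (X : R -> R * R) (w : R * R), C w -> germ2 b 1 x X t ->
    det2 (der X t) (w - x t) <= det2 (der X t) (A - x t) +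
      det2 (der X t) (B - x t) + det2 (der X t) (D - x t).
Proof.
move=> pin.
pose area3 (q : (R * R) * (R * R) * (R * R)) := det2 (q.1.2 - q.1.1) (q.2 - q.1.1).
have cC := compact_setX (compact_setX cc_compact cc_compact) cc_compact.
have C0 : (C `*` C `*` C) !=set0 by exists (x 0, x 0, x 0); repeat split; exact: (cc_mem Hx).
have carea : continuous area3.
  have c11 : continuous (fun q : (R * R) * (R * R) * (R * R) => q.1.1).
    by move=> q; apply: (@continuous_comp _ _ _ fst fst); exact: cvg_fst.
  have c12 : continuous (fun q : (R * R) * (R * R) * (R * R) => q.1.2).
    by move=> q; apply: (@continuous_comp _ _ _ fst snd); [exact: cvg_fst | exact: cvg_snd].
  have c2 : continuous (fun q : (R * R) * (R * R) * (R * R) => q.2) by move=> q; exact: cvg_snd.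
  by apply: cont_det2; apply: cont_sub2.
have [[[A B] D] + Hmax] := compact_EVT_max C0 cC (continuous_subspaceT carea).
rewrite inE => -[[/= CA CB] CD].
exists A, B, D; split => // t b X w Cw xX.
have maxi A' B' D' : C A' -> C B' -> C D' -> area3 (A', B', D') <= area3 (A, B, D).
  by move=> *; apply: Hmax; rewrite inE.
set S := area3 (A, B, D) in maxi.
have nn z : C z -> 0 <= det2 (der X t) (z - x t) by move=> Cz; exact: (cc_conv_C Hx Cz xX).
have nA := nn _ CA; have nB := nn _ CB; have nD := nn _ CD.
have hA := maxi w B D Cw CB CD; have hB := maxi A w D CA Cw CD; have hD := maxi A B w CA CB Cw.
have bary : S * det2 (der X t) (w - x t) = area3 (w, B, D) * det2 (der X t) (A - x t)
  + area3 (A, w, D) * det2 (der X t) (B - x t) + area3 (A, B, w) * det2 (der X t) (D - x t).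
  by rewrite /S /area3 /det2 !pairE /=; ring.
(* The maximal area is positive: two points of [C] aligned with [p] and a third
   one between them form a nondegenerate triangle. *)
suff S0 : 0 < S by rewrite -(ler_pM2l S0) bary; nra.
have [h1 h2 [c c0 fc]] := oppP (from_pt_rotating Hx pin) 0.
set u := opp _ _ 0 in h1 h2 fc.
have u2 : 0 < u / 2 by rewrite divr_gt0.
have u2u : u / 2 < u by lra.
have := opp_sign (from_pt_rotating Hx pin) u2 u2u.
move=> d; apply: lt_le_trans (maxi (x 0) (x (u / 2)) (x u) (cc_mem Hx _) (cc_mem Hx _) (cc_mem Hx _)).
have -> : area3 (x 0, x (u / 2), x u) = det2 (from_pt x p 0) (from_pt x p (u / 2)) +
    det2 (from_pt x p (u / 2)) (from_pt x p u) - det2 (from_pt x p 0) (from_pt x p u).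
  by rewrite /area3 /from_pt /det2 !pairE /=; ring.
rewrite fc !det2Zr det2vv mulr0 subr0 (det2C (from_pt x p (u / 2))).
by move: d; nra.
Qed.

End Inside.

(** * Chords of the image pencil *)

(** Here [a t] is the image of [x t] under the involution. Parallelism of the
    two tangents enters through [Hpar]: a tangent at [a t] can meet [C] only
    in images of points where the tangent at [x t] meets it. *)
Section Chords.
Context {R : realType}.
Implicit Types (r t : R) (b : bool) (X Y A : R -> R * R) (z w v : R * R).
Variables (T : R) (x a : R -> R * R) (C : set (R * R)) (p : R * R).
Hypothesis Hx : ccurve T x C.
Hypothesis Ha : ccurve T a C.
Hypothesis Hpar : forall t b X A r, germ2 b 1 x X t -> germ2 b 1 a A t ->
  0 < det2 (der X t) (x r - x t) -> 0 < det2 (der A t) (a r - a t).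
Hypothesis pinx : inside x p.

Let T0 : 0 < T := cc_T0 Hx.
Let f := from_pt x p.
Let Hf : rotating T f := from_pt_rotating Hx pinx.

(** The other end of the chord of [C] through [x t] and [p]. *)
Definition partner := opp T f.
Local Notation u := partner.

Lemma partner_partner t : a (u (u t)) = a t.
Proof. by rewrite /partner (opp_opp Hf) (cc_per Ha). Qed.

Lemma chord_enters t b A : germ2 b 1 a A t -> 0 < det2 (der A t) (a (u t) - a t).
Proof.
move=> aA; have [X /(germ2_le (isT : (1 <= 2)%N)) xX] := cc_germ Hx t b.
apply: (Hpar xX aA).
have [_ _ [c c0 fc]] := oppP Hf t.
have -> : x (u t) - x t = (1 - c) *: (p - x t).
  have -> : x (u t) - x t = f (u t) - f t by rewrite /f /from_pt; vring.
  by rewrite /partner fc /f /from_pt; vring.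
rewrite det2Zr mulr_gt0//; first by lra.
exact: pinx xX.
Qed.

Lemma chord_enters_partner t b A : germ2 b 1 a A (u t) -> 0 < det2 (der A (u t)) (a t - a (u t)).
Proof. by move=> /chord_enters; rewrite partner_partner. Qed.

Lemma side_sign t A v : germ2 true 1 a A t -> 0 < det2 v (der A t) ->
  exists2 e, 0 < e & forall s, t < s -> s <= t + e -> 0 < det2 v (a s - a t).
Proof.
move=> aA d; have dA := Ck2_isd2 (germ2_Ck2 aA).
have d' : 0 < det2 0 (A t) + det2 v (der A t) by rewrite /det2 !mul0r subrr add0r.
have [e e0 He] := near_itv (filterI (germ2_near aA) (isd_incr (isd2_det (isd2_cst v t) dA) d')).
exists e => // s ts se.
have [|h1 [h2 _]] := He s; first by apply/andP; split; lra.
by rewrite h1 /= ?(ltW ts)// (germ2_at aA) det2Br subr_gt0 h2.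
Qed.

(** Its sign tells on which side of the image chord of [t] the point [a r]
    lies. *)
Definition chord_side t r := det2 (a (u t) - a t) (a r - a t).

Lemma chord_side_right t : exists2 e, 0 < e & forall s, t < s -> s <= t + e -> chord_side t s < 0.
Proof.
have [A /(germ2_le (isT : (1 <= 2)%N)) aA] := cc_germ Ha t true.
have := chord_enters aA; rewrite det2C -det2Nl => d.
have [e e0 He] := side_sign aA d.
by exists e => // s ts se; have := He s ts se; rewrite det2Nl oppr_gt0.
Qed.

Lemma chord_side_partner t s : chord_side (u t) s = - chord_side t s.
Proof. by rewrite /chord_side partner_partner /det2 !pairE; ring. Qed.

Lemma chord_side_right_partner t : exists2 e, 0 < e & forall s, u t < s -> s <= u t + e -> 0 < chord_side t s.
Proof.
have [e e0 He] := chord_side_right (u t).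
by exists e => // s ts se; have := He s ts se; rewrite chord_side_partner oppr_lt0.
Qed.

(** A third point of [C] on the line of the chord would make that line a
    support line, but [C] crosses it at the two ends of the chord. *)
Lemma chord_side_neq0 t r : t < r -> r < t + T -> r != u t -> chord_side t r != 0.
Proof.
move=> tr rT ru; apply/eqP => z0.
have [h1 h2 _] := oppP Hf t.
set E := a (u t) - a t.
have [A /(germ2_le (isT : (1 <= 2)%N)) aA] := cc_germ Ha t true.
have [B /(germ2_le (isT : (1 <= 2)%N)) aB] := cc_germ Ha (u t) true.
have [D /(germ2_le (isT : (1 <= 2)%N)) aD] := cc_germ Ha r true.
have pA := chord_enters aA; have pB := chord_enters_partner aB.
have E0 : E != 0 by apply: contraTneq pA; rewrite -/E => ->; rewrite /det2 !mulr0 subrr ltxx.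
have := @det2_0P _ (a r - a t) E E0; rewrite det2C -/(chord_side t r) z0 oppr0 => /(_ erefl).
set l := _ / _ => ar.
have l0 : 0 <= l.
  by have := cc_conv Ha r aA; rewrite ar det2Zr pmulr_lge0.
have l1 : l <= 1.
  have := cc_conv Ha r aB.
  have -> : a r - a (u t) = (1 - l) *: (a t - a (u t)).
    have -> : a r - a (u t) = (a r - a t) - E by rewrite /E; vring.
    by rewrite ar /E; vring.
  by rewrite det2Zr pmulr_lge0// subr_ge0.
have l0' : l != 0.
  apply/eqP => l00; move: ar; rewrite l00 scale0r => /eqP; rewrite subr_eq0 => /eqP ar.
  by have := cc_inj Ha ar (ltW tr) rT; move/eqP; rewrite gt_eqF.
have l1' : l != 1.
  apply/eqP => l11; move: ar; rewrite l11 scale1r /E => /addIr ar.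
  have [ur|ru'] := leP (u t) r.
    have := cc_inj Ha ar ur; move/eqP: ru => ru H; apply: ru; apply: H.
    by rewrite (lt_trans rT)// ltrD2r.
  have := cc_inj Ha (esym ar) (ltW ru'); move/eqP: ru => ru H; apply: ru; apply/esym/H.
  by rewrite (lt_trans h2)// ltrD2r.
have h3 := cc_conv Ha t aD; have h4 := cc_conv Ha (u t) aD.
have e3 : a t - a r = (- l) *: E by rewrite scaleNr -ar; vring.
have e4 : a (u t) - a r = (1 - l) *: E.
  by rewrite scalerBl scale1r -ar /E; vring.
have DE : det2 (der D r) E = 0.
  move: h3 h4; rewrite e3 e4 !det2Zr => h3 h4.
  have l0'' : 0 < l by rewrite lt_neqAle eq_sym l0'.
  have l1'' : 0 < 1 - l by rewrite subr_gt0 lt_neqAle l1'.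
  apply/eqP; rewrite eq_le; apply/andP; split.
    by move: h3; rewrite mulNr oppr_ge0 pmulr_rle0.
  by move: h4; rewrite pmulr_rge0.
have := det2_0P E0 DE; set c := _ / _ => Dc.
have c0 : c != 0.
  by apply: contraNneq (cc_reg Ha aD) => c00; rewrite Dc c00 scale0r.
have key s : 0 <= c * chord_side t s.
  have := cc_conv Ha s aD; rewrite Dc det2Zl.
  have -> : a s - a r = (a s - a t) - l *: E by rewrite -ar; vring.
  by rewrite det2Br det2Zr det2vv mulr0 subr0.
have [e1 e10 H1] := chord_side_right t; have [e2 e20 H2] := chord_side_right_partner t.
have k1 := key (t + e1); have k2 := key (u t + e2).
have s1 : chord_side t (t + e1) < 0 by apply: H1; lra.
have s2 : 0 < chord_side t (u t + e2) by apply: H2; lra.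
have [c1|c1] := ltP c 0; first by nra.
have c2 : 0 < c by rewrite lt_neqAle eq_sym c0 c1.
nra.
Qed.

Lemma chord_side_cont t r : {for r, continuous (chord_side t)}.
Proof.
rewrite /chord_side; move: r; apply: cont_det2; first exact: cst_continuous.
by apply: cont_sub2; [exact: (cc_cont Ha) | exact: cst_continuous].
Qed.

Lemma chord_side_neg t r : t < r -> r < u t -> chord_side t r < 0.
Proof.
move=> tr ru; have [h1 h2 _] := oppP Hf t.
rewrite ltNge; apply/negP => zr.
have [e e0 He] := chord_side_right t.
pose s := Num.min (t + e) r.
have ts : t < s by rewrite lt_min tr ltrDl e0.
have se : s <= t + e by rewrite ge_min lexx.
have sr : s <= r by rewrite ge_min lexx orbT.
have zs := He s ts se.
have [||q /andP[q1 q2] /eqP] := @ivt0 _ (chord_side t) s r sr.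
- by move=> q _; exact: chord_side_cont.
- by rewrite nmulr_rle0.
apply/negP/chord_side_neq0; [lra | rewrite /partner in ru; lra |].
by rewrite lt_eqF// (le_lt_trans q2).
Qed.

Lemma chord_side_pos t r : u t < r -> r < t + T -> 0 < chord_side t r.
Proof.
move=> tr ru; rewrite -oppr_lt0 -chord_side_partner; apply: chord_side_neg => //.
by rewrite /partner (opp_opp Hf).
Qed.

Definition chord t := a t - a (u t).

Lemma chord_u t : chord (u t) = - chord t.
Proof. by rewrite /chord partner_partner opprB. Qed.

(** The parameters [r] and [u r] are separated by [t] and [u t], so the ends
    of the chord of [r] lie on opposite sides of the chord of [t]. *)
Lemma chord_cross t r : t < r -> r < u t -> 0 < det2 (chord t) (chord r).
Proof.
move=> tr ru.
have -> : det2 (chord t) (chord r) = chord_side t (u r) - chord_side t r.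
  by rewrite /chord /chord_side /det2 !pairE; ring.
have [t1 t2 _] := oppP Hf t; have [r1 r2 [c c0 fr]] := oppP Hf r.
have zr := chord_side_neg tr ru.
have d1 := opp_sign Hf tr ru.
have d2 : det2 (f t) (f (u r)) < 0 by rewrite /partner fr det2Zr nmulr_rlt0.
have uT : u r < t + T.
  rewrite ltNge; apply/negP => H; move: d2; rewrite ltNge => /negP; apply.
  have -> : f (u r) = f (u r - T) by rewrite -(rot_per Hf (u r - T)) subrK.
  have : t <= u r - T by lra.
  rewrite le_eqVlt => /predU1P[<-|H2]; first by rewrite det2vv.
  apply: ltW; apply: (opp_sign Hf H2); rewrite -/(u t) /partner.
  by move: ru; rewrite /partner; lra.
suff : 0 < chord_side t (u r) by lra.
apply: chord_side_pos => //.
rewrite ltNge; apply/negP; rewrite le_eqVlt => /predU1P[H|H].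
  have [_ _ [c' c'0 ft]] := oppP Hf t.
  by move: d2; rewrite H /partner ft det2Zr det2vv mulr0 ltxx.
have := @opp_sign _ _ _ Hf t (u r) _ H.
have : t < u r by rewrite (lt_trans tr).
by move=> h /(_ h); lra.
Qed.

(** The derivative of [chord] is [a' t - r' *: a' (u t)] with [r' > 0], and
    the opposite end of the chord lies to the left of either velocity.
    Injectivity comes from [chord_cross]. *)
Lemma chord_rotating : rotating T chord.
Proof.
split => //.
- by move=> t; rewrite /chord (cc_per Ha) /partner (opp_per Hf) (cc_per Ha).
- move=> t b; have [A aA] := cc_germ Ha t b; have [B aB] := cc_germ Ha (u t) b.
  have [r [ur _ rs]] := opp_germ Hf t b.
  exists (fun s => A s - B (r s)); apply: germ2B aA _.
  exact: germ2_comp aB ur rs.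
- move=> t b F DF.
  have [A /(germ2_le (isT : (1 <= 2)%N)) aA] := cc_germ Ha t b.
  have [B /(germ2_le (isT : (1 <= 2)%N)) aB] := cc_germ Ha (u t) b.
  have [r [/(germ_le (isT : (1 <= 2)%N)) ur r0 rs]] := opp_germ Hf t b.
  have DG : germ2 b 1 chord (fun s => A s - B (r s)) t.
    by apply: germ2B aA _; exact: germ2_comp aB ur rs.
  rewrite (germ2_unique DF DG).
  have rt : r t = u t by rewrite -(germ_at ur).
  have dB : isd2 B (r t) (der B (u t)) by rewrite rt; exact: Ck2_isd2 (germ2_Ck2 aB).
  have dr : is_derive (t : R) 1 r (derive1 r t) by have [Cr _] := ur; exact: Ck_derive1 Cr.
  rewrite (isd2_der (isd2B (Ck2_isd2 (germ2_Ck2 aA)) (@isd2_comp _ B r _ _ _ dB dr))).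
  have h1 := chord_enters aA; have h2 := chord_enters_partner aB.
  rewrite det2Br det2Zr.
  have -> : det2 (chord t) (der A t) = det2 (der A t) (a (u t) - a t).
    by rewrite /chord /det2 !pairE; ring.
  have -> : det2 (chord t) (der B (u t)) = - det2 (der B (u t)) (a t - a (u t)).
    by rewrite /chord /det2 !pairE; ring.
  by rewrite mulrN opprK addr_gt0// mulr_gt0.
- move=> t s c c0 Ds ts sT.
  have [h1 h2 _] := oppP Hf t.
  apply/eqP; rewrite eq_le ts andbT leNgt; apply/negP => ts'.
  have det0 : det2 (chord t) (chord s) = 0 by rewrite Ds det2Zr det2vv mulr0.
  have [su|us|E] := ltgtP s (u t).
  + by have := chord_cross ts' su; rewrite det0 ltxx.
  + have := @chord_cross (u t) s us; rewrite chord_u det2Nl det0 oppr0 ltxx => H.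
    by apply/notF/H; rewrite /partner (opp_opp Hf).
  + have [A /(germ2_le (isT : (1 <= 2)%N)) aA] := cc_germ Ha t true.
    have := chord_enters aA.
    suff : chord t = 0.
      rewrite /chord => /eqP; rewrite subr_eq0 => /eqP ->.
      by rewrite subrr /det2 !mulr0 subrr ltxx.
    have : (1 + c) *: chord t = 0.
      by rewrite scalerDl scale1r -Ds E chord_u subrr.
    by move/eqP; rewrite scaler_eq0 gt_eqF ?addr_gt0//= => /eqP.
Qed.

End Chords.

Section Frame.
Context {R : realType}.
Implicit Types (t : R) (u v w : R * R).

Lemma cos2sin2 t : cos t * cos t + sin t * sin t = 1 :> R.
Proof. by rewrite -!expr2 cos2Dsin2. Qed.

Lemma tau_pi t : tau (t + pi) = - tau t :> R * R.
Proof. by rewrite /tau sinDpi cosDpi; vring. Qed.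

Lemma normal_pi t : normal (t + pi) = - normal t :> R * R.
Proof. by rewrite /normal sinDpi cosDpi; vring. Qed.

Lemma isd2_tau t : isd2 tau t (- normal t).
Proof. by split; [apply: isdN; exact: is_derive_sin | exact: is_derive_cos]. Qed.

Lemma isd2_normal t : isd2 normal t (tau t).
Proof. by split; [exact: is_derive_cos | exact: is_derive_sin]. Qed.

Lemma Ck2_tau k t : Ck2 k tau t.
Proof. by split; [apply: CkN; exact: Ck_sin | exact: Ck_cos]. Qed.

Lemma Ck2_normal k t : Ck2 k normal t.
Proof. by split; [exact: Ck_cos | exact: Ck_sin]. Qed.

Lemma det2_tau t v : det2 (tau t) v = - dot2 (normal t) v.
Proof. by rewrite /det2 /dot2 /=; ring. Qed.

Lemma dot2_tau t : dot2 (tau t) (tau t) = 1 :> R.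
Proof. by rewrite /dot2 /= -(cos2sin2 t); ring. Qed.

Lemma tau_neq0 t : tau t != 0 :> R * R.
Proof.
apply: contra_eq_neq (dot2_tau t) => ->.
by rewrite /dot2 !mul0r addr0 eq_sym oner_neq0.
Qed.

Lemma normal_tau0 t : dot2 (normal t) (tau t) = 0 :> R.
Proof. by rewrite /dot2 /=; ring. Qed.

Lemma tau_inj (t u c : R) : 0 < c -> tau t = c *: tau u -> tau t = tau u.
Proof.
move=> c0 tu; have := dot2_tau t; rewrite {1 2}tu dot2Zl.
have -> : dot2 (tau u) (c *: tau u) = c by rewrite /dot2 !pairZ -[RHS]mulr1 -(dot2_tau u) /dot2; ring.
move=> c2; have : (c - 1) * (c + 1) = 0 by rewrite mulrBl mulrDr c2; ring.
move/eqP; rewrite mulf_eq0 (gt_eqF (addr_gt0 c0 ltr01)) orbF subr_eq0 => /eqP c1.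
by rewrite tu c1 scale1r.
Qed.

Lemma lineC u v : line u v = line v u.
Proof.
suff H w w' : line w w' `<=` line w' w by apply/seteqP; split; exact: H.
by move=> z; rewrite /line /= => H; rewrite -[RHS]oppr0 -H /det2 !pairE; ring.
Qed.

End Frame.

Section ThetaCurve.
Context {R : realType}.
Implicit Types (r t th : R) (b : bool) (X Y A : R -> R * R) (z w v : R * R).
Variables (T : R) (x a : R -> R * R) (C : set (R * R)) (p : R * R) (s : R * R -> R * R).
Hypothesis Hx : ccurve T x C.
Hypothesis Ha : ccurve T a C.
Hypothesis Hpar : forall t b X A r, germ2 b 1 x X t -> germ2 b 1 a A t ->
  0 < det2 (der X t) (x r - x t) -> 0 < det2 (der A t) (a r - a t).
Hypothesis pinx : inside x p.
Hypothesis pina : inside a p.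
Hypothesis sxa : forall t, s (x t) = a t.

Let f := from_pt x p.
Let Hf : rotating T f := from_pt_rotating Hx pinx.
Local Notation u := (partner T x p).
Local Notation chord := (chord T x a p).
Let Hd : rotating T chord := chord_rotating Hx Ha Hpar pinx.

(** The chords rotate, so each direction [tau th] is taken by exactly one of
    them: [chord_tip th] is the end of this chord towards [tau th], and
    [chord_tip (th + pi)] is its other end. *)
Definition tip_param th := xget 0 [set t | exists2 c, 0 < c & chord t = c *: tau th].
Definition chord_tip th := a (tip_param th).

Lemma tip_paramP th : exists2 c, 0 < c & chord (tip_param th) = c *: tau th.
Proof. exact: (@xgetPex _ 0 [set t | exists2 c, 0 < c & chord t = c *: tau th] (ray_ex Hd (tau_neq0 th))). Qed.

Lemma tip_param_mod th t c : 0 < c -> chord t = c *: tau th -> exists n : int, t = tip_param th + n%:~R * T.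
Proof.
move=> c0 ct; have [d d0 dt] := tip_paramP th.
apply: (inj_mod Hd (c := c / d)); first by rewrite divr_gt0.
by rewrite ct dt scalerA divfK// gt_eqF.
Qed.

Lemma chord_tip_uniq th t c : 0 < c -> chord t = c *: tau th -> chord_tip th = a t.
Proof. by move=> c0 /(tip_param_mod c0)[n ->]; rewrite (perZ (cc_per Ha)). Qed.

Lemma chord_tip_pi th : chord_tip (th + pi) = a (u (tip_param th)).
Proof.
have [c c0 ct] := tip_paramP th.
apply: (chord_tip_uniq c0).
by rewrite (chord_u Hx Ha pinx) ct tau_pi scalerN.
Qed.

Lemma chord_tip_2pi th : chord_tip (th + pi + pi) = chord_tip th.
Proof.
have [c c0 ct] := tip_paramP th.
by apply: (chord_tip_uniq c0); rewrite !tau_pi opprK.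
Qed.

Lemma chord_tip_chord th : exists2 c, 0 < c & chord_tip th - chord_tip (th + pi) = c *: tau th.
Proof. by have [c c0 ct] := tip_paramP th; exists c => //; rewrite chord_tip_pi. Qed.

Lemma chord_tip_C th : C (chord_tip th).
Proof. exact: (cc_mem Ha). Qed.

Lemma chord_tip_rays th1 th2 c : 0 < c -> chord_tip th1 - p = c *: (chord_tip th2 - p) -> tau th1 = tau th2.
Proof.
move=> c0 H; have [n nE] := inj_mod (from_pt_rotating Ha pina) c0 H.
have [c1 c10 E1] := tip_paramP th1; have [c2 c20 E2] := tip_paramP th2.
apply: (@tau_inj _ _ _ (c2 / c1)); first by rewrite divr_gt0.
have : c1 *: tau th1 = c2 *: tau th2 by rewrite -E1 -E2 nE (perZ (rot_per Hd)).
by move=> E; rewrite mulrC -scalerA -E scalerA mulVf ?scale1r// gt_eqF.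
Qed.

(** Both [chord] and [tau] rotate counterclockwise, so [solve_germ] gives a
    germ of the parameter at which [chord] has direction [tau th]. *)
Lemma chord_tip_germ th b : exists A A0 k, [/\ germ2 b 2 chord_tip A th, 0 < k,
  germ2 b 1 a A0 (tip_param th) & der A th = k *: der A0 (tip_param th)].
Proof.
have [c c0 ct] := tip_paramP th.
have [F fF] := rot_germ Hd (tip_param th) b.
have dF := rot_pos Hd (germ2_le (isT : (1 <= 2)%N) fF).
rewrite (germ2_at fF) in dF.
have tE : germ2 b 2 tau tau th by apply: germ2P; [exact: Ck2_tau | near=> q].
have dE : 0 < det2 (tau th) (der tau th).
  rewrite (isd2_der (isd2_tau th)) det2_tau /dot2 !pairE /=.
  by have := cos2sin2 th; lra.
have [r [Cr rt r0 Hr]] := solve_germ fF dF tE dE ct (lt0r_neq0 c0).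
have [A aA] := cc_germ Ha (tip_param th) b.
have aA1 := germ2_le (isT : (1 <= 2)%N) aA.
have rr : germ b 2 r r th by exact: germ_Ck.
have rs : \forall q \near th, side b th q -> side b (r th) (r q).
  by apply: filterS Hr => q Hq bq; rewrite rt; have [] := Hq bq.
have aA' : germ2 b 2 a A (r th) by rewrite rt.
have G := germ2_comp aA' rr rs.
have ccr : \forall q \near th, side b th q -> chord_tip q = a (r q).
  apply: filterS Hr => q Hq bq; have [_ d1 d2] := Hq bq.
  apply: (@chord_tip_uniq q (r q) (dot2 (chord (r q)) (tau q) / dot2 (tau q) (tau q))).
    by rewrite dot2_tau divr1 -(pmulr_rgt0 _ c0).
  by apply: det2_0P => //; exact: tau_neq0.
have dA : isd2 A (r th) (der A (tip_param th)) by rewrite rt; exact: Ck2_isd2 (germ2_Ck2 aA1).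
have dr : is_derive (th : R) 1 r (derive1 r th) by exact: Ck_derive1 Cr.
exists (fun q => A (r q)), A, (derive1 r th); split.
- exact: germ2_eq G ccr.
- exact: r0.
- exact: aA1.
- exact: isd2_der (@isd2_comp _ A r _ _ _ dA dr).
Unshelve. all: by end_near. Qed.

Let f0 t : f t != 0.
Proof.
have [F /(germ2_le (isT : (1 <= 2)%N)) /(rot_pos Hf)] := rot_germ Hf t true.
by apply: contraTneq => ->; rewrite /det2 !mul0r subrr ltxx.
Qed.

Lemma line_meets_curve t r : det2 (f t) (f r) = 0 -> x r = x t \/ x r = x (u t).
Proof.
move=> d; have fr : f r = (dot2 (f r) (f t) / dot2 (f t) (f t)) *: f t.
  by apply: det2_0P => //; rewrite det2C d oppr0.
move: fr; set c := _ / _ => fr.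
have c0 : c != 0 by apply: contraNneq (f0 r) => c0; rewrite fr c0 scale0r.
have [c1|c1] := ltP 0 c.
  by left; have [n ->] := inj_mod Hf c1 fr; rewrite (perZ (cc_per Hx)).
right; have [_ _ [d' d'0 fu]] := oppP Hf t.
have c1' : c < 0 by rewrite lt_neqAle c0.
have fr' : f r = (c / d') *: f (u t).
  by rewrite fr /partner fu scalerA divfK// lt_eqF.
have cd : 0 < c / d' by rewrite nmulr_rgt0// invr_lt0.
by have [n ->] := inj_mod Hf cd fr'; rewrite (perZ (cc_per Hx)).
Qed.

Lemma Phi_line t : Phi C s (line p (x t)) = line (a t) (a (u t)).
Proof.
have xu : x t <> x (u t).
  have [_ _ [c c0 fu]] := oppP Hf t => E.
  have : (1 - c) *: f t = 0 by rewrite scalerBl scale1r -fu /f /from_pt -/(u t) E subrr.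
  by move/eqP; rewrite scaler_eq0 (negPf (f0 t)) orbF gt_eqF//; lra.
have on_l r : line p (x t) (x r) <-> det2 (f t) (f r) = 0 by [].
apply/seteqP; split => z.
  move=> [_ [_ [[/(cc_memP Hx)[r1 ->] /on_l/line_meets_curve h1] [/(cc_memP Hx)[r2 ->] /on_l/line_meets_curve h2] ne]]].
  case: h1 ne => ->; case: h2 => -> ne //; rewrite !sxa //.
  by rewrite lineC.
move=> lz; exists (x t), (x (u t)); split; rewrite ?sxa//.
  by split; [exact: (cc_mem Hx) | rewrite /line /= det2vv].
split; first exact: (cc_mem Hx).
have [_ _ [c c0 fu]] := oppP Hf t.
by rewrite /line /= -/(from_pt x p t) -/(from_pt x p (u t)) /partner -/f fu det2Zr det2vv mulr0.
Qed.

Lemma line_chord th t d : d != 0 -> chord t = d *: tau th ->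
  line (a t) (a (u t)) = [set z | dot2 (normal th) (z - p) = dot2 (normal th) (a t - p)].
Proof.
move=> d0 ct; have key z : det2 (a (u t) - a t) (z - a t) = d * (dot2 (normal th) (z - p) - dot2 (normal th) (a t - p)).
  have -> : a (u t) - a t = (- d) *: tau th by rewrite scaleNr -ct /chord; vring.
  by rewrite det2Zl det2_tau /dot2 !pairE; ring.
apply/seteqP; split => z; rewrite /line /= key.
  by move/eqP; rewrite mulf_eq0 (negPf d0) /= subr_eq0 => /eqP.
by move=> ->; rewrite subrr mulr0.
Qed.

(** The lines of the image pencil are those of the chords, and only one of
    them has the normal [normal th]. *)
Lemma q_E th : q_ C s p th = dot2 (normal th) (chord_tip th - p).
Proof.
apply: xget_unique => /=.
  exists (line p (x (tip_param th))).
    exists (x (tip_param th)) => //; apply/eqP; rewrite -subr_eq0; exact: f0.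
  have [c c0 ct] := tip_paramP th.
  by rewrite Phi_line (line_chord (lt0r_neq0 c0) ct).
move=> y [l [y' /eqP y'p ->]].
have y'p0 : y' - p != 0 by rewrite subr_eq0.
have [t [c c0 ft]] := ray_ex Hf y'p0.
have -> : line p y' = line p (x t).
  apply/seteqP; split => z; rewrite /line /= -/(from_pt x p t) -/f ft det2Zl; first by move=> ->; rewrite mulr0.
  by move/eqP; rewrite mulf_eq0 gt_eqF//= => /eqP.
rewrite Phi_line => H.
have h1 : dot2 (normal th) (a t - p) = y.
  have : line (a t) (a (u t)) (a t) by rewrite /line /= subrr /det2 !mulr0 subrr.
  by rewrite H.
have h2 : dot2 (normal th) (a (u t) - p) = y.
  have : line (a t) (a (u t)) (a (u t)) by rewrite /line /= det2vv.
  by rewrite H.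
have ct : chord t = (dot2 (chord t) (tau th) / dot2 (tau th) (tau th)) *: tau th.
  apply: det2_0P; first exact: tau_neq0.
  rewrite det2C det2_tau opprK; move: h1; rewrite -h2 /chord /dot2 !pairE; lra.
move: ct; set d := _ / _ => ct.
have d0 : d != 0.
  have [F /(germ2_le (isT : (1 <= 2)%N)) /(rot_pos Hd)] := rot_germ Hd t true.
  by apply: contraTneq => d0; rewrite ct d0 scale0r /det2 !mul0r subrr ltxx.
have [d1|d1] := ltP 0 d; first by rewrite (chord_tip_uniq d1 ct).
have d2 : 0 < - d by rewrite oppr_gt0 lt_neqAle d0.
have := @chord_tip_uniq th (u t) _ d2.
by rewrite (chord_u Hx Ha pinx) ct scaleNr => /(_ erefl) ->.
Qed.

End ThetaCurve.

(** * Areas of triangles *)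

Section PlaneMeasure.
Context {R : realType}.
Local Notation mu := (@lebesgue_measure R).
Local Notation mu2 := (mu \x mu)%E.
Implicit Types (S : set (measurableTypeR R * measurableTypeR R)).

(** An open set is the union of the countably many boxes with rational corners
    that it contains. *)
Lemma open_measurable2 (S : set (R * R)) : open S ->
  measurable (S : set (measurableTypeR R * measurableTypeR R)).
Proof.
move=> oS.
pose box (q : rat * rat * (rat * rat)) : set (R * R) :=
  `]ratr q.1.1 : R, ratr q.1.2 : R[%classic `*` `]ratr q.2.1 : R, ratr q.2.2 : R[%classic.
pose F q : set (measurableTypeR R * measurableTypeR R) :=
  [set z | box q z /\ box q `<=` S].
have -> : S = \bigcup_q F q.
  apply/seteqP; split => [z Sz|z [q _] [bz bS]]; last exact: bS.
  have [e e0 He] : exists2 e, 0 < e & forall w : R * R,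
     `|z.1 - w.1| < e -> `|z.2 - w.2| < e -> S w.
    move: oS; rewrite openE => /(_ _ Sz) /nbhs_ballP[e /= e0 He].
    by exists e => // w h1 h2; apply: He; split.
  have [q1 q1z] := @rat_in_itvoo R (z.1 - e) z.1 ltac:(by rewrite gtrBl).
  have [q2 q2z] := @rat_in_itvoo R z.1 (z.1 + e) ltac:(by rewrite ltrDl).
  have [q3 q3z] := @rat_in_itvoo R (z.2 - e) z.2 ltac:(by rewrite gtrBl).
  have [q4 q4z] := @rat_in_itvoo R z.2 (z.2 + e) ltac:(by rewrite ltrDl).
  move: q1z q2z q3z q4z; rewrite !in_itv/= => /andP[a1 a2] /andP[a3 a4] /andP[a5 a6] /andP[a7 a8].
  exists (q1, q2, (q3, q4)) => //; split.
    by split; rewrite /= in_itv/=; apply/andP; split.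
  move=> w [h1 h2].
  move: h1 h2; rewrite /= !in_itv/= => /andP[b1 b2] /andP[b3 b4].
  by apply: He; apply/ltr_normlP; split; lra.
apply: countable_bigcupT_measurable => // q.
have [bS|nbS] := pselect (box q `<=` S); last first.
  have -> : F q = set0 by apply/seteqP; split => // z [].
  exact: measurable0.
have -> : F q = box q by apply/seteqP; split => // z [].
by apply: measurableX; exact: measurable_itv.
Qed.

Lemma integral_affine (al be m n : R) : al <= be ->
  (\int[mu]_(x in `]al, be[) (m * x + n)%:E =
    (m * (be ^+ 2 - al ^+ 2) / 2 + n * (be - al))%:E)%E.
Proof.
rewrite le_eqVlt => /predU1P[->|ab].
  by rewrite set_itvoo0 integral_set0; congr EFin; rewrite !subrr !mulr0 mul0r addr0.
pose f x := m * x + n.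
have cf : continuous f.
  move=> x; apply: cvgD; last exact: cvg_cst.
  by apply: cvgM; [exact: cvg_cst | exact: cvg_id].
have mf : measurable_fun setT f by exact: continuous_measurable_fun.
pose F x := m / 2 * (x * x) + n * x.
have dF x : is_derive (x : R) 1 F (f x).
  apply: isd_eq (isdD (isdM (is_derive_cst (m / 2) _ _) (isdM (is_derive_id _ _) (is_derive_id _ _)))
    (isdM (is_derive_cst n _ _) (is_derive_id _ _))) _.
  by rewrite /f /cst /id /=; field.
have cF : continuous F by move=> x; apply: derivable_cont; have [] := dF x.
rewrite -(integral_itv_bndoo true false); last by apply/measurable_EFinP; exact: measurable_funTS.
have := @continuous_FTC2 R f F al be ab _ _ _.
rewrite /f => ->.
- by rewrite -EFinB; congr EFin; rewrite /F; field.
- exact: continuous_subspaceT.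
- split; first by move=> x _; have [] := dF x.
  + by apply: cvg_at_right_filter; exact: cF.
  + by apply: cvg_at_left_filter; exact: cF.
- by move=> x _; rewrite (isd_derive1 (dF x)).
Qed.
End PlaneMeasure.

Section TriangleMeasure.
Context {R : realType}.
Local Notation mu := (@lebesgue_measure R).
Local Notation mu2 := (mu \x mu)%E.
Implicit Types (S : set (measurableTypeR R * measurableTypeR R)) (c A B z : R * R).

Lemma slices_ge S (al be m n : R) : measurable S -> al <= be ->
  (forall x, al < x < be -> 0 <= m * x + n /\
     exists l, forall y, l < y < l + (m * x + n) -> S (x, y)) ->
  ((m * (be ^+ 2 - al ^+ 2) / 2 + n * (be - al))%:E <=
    \int[mu]_(x in `]al, be[) (mu \o xsection S) x)%E.
Proof.
move=> mS ab H; rewrite -integral_affine//.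
have mphi : measurable_fun setT (mu \o xsection S) by exact: measurable_fun_xsection.
apply: ge0_le_integral => //.
- by move=> x /=; rewrite in_itv/= lee_fin => /H[].
- apply/measurable_EFinP; apply: measurable_funTS; apply: continuous_measurable_fun.
  move=> x; apply: cvgD; last exact: cvg_cst.
  by apply: cvgM; [exact: cvg_cst | exact: cvg_id].
- exact: measurable_funTS.
- move=> x /=; rewrite in_itv/= => /H[k0 [l Hl]].
  have -> : (m * x + n)%:E = mu `]l, l + (m * x + n)[%classic.
    rewrite lebesgue_measure_itv/= lte_fin ltrDl.
    have [_|h] := ltP 0 (m * x + n); first by rewrite -EFinB; congr EFin; ring.
    by congr EFin; apply/le_anti; rewrite h k0.
  apply: le_measure; rewrite ?inE; first exact: measurable_itv.
    exact: measurable_xsection.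
  by move=> y /=; rewrite in_itv/= => /Hl ?; apply/xsectionP.
Qed.

Lemma two_slices_ge S (al be ga m n m' n' : R) : measurable S -> al <= be -> be <= ga ->
  (forall x, al < x < be -> 0 <= m * x + n /\
     exists l, forall y, l < y < l + (m * x + n) -> S (x, y)) ->
  (forall x, be < x < ga -> 0 <= m' * x + n' /\
     exists l, forall y, l < y < l + (m' * x + n') -> S (x, y)) ->
  ((m * (be ^+ 2 - al ^+ 2) / 2 + n * (be - al) +
    (m' * (ga ^+ 2 - be ^+ 2) / 2 + n' * (ga - be)))%:E <= mu2 S)%E.
Proof.
move=> mS ab bg H1 H2; rewrite EFinD.
apply: le_trans (leeD (slices_ge mS ab H1) (slices_ge mS bg H2)) _.
have mphi : measurable_fun setT (mu \o xsection S) by exact: measurable_fun_xsection.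
rewrite -ge0_integral_setU//.
- apply: ge0_subset_integral => //.
  by apply: measurableU; exact: measurable_itv.
- exact: measurable_funTS.
- apply/disj_setPS => x [/=]; rewrite !in_itv/= => /andP[_ h1] /andP[h2 _].
  by have := lt_trans h1 h2; rewrite ltxx.
Qed.

Definition triangle c A B : set (R * R) :=
  [set z | [/\ 0 < det2 (A - c) (z - c), 0 < det2 (B - A) (z - A) &
               0 < det2 (c - B) (z - B)]].

Lemma triangle_cyc c A B : triangle c A B = triangle A B c.
Proof. by apply/seteqP; split => z []. Qed.

Lemma triangle_open c A B : open (triangle c A B).
Proof.
have h u v : open [set z : R * R | 0 < det2 u (z - v)].
  have -> : [set z : R * R | 0 < det2 u (z - v)] = (fun z => det2 u (z - v)) @^-1` [set y | 0 < y] by [].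
  apply: open_comp; last exact: open_gt.
  move=> z _; move: z; apply: cont_det2; first exact: cst_continuous.
  by apply: cont_sub2; [move=> ?; exact: cvg_id | exact: cst_continuous].
have -> : triangle c A B = [set z | 0 < det2 (A - c) (z - c)] `&`
   [set z | 0 < det2 (B - A) (z - A)] `&` [set z | 0 < det2 (c - B) (z - B)].
  by apply/seteqP; split => z; [case | move=> [[]]].
by apply: openI => //; apply: openI.
Qed.

Lemma triangle_measurable c A B :
  measurable (triangle c A B : set (measurableTypeR R * measurableTypeR R)).
Proof. by apply: open_measurable2; exact: triangle_open. Qed.

(** With [c] leftmost, the length of the vertical slices is an affine function
    before and after the middle vertex, and its integral is elementary. *)
Lemma measure_triangle_left c A B : c.1 <= A.1 -> c.1 <= B.1 ->
  0 < det2 (A - c) (B - c) ->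
  ((det2 (A - c) (B - c) / 2)%:E <= mu2 (triangle c A B))%E.
Proof.
case: c A B => [c1 c2] [a1 a2] [b1 b2] /= ca cb D0.
have mT := @triangle_measurable (c1, c2) (a1, a2) (b1, b2).
move: D0; set D := det2 _ _ => D0.
have DE : D = (a1 - c1) * (b2 - c2) - (a2 - c2) * (b1 - c1) by [].
have TE x y : triangle (c1, c2) (a1, a2) (b1, b2) (x, y) <->
  [/\ 0 < (a1 - c1) * (y - c2) - (a2 - c2) * (x - c1),
      0 < D - ((a1 - c1) * (y - c2) - (a2 - c2) * (x - c1)) - ((x - c1) * (b2 - c2) - (y - c2) * (b1 - c1)) &
      0 < (x - c1) * (b2 - c2) - (y - c2) * (b1 - c1)].
  rewrite /triangle /=.
  have -> : det2 ((b1, b2) - (a1, a2)) ((x, y) - (a1, a2)) =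
    D - ((a1 - c1) * (y - c2) - (a2 - c2) * (x - c1)) - ((x - c1) * (b2 - c2) - (y - c2) * (b1 - c1)).
    by rewrite DE /det2 /=; ring.
  have -> : det2 ((c1, c2) - (b1, b2)) ((x, y) - (b1, b2)) =
    (x - c1) * (b2 - c2) - (y - c2) * (b1 - c1) by rewrite /det2 /=; ring.
  by split => -[].
set dA := a1 - c1 in DE TE; set a' := a2 - c2 in DE TE.
set dB := b1 - c1 in DE TE; set b' := b2 - c2 in DE TE.
have dA0 : 0 <= dA by rewrite subr_ge0.
have dB0 : 0 <= dB by rewrite subr_ge0.
have [AB|BA] := leP a1 b1.
- have dAB : dA <= dB by rewrite lerD2r.
  have dBp : 0 < dB.
    rewrite lt_neqAle eq_sym dB0 andbT; apply/eqP => z; move: D0.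
    have z2 : dA = 0 by apply/le_anti; rewrite dA0 -z dAB.
    by rewrite DE z2 z mul0r mulr0 subrr ltxx.
  (* Up to sign, the slopes of the slice length before and after the middle
     vertex. *)
  pose k1 := D / (dA * dB); pose k2 := D / (dB * (dB - dA)).
  have : ((k1 * (a1 ^+ 2 - c1 ^+ 2) / 2 + (- k1 * c1) * (a1 - c1) +
    (- k2 * (b1 ^+ 2 - a1 ^+ 2) / 2 + (k2 * b1) * (b1 - a1)))%:E <=
     mu2 (triangle (c1, c2) (a1, a2) (b1, b2)))%E.
    apply: two_slices_ge => // x /andP[x1 x2].
      set xi := x - c1; have xi0 : 0 < xi by rewrite subr_gt0.
      have xiA : xi < dA by rewrite ltrD2r.
      have dAp : 0 < dA by apply: lt_trans xiA.
      have -> : k1 * x + - k1 * c1 = k1 * xi by rewrite /xi; ring.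
      split; first by rewrite mulr_ge0 ?(ltW xi0)// divr_ge0 ?(ltW D0)// mulr_ge0.
      exists (c2 + a' / dA * xi) => y /andP[y1 y2]; apply/TE.
      set eta := y - c2.
      have e1 : a' / dA * xi < eta by rewrite /eta; lra.
      have e2 : eta < b' / dB * xi.
        have -> : b' / dB * xi = a' / dA * xi + k1 * xi.
          by rewrite /k1 DE; field; rewrite !gt_eqF.
        by rewrite /eta; lra.
      have h1 : a' * xi < dA * eta.
        have -> : a' * xi = dA * (a' / dA * xi) by field; rewrite gt_eqF.
        by rewrite ltr_pM2l.
      have h2 : dB * eta < b' * xi.
        have -> : b' * xi = dB * (b' / dB * xi) by field; rewrite gt_eqF.
        by rewrite ltr_pM2l.
      rewrite -/xi; split; [lra| |lra].
      rewrite -(pmulr_rgt0 _ dAp).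
      have -> : dA * (D - (dA * eta - a' * xi) - (xi * b' - eta * dB)) =
        (dB - dA) * (dA * eta - a' * xi) + D * (dA - xi) by rewrite DE; ring.
      by apply: ltr_wpDl; [rewrite mulr_ge0// subr_ge0// ltW | rewrite mulr_gt0// subr_gt0].
    set xi := x - c1; have xiA : dA < xi by rewrite ltrD2r.
    have xiB : xi < dB by rewrite ltrD2r.
    have dd : 0 < dB - dA by rewrite subr_gt0; exact: lt_trans xiB.
    have -> : - k2 * x + k2 * b1 = k2 * (dB - xi) by rewrite /xi /dB; ring.
    split.
      by rewrite mulr_ge0 ?subr_ge0 ?(ltW xiB)// divr_ge0 ?(ltW D0)// mulr_ge0// ltW.
    exists (c2 + a' + (b' - a') / (dB - dA) * (xi - dA)) => y /andP[y1 y2]; apply/TE.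
    set eta := y - c2.
    have e1 : (b' - a') / (dB - dA) * (xi - dA) < eta - a' by rewrite /eta; lra.
    have e2 : eta < b' / dB * xi.
      have -> : b' / dB * xi = a' + (b' - a') / (dB - dA) * (xi - dA) + k2 * (dB - xi).
        by rewrite /k2 DE; field; rewrite (gt_eqF dBp) (gt_eqF dd).
      by rewrite /eta; lra.
    have h1 : (b' - a') * (xi - dA) < (dB - dA) * (eta - a').
      have -> : (b' - a') * (xi - dA) = (dB - dA) * ((b' - a') / (dB - dA) * (xi - dA)).
        by field; rewrite gt_eqF.
      by rewrite ltr_pM2l.
    have h2 : dB * eta < b' * xi.
      have -> : b' * xi = dB * (b' / dB * xi) by field; rewrite gt_eqF.
      by rewrite ltr_pM2l.
    rewrite -/xi; split; last by lra.
      rewrite -(pmulr_rgt0 _ dd).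
      have -> : (dB - dA) * (dA * eta - a' * xi) =
         dA * ((dB - dA) * (eta - a') - (b' - a') * (xi - dA)) + D * (xi - dA) by rewrite DE; ring.
      by apply: ltr_wpDl; [rewrite mulr_ge0// subr_ge0 ltW | rewrite mulr_gt0// subr_gt0].
    have -> : D - (dA * eta - a' * xi) - (xi * b' - eta * dB) =
       (dB - dA) * (eta - a') - (b' - a') * (xi - dA) by rewrite DE; ring.
    by rewrite subr_gt0.
  congr (_ <= _)%E; congr EFin.
  have -> : k1 * (a1 ^+ 2 - c1 ^+ 2) / 2 + - k1 * c1 * (a1 - c1) = D * dA / (2 * dB).
    have -> : k1 * (a1 ^+ 2 - c1 ^+ 2) / 2 + - k1 * c1 * (a1 - c1) = k1 * (dA * dA) / 2.
      by rewrite /dA; field.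
    rewrite /k1; have [->|z] := eqVneq dA 0; first by rewrite !(mul0r, mulr0).
    by field; rewrite z gt_eqF.
  have -> : - k2 * (b1 ^+ 2 - a1 ^+ 2) / 2 + k2 * b1 * (b1 - a1) = D * (dB - dA) / (2 * dB).
    have -> : - k2 * (b1 ^+ 2 - a1 ^+ 2) / 2 + k2 * b1 * (b1 - a1) = k2 * ((dB - dA) * (dB - dA)) / 2.
      by rewrite /dA /dB; field.
    rewrite /k2; have [->|z] := eqVneq (dB - dA) 0; first by rewrite !(mul0r, mulr0).
    by field; rewrite z gt_eqF.
  by field; rewrite gt_eqF.
- have dAB : dB < dA by rewrite ltrD2r.
  have dAp : 0 < dA by apply: le_lt_trans dAB.
  have dd : 0 < dA - dB by rewrite subr_gt0.
  (* Up to sign, the slopes of the slice length before and after the middle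
     vertex. *)
  pose k1 := D / (dA * dB); pose k2 := D / (dA * (dA - dB)).
  have : ((k1 * (b1 ^+ 2 - c1 ^+ 2) / 2 + (- k1 * c1) * (b1 - c1) +
    (- k2 * (a1 ^+ 2 - b1 ^+ 2) / 2 + (k2 * a1) * (a1 - b1)))%:E <=
     mu2 (triangle (c1, c2) (a1, a2) (b1, b2)))%E.
    apply: two_slices_ge => //; first exact: ltW.
      move=> x /andP[x1 x2].
      set xi := x - c1; have xi0 : 0 < xi by rewrite subr_gt0.
      have xiB : xi < dB by rewrite ltrD2r.
      have dBp : 0 < dB by apply: lt_trans xiB.
      have -> : k1 * x + - k1 * c1 = k1 * xi by rewrite /xi; ring.
      split; first by rewrite mulr_ge0 ?(ltW xi0)// divr_ge0 ?(ltW D0)// mulr_ge0.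
      exists (c2 + a' / dA * xi) => y /andP[y1 y2]; apply/TE.
      set eta := y - c2.
      have e1 : a' / dA * xi < eta by rewrite /eta; lra.
      have e2 : eta < b' / dB * xi.
        have -> : b' / dB * xi = a' / dA * xi + k1 * xi.
          by rewrite /k1 DE; field; rewrite !gt_eqF.
        by rewrite /eta; lra.
      have h1 : a' * xi < dA * eta.
        have -> : a' * xi = dA * (a' / dA * xi) by field; rewrite gt_eqF.
        by rewrite ltr_pM2l.
      have h2 : dB * eta < b' * xi.
        have -> : b' * xi = dB * (b' / dB * xi) by field; rewrite gt_eqF.
        by rewrite ltr_pM2l.
      rewrite -/xi; split; [lra| |lra].
      rewrite -(pmulr_rgt0 _ dBp).
      have -> : dB * (D - (dA * eta - a' * xi) - (xi * b' - eta * dB)) =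
        (dA - dB) * (b' * xi - dB * eta) + D * (dB - xi) by rewrite DE; ring.
      by apply: addr_gt0; rewrite mulr_gt0// subr_gt0.
    move=> x /andP[x1 x2].
    set xi := x - c1; have xiA : dB < xi by rewrite ltrD2r.
    have xiB : xi < dA by rewrite ltrD2r.
    have -> : - k2 * x + k2 * a1 = k2 * (dA - xi) by rewrite /xi /dA; ring.
    split.
      by rewrite mulr_ge0 ?subr_ge0 ?(ltW xiB)// divr_ge0 ?(ltW D0)// mulr_ge0// ltW.
    exists (c2 + a' / dA * xi) => y /andP[y1 y2]; apply/TE.
    set eta := y - c2.
    have e1 : a' / dA * xi < eta by rewrite /eta; lra.
    have e2 : eta - a' < (b' - a') / (dA - dB) * (dA - xi).
      have -> : (b' - a') / (dA - dB) * (dA - xi) = a' / dA * xi + k2 * (dA - xi) - a'.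
        by rewrite /k2 DE; field; rewrite (gt_eqF dAp) (gt_eqF dd).
      by rewrite /eta; lra.
    have h1 : a' * xi < dA * eta.
      have -> : a' * xi = dA * (a' / dA * xi) by field; rewrite gt_eqF.
      by rewrite ltr_pM2l.
    have h2 : (dA - dB) * (eta - a') < (b' - a') * (dA - xi).
      have -> : (b' - a') * (dA - xi) = (dA - dB) * ((b' - a') / (dA - dB) * (dA - xi)).
        by field; rewrite gt_eqF.
      by rewrite ltr_pM2l.
    rewrite -/xi; split; first by lra.
      have -> : D - (dA * eta - a' * xi) - (xi * b' - eta * dB) =
         (b' - a') * (dA - xi) - (dA - dB) * (eta - a') by rewrite DE; ring.
      by rewrite subr_gt0.
    rewrite -(pmulr_rgt0 _ dd).
    have -> : (dA - dB) * (xi * b' - eta * dB) =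
       dB * ((b' - a') * (dA - xi) - (dA - dB) * (eta - a')) + D * (xi - dB) by rewrite DE; ring.
    by apply: ltr_wpDl; [rewrite mulr_ge0// subr_ge0 ltW | rewrite mulr_gt0// subr_gt0].
  congr (_ <= _)%E; congr EFin.
  have -> : k1 * (b1 ^+ 2 - c1 ^+ 2) / 2 + - k1 * c1 * (b1 - c1) = D * dB / (2 * dA).
    have -> : k1 * (b1 ^+ 2 - c1 ^+ 2) / 2 + - k1 * c1 * (b1 - c1) = k1 * (dB * dB) / 2.
      by rewrite /dB; field.
    rewrite /k1; have [->|z] := eqVneq dB 0; first by rewrite !(mul0r, mulr0).
    by field; rewrite z gt_eqF.
  have -> : - k2 * (a1 ^+ 2 - b1 ^+ 2) / 2 + k2 * a1 * (a1 - b1) = D * (dA - dB) / (2 * dA).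
    have -> : - k2 * (a1 ^+ 2 - b1 ^+ 2) / 2 + k2 * a1 * (a1 - b1) = k2 * ((dA - dB) * (dA - dB)) / 2.
      by rewrite /dA /dB; field.
    by rewrite /k2; field; rewrite (gt_eqF dAp) (gt_eqF dd).
  by field; rewrite gt_eqF.
Qed.

(** Rotating the names of the vertices makes the first one leftmost. *)
Lemma measure_triangle c A B : 0 < det2 (A - c) (B - c) ->
  ((det2 (A - c) (B - c) / 2)%:E <= mu2 (triangle c A B))%E.
Proof.
have cyc u v w : det2 (v - u) (w - u) = det2 (w - v) (u - v) :> R.
  by rewrite /det2 !pairE; ring.
move=> D0; have [cA|Ac] := leP c.1 A.1; have [cB|Bc] := leP c.1 B.1.
- exact: measure_triangle_left.
- have BA : B.1 <= A.1 by apply: le_trans cA; exact: ltW.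
  rewrite cyc cyc triangle_cyc triangle_cyc; rewrite cyc cyc in D0.
  by apply: measure_triangle_left => //; exact: ltW.
- have AB : A.1 <= B.1 by apply: le_trans cB; exact: ltW.
  rewrite cyc triangle_cyc; rewrite cyc in D0.
  by apply: measure_triangle_left => //; exact: ltW.
- have [AB|BA] := leP A.1 B.1.
    rewrite cyc triangle_cyc; rewrite cyc in D0.
    by apply: measure_triangle_left => //; exact: ltW.
  rewrite cyc cyc triangle_cyc triangle_cyc; rewrite cyc cyc in D0.
  by apply: measure_triangle_left => //; exact: ltW.
Qed.

End TriangleMeasure.

(** * Lateral limits and integrals *)

Section Glue.
Context {R : realType}.
Implicit Types (r s t lo hi : R) (b : bool).
Local Notation mu := (@lebesgue_measure R).

Lemma derive1_pair (X : R -> R * R) t v : isd2 X t v -> derive1 X t = v.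
Proof.
move=> [[d1 e1] [d2 e2]].
have X1 : differentiable (fun s => (X s).1) t by apply/derivable1_diffP.
have X2 : differentiable (fun s => (X s).2) t by apply/derivable1_diffP.
have XE : X = (fun s => ((X s).1, (X s).2)) by apply/funext => s; case: (X s).
have dX : differentiable X t by rewrite XE; exact: differentiable_pair.
rewrite derive1E' // XE diff_pair// -!deriveE// e1 e2.
by case: (v).
Qed.

Lemma lim_pt_eq (A : Type) (F : set_system A) {FF : ProperFilter F} (f : A -> R * R) l :
  f u @[u --> F] --> l -> lim_pt (f u @[u --> F]) = l.
Proof.
move=> fl; apply: xget_unique => // y fy.
exact: (@cvg_unique _ (@norm_hausdorff _ (R * R)%type) _ _ y l fy fl).
Qed.

Definition at_side b t : set_system R := if b then t^'+ else t^'-.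

Global Instance at_side_proper b t : ProperFilter (at_side b t).
Proof. by case: b; [exact: at_right_proper_filter | exact: at_left_proper_filter]. Qed.

Lemma near_at_side b t (P : set R) :
  (\forall s \near t, side b t s -> s != t -> P s) -> \forall s \near at_side b t, P s.
Proof.
case: b => H; rewrite /at_side near_withinE; apply: filterS H => s H st; apply: H => /=.
- exact: ltW.
- by rewrite gt_eqF.
- exact: ltW.
- by rewrite lt_eqF.
Qed.

Lemma cvg_at_side b t (T : topologicalType) (f F : R -> T) (l : T) :
  (\forall s \near t, side b t s -> s != t -> f s = F s) ->
  F s @[s --> t] --> l -> f s @[s --> at_side b t] --> l.
Proof.
move=> /near_at_side fF Fl.
have Fb : F s @[s --> at_side b t] --> l.
  by case: (b); apply: cvg_within_filter.
apply: cvg_trans Fb; apply: near_eq_cvg.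
by apply: filterS fF => s ->.
Qed.

Lemma integrable_oc (f : R -> R) lo hi : mu.-integrable `]lo, hi[ (EFin \o f) ->
  mu.-integrable `]lo, hi] (EFin \o f).
Proof.
have [lh|hl] := ltP lo hi; last first.
  move=> _; have -> : `]lo, hi]%classic = set0 :> set R by apply: set_itv_ge; rewrite bnd_simp -leNgt.
  exact: integrable_set0.
move=> /integrableP[mf If]; apply/integrableP.
have E : `]lo, hi]%classic = `]lo, hi[%classic `|` [set hi] :> set R.
  by rewrite setUitv1// bnd_simp.
have mf' : measurable_fun `]lo, hi] (EFin \o f).
  rewrite E; apply/measurable_funU => //; split => //.
  exact: measurable_fun_set1.
split => //.
rewrite -integral_itv_bndo_bndc//; apply: measurableT_comp => //.
Qed.

Lemma integrable_cat (f : R -> R) s t r : s <= t -> t <= r ->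
  mu.-integrable `]s, t] (EFin \o f) -> mu.-integrable `]t, r] (EFin \o f) ->
  mu.-integrable `]s, r] (EFin \o f) /\
  (\int[mu]_(x in `]s, r]) f x = \int[mu]_(x in `]s, t]) f x + \int[mu]_(x in `]t, r]) f x)%R.
Proof.
move=> st tr if1 if2.
have E : `]s, r]%classic = `]s, t]%classic `|` `]t, r]%classic :> set R.
  by rewrite -itv_bndbnd_setU// bnd_simp.
have D : [disjoint `]s, t]%classic & `]t, r]%classic].
  apply/disj_setPS => y [/=]; rewrite !in_itv/= => /andP[_ h1] /andP[h2 _].
  by have := lt_le_trans h2 h1; rewrite ltxx.
have I : mu.-integrable `]s, r] (EFin \o f).
  move/integrableP: if1 => [m1 i1]; move/integrableP: if2 => [m2 i2].
  have mf : measurable_fun (`]s, t]%classic `|` `]t, r]%classic) (EFin \o f).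
    exact/measurable_funU.
  rewrite E; apply/integrableP; split => //.
  rewrite ge0_integral_setU//; first exact: lte_add_pinfty.
  by apply: measurableT_comp.
split => //; rewrite E Rintegral_setU//.
by rewrite -E.
Qed.

Lemma Rint_lower (f F : R -> R) lo hi k : lo <= hi ->
  (forall r, lo < r -> r < hi -> f r = F r) ->
  (forall r, lo <= r -> r <= hi -> {for r, continuous F} /\ k <= F r) ->
  mu.-integrable `]lo, hi] (EFin \o f) /\
  k * (hi - lo) <= (\int[mu]_(x in `]lo, hi]) f x)%R.
Proof.
move=> lh fF HF.
have IF : mu.-integrable `[lo, hi] (EFin \o F).
  apply: continuous_compact_integrable; first exact: segment_compact.
  apply: continuous_in_subspaceT => r; rewrite inE/= in_itv/= => /andP[r1 r2].
  by have [] := HF r r1 r2.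
have IF' : mu.-integrable `]lo, hi[ (EFin \o F).
  by apply: integrableS IF => //; exact: subset_itv_oo_cc.
have If : mu.-integrable `]lo, hi[ (EFin \o f).
  apply: eq_integrable IF' => // r; rewrite inE/= in_itv/= => /andP[r1 r2].
  by rewrite fF.
split; first exact: integrable_oc.
rewrite -Rintegral_itv_bndo_bndc//.
have -> : k * (hi - lo) = (\int[mu]_(x in `]lo, hi[) k)%R.
  rewrite Rintegral_cst//; congr (_ * _).
  move: lh; rewrite le_eqVlt => /predU1P[->|lh].
    by rewrite subrr set_itvoo0 measure0.
  have mE : mu `]lo, hi[%classic = (hi - lo)%:E.
    by rewrite lebesgue_measure_itv/= lte_fin lh EFinB.
  by rewrite [X in fine X]mE.
apply: le_Rintegral => //.
  have Ik : mu.-integrable `[lo, hi] (EFin \o (fun=> k)).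
    apply: continuous_compact_integrable; first exact: segment_compact.
    by apply: continuous_subspaceT => ?; exact: cst_continuous.
  by apply: integrableS Ik => //; exact: subset_itv_oo_cc.
move=> r /=; rewrite in_itv/= => /andP[r1 r2]; rewrite fF//.
by have [|| _ ->//] := HF r; exact: ltW.
Qed.

End Glue.

(** * The pointwise inequality *)

Section Rate.
Context {R : realType}.
Implicit Types (u v w p : R * R) (t : R).

Definition frame t (x y : R) : R * R := x *: normal t + y *: tau t.

Lemma frameE t v : v = frame t (dot2 (normal t) v) (dot2 (tau t) v).
Proof.
rewrite /frame /normal /tau /dot2; apply: vec_eq; rewrite !pairE /=.
  transitivity ((cos t * cos t + sin t * sin t) * v.1); last by ring.
  by rewrite cos2sin2 mul1r.
transitivity ((cos t * cos t + sin t * sin t) * v.2); last by ring.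
by rewrite cos2sin2 mul1r.
Qed.

Lemma det2_frame t x y x' y' : det2 (frame t x y) (frame t x' y') = x * y' - y * x'.
Proof.
rewrite /det2 /frame !pairE /=.
transitivity ((cos t * cos t + sin t * sin t) * (x * y' - y * x')); first by ring.
by rewrite cos2sin2 mul1r.
Qed.

Lemma frameD t x y x' y' : frame t x y + frame t x' y' = frame t (x + x') (y + y').
Proof. by rewrite /frame; vring. Qed.

Lemma frameB t x y x' y' : frame t x y - frame t x' y' = frame t (x - x') (y - y').
Proof. by rewrite /frame; vring. Qed.

Lemma frameZ t k x y : k *: frame t x y = frame t (k * x) (k * y).
Proof. by rewrite /frame; vring. Qed.

(** Here [a] and [b] are the ends of a chord as seen from the centre of the
    pencil, [a'] and [b'] their velocities. Let s and s' = s - l be the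
    tangential coordinates of [a] and [b], and al and be the normal
    coordinates of [a'] and [b']. The terms in [q''] cancel, and the
    difference of the two sides is the mean of the slacks of the last two
    hypotheses plus the product of - al and be, which is nonnegative since the
    support conditions give al <= 0 <= be. *)
Lemma rate_bound t (W a b a' b' : R * R) (q q' q'' l : R) : 0 < l ->
  a - b = l *: tau t -> q = dot2 (normal t) a ->
  q' = dot2 (tau t) a + dot2 (normal t) a' ->
  q' = dot2 (tau t) b + dot2 (normal t) b' ->
  0 <= det2 a' (b - a) -> 0 <= det2 b' (a - b) ->
  det2 a' (b - a) <= det2 a' (W - 3 *: a) ->
  det2 b' (a - b) <= det2 b' (W - 3 *: b) ->
  - det2 (frame t q q') ((q + q'') *: tau t) <= det2 a a' + det2 b b' +
    (det2 ((q + q'') *: tau t) (2^-1 *: (a + b)) + det2 (frame t q q') (2^-1 *: (a' + b'))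
     - det2 W (2^-1 *: (a' + b'))).
Proof.
move=> l0 ab qa q'a q'b ca cb wa wb.
have qb : q = dot2 (normal t) b.
  have := congr1 (dot2 (normal t)) ab; rewrite qa /dot2 !pairE /=; lra.
have aE := frameE t a; have bE := frameE t b.
have a'E := frameE t a'; have b'E := frameE t b'; have WE := frameE t W.
rewrite -qa in aE; rewrite -qb in bE.
move: aE bE a'E b'E WE q'a q'b; set s := dot2 (tau t) a; set s' := dot2 (tau t) b.
set al := dot2 (normal t) a'; set al' := dot2 (tau t) a'.
set be := dot2 (normal t) b'; set be' := dot2 (tau t) b'.
set w := dot2 (normal t) W; set w' := dot2 (tau t) W.
move=> aE bE a'E b'E WE q'a q'b.
have XE' : (q + q'') *: tau t = frame t 0 (q + q'') by rewrite /frame scale0r add0r.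
have sl : s - s' = l.
  have := congr1 (dot2 (tau t)) ab; rewrite -/s /s /s'.
  have -> : dot2 (tau t) (a - b) = dot2 (tau t) a - dot2 (tau t) b by rewrite /dot2 !pairE; ring.
  by move=> ->; rewrite -[RHS]mulr1 -(dot2_tau t) /dot2 !pairE; ring.
move: ca cb wa wb; rewrite XE' aE bE a'E b'E WE.
rewrite !(frameZ, frameD, frameB, det2_frame).
move=> ca cb wa wb.
have al0 : al <= 0.
  have : 0 <= l * (- al) by move: ca; rewrite -sl; lra.
  by rewrite pmulr_rge0// oppr_ge0.
have be0 : 0 <= be.
  have : 0 <= l * be by move: cb; rewrite -sl; lra.
  by rewrite pmulr_rge0.
have pos : 0 <= (- al) * be by rewrite mulr_ge0// oppr_ge0.
have q1 : q' = s + al by rewrite q'a.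
have q2 : s' = s + al - be by move: q'a q'b; lra.
move: wa wb ca cb pos; rewrite q1 q2; nra.
Qed.

End Rate.

(** * The front and its jumps *)

Section Fronts.
Context {R : realType}.
Implicit Types (r t : R) (b : bool) (Q : R -> R) (A B : R -> R * R) (z w v : R * R).
Variables (C : set (R * R)) (s : R * R -> R * R) (p : R * R).

Let q := q_ C s p.
Let X := front C s p.

(** The front as computed from a germ [Q] of [q]. *)
Definition frontQ Q r := p + frame r (Q r) (derive1 Q r).

Lemma isd2_frontQ Q r : Ck 2 Q r ->
  isd2 (frontQ Q) r ((Q r + derive1 (derive1 Q) r) *: tau r).
Proof.
move=> CQ; have dQ := Ck_derive1 CQ; have dQ' := Ck_derive1 (Ck_D CQ).
apply: isd2_eq (isd2D (isd2_cst p r) (isd2D (isd2Z dQ (isd2_normal r)) (isd2Z dQ' (isd2_tau r)))) _.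
by vring.
Qed.

Lemma front_nearE Q r : (\forall z \near r, q z = Q z) ->
  \forall z \near r, derive1 q z = derive1 Q z /\ X z = frontQ Q z.
Proof.
move=> qQ; have dqQ : \forall z \near r, derive1 q z = derive1 Q z.
  by apply: filterS (near_near qQ) => z; exact: near_eq_derive1.
by apply: filterS2 qQ dqQ => z e1 e2; split; rewrite // /X /front /frontQ /frame -/q e1 e2 addrA.
Qed.

Lemma germ_nearby b Q r : germ b 2 q Q r ->
  \forall t \near r, side b r t -> t != r -> (\forall z \near t, q z = Q z) /\ Ck 2 Q t.
Proof.
move=> qQ; have G : germ2 b 2 (fun t => (q t, q t)) (fun t => (Q t, Q t)) r by split.
apply: filterS (germ2_nearby G) => t H bt tr; have [H1 H2] := H bt tr.
split; first by apply: filterS H1 => z [].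
by have [[]] := H2 true.
Qed.

Lemma derive1_front Q r : (\forall z \near r, q z = Q z) -> Ck 2 Q r ->
  derive1 X r = (Q r + derive1 (derive1 Q) r) *: tau r.
Proof.
move=> qQ CQ; rewrite -(derive1_pair (isd2_frontQ CQ)) !derive1E.
by apply: near_eq_derive; apply: filterS (front_nearE qQ) => z [].
Qed.

Lemma frontQ_cont Q r : Ck 2 Q r -> frontQ Q u @[u --> r] --> frontQ Q r.
Proof.
move=> CQ; have [h1 h2] : Ck2 1 (frontQ Q) r.
  apply: Ck2D; first exact: Ck2_cst.
  by apply: Ck2D; apply: Ck2Z; [exact: Ck_le CQ | exact: Ck2_normal | exact: Ck_D | exact: Ck2_tau].
have H : ((frontQ Q u).1, (frontQ Q u).2) @[u --> r] --> ((frontQ Q r).1, (frontQ Q r).2).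
  exact: cvg_pair (Ck_cont1 h1) (Ck_cont1 h2).
have E : (fun u => ((frontQ Q u).1, (frontQ Q u).2)) = frontQ Q.
  by apply/funext => u; rewrite -surjective_pairing.
by rewrite E -surjective_pairing in H.
Qed.

Lemma side_limits b Q r : germ b 2 q Q r ->
  (derive1 q u @[u --> at_side b r] --> derive1 Q r) /\
  (X u @[u --> at_side b r] --> frontQ Q r).
Proof.
move=> qQ; have [CQ _] := qQ; have near_ := germ_nearby qQ.
split.
  apply: (@cvg_at_side _ _ _ _ _ (derive1 Q)); last exact: Ck_cont1 (Ck_D CQ).
  apply: filterS near_ => t H bt tr; have [e _] := H bt tr.
  by have [] := nbhs_singleton (front_nearE e).
apply: (@cvg_at_side _ _ _ _ _ (frontQ Q)); last exact: frontQ_cont.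
apply: filterS near_ => t H bt tr; have [e _] := H bt tr.
by have [] := nbhs_singleton (front_nearE e).
Qed.

Lemma germ_smooth b Q r : (\forall z \near r, q z = Q z) -> Ck 2 Q r -> germ b 2 q Q r.
Proof. by move=> qQ CQ; split => //; apply: filterS qQ. Qed.

Lemma lim_deriv b Q r : germ b 2 q Q r -> lim (derive1 q u @[u --> at_side b r]) = derive1 Q r.
Proof. by move=> /side_limits[h _]; apply: cvg_lim. Qed.

Lemma lim_front b Q r : germ b 2 q Q r -> lim_pt (X u @[u --> at_side b r]) = frontQ Q r.
Proof. by move=> /side_limits[_ h]; apply: lim_pt_eq. Qed.

Definition q_right r := lim (derive1 q u @[u --> r^'+]).
(** The front made continuous from the right, so that each of its jumps is
    seen on the left of its angle only. *)
Definition frontR r := p + frame r (q r) (q_right r).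

Lemma frontR_germ Q r : germ true 2 q Q r -> frontR r = frontQ Q r.
Proof. by move=> G; rewrite /frontR /frontQ /q_right (lim_deriv G) (germ_at G). Qed.

Lemma frontR_nearby b Q r : germ b 2 q Q r ->
  \forall t \near r, side b r t -> t != r -> frontR t = frontQ Q t /\ ~ jumps C s p t.
Proof.
move=> /germ_nearby; apply: filterS => t H bt tr; have [e CQ] := H bt tr.
split; first exact: frontR_germ (germ_smooth _ e CQ).
move=> [_]; apply.
have := lim_deriv (germ_smooth false e CQ); have := lim_deriv (germ_smooth true e CQ).
by rewrite /at_side => -> ->.
Qed.

Lemma segment_form x y : det_form (segment x y) 0 1 = det2 x (y - x) :> R.
Proof.
have dS (r : R) : derive1 (segment x y) r = y - x.
  apply: derive1_pair; apply: isd2_eq (isd2D (isd2_cst x r) (isd2Z (is_derive_id r 1) (isd2_cst (y - x) r))) _.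
  by vring.
rewrite /det_form.
have E (r : R) : det2 (segment x y r) (derive1 (segment x y) r) = det2 x (y - x).
  by rewrite dS /segment det2Dl det2Zl det2vv mulr0 addr0.
under eq_Rintegral do rewrite E.
rewrite Rintegral_cst//; have m1 : lebesgue_measure (`[0, 1]%classic : set R) = 1%E.
  by rewrite lebesgue_measure_itv/= lte_fin ltr01 oppr0 adde0.
by rewrite [X in fine X]m1 mulr1.
Qed.

Definition jump_form r := det_form (segment (lim_pt (X u @[u --> r^'-]))
                                            (lim_pt (X u @[u --> r^'+]))) 0 1.

Lemma jump_formE Ql Qr r : germ false 2 q Ql r -> germ true 2 q Qr r ->
  jump_form r = det2 (frontQ Ql r) (frontR r - frontQ Ql r).
Proof.
move=> Gl Gr; rewrite /jump_form segment_form.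
have := lim_front Gl; have := lim_front Gr; rewrite /at_side => -> ->.
by rewrite (frontR_germ Gr).
Qed.

Lemma front_no_jump Ql Qr r : germ false 2 q Ql r -> germ true 2 q Qr r ->
  r \in `]0, pi] -> ~ jumps C s p r -> frontQ Ql r = frontR r.
Proof.
move=> Gl Gr r0 nj.
rewrite (frontR_germ Gr) /frontQ -(germ_at Gl) -(germ_at Gr).
suff -> : derive1 Ql r = derive1 Qr r by [].
have := lim_deriv Gl; have := lim_deriv Gr; rewrite /at_side => e1 e2.
by rewrite -e1 -e2; apply: contrapT => ne; apply: nj; split.
Qed.

End Fronts.

(** * Swept sectors and the rate of the energy *)

Lemma isd2Zc {R : realType} (k t : R) (X : R -> R * R) v : isd2 X t v ->
  isd2 (fun r => k *: X r) t (k *: v).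
Proof.
move=> dX; have dk : is_derive (t : R) 1 (fun=> k) 0 by exact: is_derive_cst.
by apply: isd2_eq (isd2Z dk dX) _; rewrite scale0r add0r.
Qed.

(** What the energy estimate uses of the image chords: [c th] is the end
    towards [tau th] of the chord with normal [normal th], and [P1], [P2],
    [P3] are the vertices of a triangle as in [max_triangle]. *)
Record chord_family {R : realType} (C : set (R * R)) (s : R * R -> R * R) (p : R * R)
    (c : R -> R * R) (P1 P2 P3 : R * R) : Prop := ChordFamily {
  cf_q : forall th, q_ C s p th = dot2 (normal th) (c th - p);
  cf_germ : forall th b, exists A, [/\ germ2 b 2 c A th,
    forall w, C w -> 0 <= det2 (der A th) (w - c th),
    0 < det2 (der A th) (p - c th) &
    forall w, C w ->
      det2 (der A th) (w - c th) <= det2 (der A th) (P1 + P2 + P3 - 3 *: c th)];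
  cf_2pi : forall th, c (th + pi + pi) = c th;
  cf_chord : forall th, exists2 l, 0 < l & c th - c (th + pi) = l *: tau th;
  cf_rays : forall th1 th2 k,
    0 < k -> c th1 - p = k *: (c th2 - p) -> tau th1 = tau th2;
  cf_C : forall th, C (c th);
  cf_meas : measurable (region C : set (measurableTypeR R * measurableTypeR R));
  cf_reg : forall th l, 0 < l -> l < 1 -> region C (p + l *: (c th - p));
  cf_fin : ((@lebesgue_measure R \x @lebesgue_measure R)%E (region C) < +oo)%E }.

Section Energy.
Context {R : realType}.
Implicit Types (r t th lo hi : R) (b : bool) (Q : R -> R) (A B : R -> R * R) (z w v : R * R).
Local Notation mu := (@lebesgue_measure R).
Local Notation mu2 := (mu \x mu)%E.
Variables (C : set (R * R)) (s : R * R -> R * R) (p : R * R) (c : R -> R * R).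
Variables (P1 P2 P3 : R * R).
Hypothesis HC : chord_family C s p c P1 P2 P3.

Let q := q_ C s p.
Let X := front C s p.
Let cq : forall th, q th = dot2 (normal th) (c th - p) := cf_q HC.
Let c_germ := cf_germ HC.
Let c_chord := cf_chord HC.
Let c_rays := cf_rays HC.
Let c_C := cf_C HC.
Let c_reg := cf_reg HC.
Let fin_reg := cf_fin HC.

Definition tri_vec := P1 + P2 + P3 - 3 *: p.
Definition alpha th := c th - p.
Definition beta th := alpha (th + pi).
Definition midpt th := 2^-1 *: (alpha th + beta th).

Lemma alpha_germ th b : exists A, [/\ germ2 b 2 alpha A th,
  forall w, C w -> 0 <= det2 (der A th) (w - p - alpha th),
  0 < det2 (alpha th) (der A th) &
  forall w, C w -> det2 (der A th) (w - p - alpha th) <= det2 (der A th) (tri_vec - 3 *: alpha th)].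
Proof.
have [A [cA h1 h2 h3]] := c_germ th b.
have d : der (fun r => A r - p) th = der A th.
  rewrite (isd2_der (isd2B (Ck2_isd2 (germ2_Ck2 (germ2_le (isT : (1 <= 2)%N) cA))) (isd2_cst p th))).
  by rewrite subr0.
have e w : w - p - alpha th = w - c th by rewrite /alpha; vring.
exists (fun r => A r - p); split.
- by apply: germ2B cA _; exact: germ2_cst.
- by move=> w Cw; rewrite d e; exact: h1.
- by rewrite d det2C -det2Nr /alpha opprB.
- move=> w Cw; rewrite d e; apply: le_trans (h3 w Cw) _.
  suff -> : P1 + P2 + P3 - 3 *: c th = tri_vec - 3 *: alpha th by [].
  by rewrite /tri_vec /alpha; vring.
Qed.

Lemma beta_germ th b : exists B, [/\ germ2 b 2 beta B th,
  forall w, C w -> 0 <= det2 (der B th) (w - p - beta th),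
  0 < det2 (beta th) (der B th) &
  forall w, C w -> det2 (der B th) (w - p - beta th) <= det2 (der B th) (tri_vec - 3 *: beta th)].
Proof.
have [B [bB h1 h2 h3]] := alpha_germ (th + pi) b.
have dB := Ck2_isd2 (germ2_Ck2 (germ2_le (isT : (1 <= 2)%N) bB)).
have ds : is_derive (th : R) 1 (fun r => r + pi) 1.
  by apply: isd_eq (isdD (is_derive_id _ _) (is_derive_cst pi _ _)) _; rewrite addr0.
have d : der (fun r => B (r + pi)) th = der B (th + pi).
  by rewrite (isd2_der (@isd2_comp _ B (fun r => r + pi) _ _ _ dB ds)) scale1r.
exists (fun r => B (r + pi)); rewrite d; split => //.
apply: (@germ2_comp _ b 2 alpha B (fun r => r + pi)) => //.
  by apply: germ_Ck; apply: CkD; [exact: Ck_id | exact: Ck_cst].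
by near=> r; case: (b) => /=; lra.
Unshelve. all: by end_near. Qed.

Lemma q_beta th : q th = dot2 (normal th) (beta th).
Proof.
rewrite cq; have [l _ e] := c_chord th.
rewrite /beta /alpha; have -> : c th - p = (c (th + pi) - p) + l *: tau th by rewrite -e; vring.
have := normal_tau0 th; rewrite /dot2 !pairE => e0.
set t1 := (normal th).1 in e0 *; set t2 := (normal th).2 in e0 *.
set u1 := (tau th).1 in e0 *; set u2 := (tau th).2 in e0 *.
have -> : t1 * ((c (th + pi)).1 - p.1 + l * u1) + t2 * ((c (th + pi)).2 - p.2 + l * u2) =
  t1 * ((c (th + pi)).1 - p.1) + t2 * ((c (th + pi)).2 - p.2) + l * (t1 * u1 + t2 * u2) by ring.
by rewrite e0 mulr0 addr0.
Qed.

Lemma normal_germ (a : R -> R * R) A th b : germ2 b 2 a A th ->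
  germ b 2 (fun r => dot2 (normal r) (a r)) (fun r => dot2 (normal r) (A r)) th /\
  derive1 (fun r => dot2 (normal r) (A r)) th =
    dot2 (tau th) (a th) + dot2 (normal th) (der A th).
Proof.
move=> aA; split.
  split; first by apply: Ck_dot2; [exact: Ck2_normal | exact: germ2_Ck2 aA].
  by apply: filterS (germ2_near aA) => r H br; rewrite H.
have dA := Ck2_isd2 (germ2_Ck2 (germ2_le (isT : (1 <= 2)%N) aA)).
by rewrite (isd_derive1 (isd2_dot (isd2_normal th) dA)) (germ2_at aA).
Qed.

(** The potential Z whose derivative is the last term of [rate_bound]; it is
    computed from germs here, and from the front continuous from the right in
    [potential]. *)
Definition potentialQ A B Q r := det2 (frontQ p Q r - p) (2^-1 *: (A r + B r))
  - det2 p (frontQ p Q r) - det2 tri_vec (2^-1 *: (A r + B r)).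
Definition area_rateQ Q r := det2 (frontQ p Q r) ((Q r + derive1 (derive1 Q) r) *: tau r).
Definition area_rate r := det2 (X r) (derive1 X r).
Definition potential r := det2 (frontR C s p r - p) (midpt r) - det2 p (frontR C s p r) - det2 tri_vec (midpt r).

(** Apply [rate_bound] with the supporting functions at either end of the
    chord evaluated at the other end. *)
Lemma energy_rate th b : exists A B Q, [/\ germ2 b 2 alpha A th, germ2 b 2 beta B th,
  germ b 2 q Q th, 0 < det2 (alpha th) (der A th) /\ 0 < det2 (beta th) (der B th) &
  exists2 dz, is_derive (th : R) 1 (potentialQ A B Q) dz &
    - area_rateQ Q th <= det2 (alpha th) (der A th) + det2 (beta th) (der B th) + dz].
Proof.
have [A [aA hA1 hA2 hA3]] := alpha_germ th b.
have [B [bB hB1 hB2 hB3]] := beta_germ th b.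
pose Q r := dot2 (normal r) (A r).
have [qQ dQ] := normal_germ aA; rewrite -/Q in qQ dQ.
have qE : q = fun r => dot2 (normal r) (alpha r) by apply/funext => r; rewrite cq.
rewrite -qE in qQ.
have [qQ' dQ'] := normal_germ bB.
have qE' : q = fun r => dot2 (normal r) (beta r) by apply/funext => r; exact: q_beta.
rewrite -qE' in qQ'.
have dQB := germ_unique (germ_le (isT : (1 <= 2)%N) qQ) (germ_le (isT : (1 <= 2)%N) qQ').
have [CQ _] := qQ.
exists A, B, Q; split => //.
have [l l0 cl] := c_chord th.
have ab : alpha th - beta th = l *: tau th by rewrite -cl /beta /alpha; vring.
have e1 : beta th - alpha th = c (th + pi) - p - alpha th by rewrite /beta.
have e2 : alpha th - beta th = c th - p - beta th by [].
have Qa : Q th = dot2 (normal th) (alpha th) by rewrite /Q (germ2_at aA).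
have := rate_bound (derive1 (derive1 Q) th) l0 ab Qa dQ (etrans dQB dQ')
  (hA1 _ (c_C (th + pi))) (hB1 _ (c_C th)) (hA3 _ (c_C (th + pi))) (hB3 _ (c_C th)).
set v := _ *: tau th => rate.
have dX : isd2 (frontQ p Q) th v by exact: isd2_frontQ.
have dA := Ck2_isd2 (germ2_Ck2 (germ2_le (isT : (1 <= 2)%N) aA)).
have dB := Ck2_isd2 (germ2_Ck2 (germ2_le (isT : (1 <= 2)%N) bB)).
have dM : isd2 (fun r => 2^-1 *: (A r + B r)) th (2^-1 *: (der A th + der B th)).
  exact: isd2Zc (isd2D dA dB).
exists (det2 v (2^-1 *: (alpha th + beta th)) + det2 (frame th (Q th) (derive1 Q th)) (2^-1 *: (der A th + der B th))
   - det2 p v - det2 tri_vec (2^-1 *: (der A th + der B th))).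
  apply: isd_eq (isdB (isdB (isd2_det (isd2B dX (isd2_cst p th)) dM) (isd2_det (isd2_cst p th) dX))
    (isd2_det (isd2_cst tri_vec th) dM)) _.
  rewrite subr0 -(germ2_at aA) -(germ2_at bB).
  have -> : frontQ p Q th - p = frame th (Q th) (derive1 Q th) by rewrite /frontQ; vring.
  by rewrite /det2 !pairE; ring.
move: rate; rewrite /area_rateQ -/v /frontQ det2Dl; lra.
Qed.

(** Both ends of each chord are included, so that the angles from 0 to [pi]
    cover a full turn about [p]. *)
Definition sector lo hi : set (R * R) := [set z | exists th l,
  [/\ (lo < th < hi) || (lo + pi < th < hi + pi), 0 < l, l < 1 & z = p + l *: alpha th]].

Lemma tau_eq th1 th2 : tau th1 = tau th2 -> - (2 * pi) < th1 - th2 < 2 * pi -> th1 = th2.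
Proof.
have key d : 0 < d -> d < 2 * pi -> cos d != 1 :> R.
  move=> d0 d1; have s0 : 0 < sin (d / 2) by apply: sin_gt0_pi; lra.
  have -> : d = d / 2 + d / 2 by field.
  rewrite cosD; apply/eqP => H.
  have := cos2sin2 (d / 2); nra.
move=> [e1 e2] /andP[d1 d2].
have cd : cos (th1 - th2) = 1.
  rewrite cosB e2; have -> : sin th1 = sin th2 by lra.
  exact: cos2sin2.
have [h|h|//] := ltgtP th1 th2.
  have h1 : 0 < th2 - th1 by lra.
  have h2 : th2 - th1 < 2 * pi by lra.
  by have := key _ h1 h2; rewrite -[th2 - th1]opprB cosN cd eqxx.
have h1 : 0 < th1 - th2 by lra.
by have := key _ h1 d2; rewrite cd eqxx.
Qed.

Lemma same_ray th1 th2 l1 l2 : 0 < l1 -> 0 < l2 ->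
  p + l1 *: alpha th1 = p + l2 *: alpha th2 -> tau th1 = tau th2.
Proof.
move=> l10 l20 /addrI e; apply: (@c_rays _ _ (l2 / l1)); first by rewrite divr_gt0.
by rewrite -/(alpha th1) -/(alpha th2) mulrC -scalerA -e scalerA mulVf ?scale1r// gt_eqF.
Qed.

Lemma sector_disj lo t hi : 0 <= lo -> lo <= t -> t <= hi -> hi <= pi ->
  sector lo t `&` sector t hi `<=` set0.
Proof.
move=> lo0 lot thi hipi z [[th1 [l1 [h1 l10 _ ->]]] [th2 [l2 [h2 l20 _ e]]]].
have te := same_ray l10 l20 e.
have pi0 := pi_gt0 R.
have tE : th1 = th2.
  apply: (tau_eq te); case/orP: h1 => /andP[? ?]; case/orP: h2 => /andP[? ?]; apply/andP; split; lra.
rewrite -tE in h2.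
by case/orP: h1 => /andP[? ?]; case/orP: h2 => /andP[? ?]; lra.
Qed.

Lemma sector_reg lo hi : sector lo hi `<=` region C.
Proof. by move=> z [th [l [_ l0 l1 ->]]]; exact: c_reg. Qed.

Lemma sector_sub lo hi lo' hi' : lo' <= lo -> hi <= hi' -> sector lo hi `<=` sector lo' hi'.
Proof.
move=> h1 h2 z [th [l [h l0 l1 e]]]; exists th, l; split => //.
by case/orP: h => /andP[a1 a2]; apply/orP; [left | right]; apply/andP; split; lra.
Qed.

Lemma meas_fin (S : set (measurableTypeR R * measurableTypeR R)) : measurable S -> S `<=` region C ->
  mu2 S \is a fin_num.
Proof.
move=> mS SC; rewrite ge0_fin_numE//.
apply: le_lt_trans fin_reg; apply: le_measure; rewrite ?inE//.
exact: cf_meas HC.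
Qed.

(** By the intermediate value theorem, a point of the triangle lies on the ray
    from [p] through [c t] for some [t] between [lo] and [hi]. The triangle is
    on one side of the support line at [c t], so the point comes before [c t]
    on this ray. *)
Lemma triangle_in_sector th b : \forall r \near th, side b th r -> r != th ->
  forall lo hi, lo = (if b then th else r) -> hi = (if b then r else th) ->
  0 < det2 (alpha lo) (alpha hi) /\
  triangle p (c lo) (c hi) `<=`
    [set z | exists t l, [/\ lo < t < hi, 0 < l, l < 1 & z = p + l *: alpha t]].
Proof.
have [A [aA _ dA _]] := alpha_germ th b.
have DA := Ck2_isd2 (germ2_Ck2 (germ2_le (isT : (1 <= 2)%N) aA)).
have d' : 0 < det2 0 (A th) + det2 (alpha th) (der A th) by rewrite /det2 !mul0r subrr add0r.
have inc := isd_incr (isd2_det (isd2_cst (alpha th) th) DA) d'.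
have cA : \forall r \near th, {for r, continuous (fun r => (A r).1)} /\ {for r, continuous (fun r => (A r).2)}.
  by have [C1 C2] := germ2_Ck2 aA; apply: filterS2 (Ck_cont C1) (Ck_cont C2).
have [e e0 He] := near_itv (filterI (germ2_near aA) (filterI inc cA)).
apply: (itv_near e0) => r /andP[r1 r2] br rth lo hi loE hiE.
have lh : lo < hi.
  by rewrite loE hiE; move: br rth; case: (b) => /= h1 h2; rewrite lt_neqAle h1 ?h2// eq_sym h2.
have near_ t : lo <= t -> t <= hi -> side b th t /\ th - e <= t <= th + e.
  by move: br; rewrite loE hiE; case: (b) => /= h h1 h2; split => //; apply/andP; split; lra.
have alA t : lo <= t -> t <= hi -> alpha t = A t.
  by move=> h1 h2; have [bt te] := near_ t h1 h2; have [h _] := He t te; exact: h.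
have sgn t : lo <= t -> t <= hi -> t != th ->
    if b then 0 < det2 (alpha th) (alpha t) else det2 (alpha th) (alpha t) < 0.
  move=> h1 h2 tth; have [bt te] := near_ t h1 h2; have [_ [[i1 i2] _]] := He t te.
  have zero : det2 (alpha th) (A th) = 0 by rewrite -(germ2_at aA) det2vv.
  rewrite (alA t h1 h2); move: bt i1 i2; rewrite zero; case: (b) => /= bt i1 i2.
    by apply: i1; rewrite lt_neqAle eq_sym tth.
  by apply: i2; rewrite lt_neqAle tth.
have D0 : 0 < det2 (alpha lo) (alpha hi).
  have := sgn r; move: br; rewrite loE hiE; case: (b) => /= br H; first exact: H.
  by rewrite det2C oppr_gt0; exact: H.
split => // z [t1 t2 t3].
have t1' : 0 < det2 (alpha lo) (z - p) by [].
have t3' : det2 (alpha hi) (z - p) < 0.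
  have -> : det2 (alpha hi) (z - p) = - det2 (p - c hi) (z - c hi).
    by rewrite /alpha /det2 !pairE; ring.
  by rewrite oppr_lt0.
have cont t : lo <= t <= hi -> {for t, continuous (fun t => det2 (A t) (z - p))}.
  move=> /andP[h1 h2]; have [bt te] := near_ t h1 h2; have [_ [_ [c1 c2]]] := He t te.
  have c1' : (A u).1 @[u --> t] --> (A t).1 by exact: c1.
  have c2' : (A u).2 @[u --> t] --> (A t).2 by exact: c2.
  exact: cvgB (cvgM c1' (cvg_cst _)) (cvgM c2' (cvg_cst _)).
have [|t /andP[tlo thi] t0] := ivt0 (ltW lh) cont.
  rewrite -!alA ?lexx ?(ltW lh)//; apply: ltW; rewrite pmulr_rlt0//.
rewrite -alA// in t0.
have at0 : alpha t != 0.
  by have [A' [_ _ d _]] := alpha_germ t true; apply: contraTneq d => ->; rewrite /det2 !mul0r subrr ltxx.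
have := @det2_0P _ (z - p) (alpha t) at0; rewrite det2C t0 oppr0 => /(_ erefl).
set l := _ / _ => zE.
have tlo' : t != lo by apply: contraTneq t1' => <-; rewrite t0 ltxx.
have thi' : t != hi by apply: contraTneq t3' => <-; rewrite t0 ltxx.
have l0 : 0 < l.
  have := sgn t tlo thi; move: t1' t3'; rewrite loE hiE zE !det2Zr; case: (b) loE hiE => loE hiE.
    move=> h _ h2; have h3 : 0 < det2 (alpha th) (alpha t) by apply: h2; rewrite -loE.
    by move: h; rewrite pmulr_lgt0.
  move=> _ h h2; have h3 : det2 (alpha th) (alpha t) < 0 by apply: h2; rewrite -hiE.
  by move: h; rewrite nmulr_llt0.
exists t, l; split => //.
- by rewrite !lt_neqAle tlo thi eq_sym tlo' thi'.
- have [A' [aA' hA1 hA2 _]] := alpha_germ t true.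
  have f1 := hA1 _ (c_C lo); have f2 := hA1 _ (c_C hi).
  have : 0 < det2 (alpha lo) (alpha hi) * det2 (der A' t) (z - p - alpha t).
    have -> : det2 (alpha lo) (alpha hi) * det2 (der A' t) (z - p - alpha t) =
      det2 (c hi - c lo) (z - c lo) * det2 (alpha t) (der A' t) +
      (det2 (p - c hi) (z - c hi) * det2 (der A' t) (c lo - p - alpha t) +
       det2 (c lo - p) (z - p) * det2 (der A' t) (c hi - p - alpha t)).
      by rewrite /alpha /det2 !pairE; ring.
    apply: ltr_wpDr; last exact: mulr_gt0.
    by apply: addr_ge0; apply: mulr_ge0 => //; exact: ltW.
  rewrite pmulr_rgt0// zE.
  have -> : l *: alpha t - alpha t = (l - 1) *: alpha t by rewrite scalerBl scale1r.
  rewrite det2Zr det2C mulrN -mulNr pmulr_lgt0// oppr_gt0 subr_lt0.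
  by [].
- by rewrite -zE addrC subrK.
Qed.

End Energy.

(** * The energy is at most the area *)

Section Arith.
Context {R : realFieldType}.
Implicit Types (th r e : R).

Lemma add_halves (x y u v : R) : u / 2 <= x -> v / 2 <= y -> u + v <= 2 * (x + y).
Proof. by lra. Qed.

Lemma itv_shift th r e (k : R) : th - e < r -> r < th + e ->
  th + k - e <= r + k <= th + k + e.
Proof. by move=> ? ?; apply/andP; split; lra. Qed.

Lemma itv_between th r e (t : R) : 0 < e -> th - e <= r -> r <= th + e ->
  (th <= t -> t <= r -> th - e <= t <= th + e) /\
  (r <= t -> t <= th -> th - e <= t <= th + e).
Proof. by move=> ? ? ?; split=> ? ?; apply/andP; split; lra. Qed.

(** The integral and the three increments are each within [eps / 4] times the
    length of their first order values. *)
Lemma rate_right (l f I d1 d2 D1 D2 dz z0 z1 m eps : R) : 0 < l ->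
  (f - eps / 4) * l <= I -> D1 + D2 <= 2 * m ->
  `|D1 - d1 * l| <= eps / 4 * `|l| -> `|D2 - d2 * l| <= eps / 4 * `|l| ->
  `|z1 - z0 - dz * l| <= eps / 4 * `|l| -> - f <= d1 + d2 + dz ->
  - I <= z1 - z0 + 2 * m + eps * l.
Proof.
move=> l0; rewrite (gtr0_norm l0) => Il Dm.
move=> /ler_normlP[h1 h1'] /ler_normlP[h2 h2'] /ler_normlP[h3 h3'] rate.
have := @ler_wpM2r _ l (ltW l0) _ _ rate; lra.
Qed.

Lemma rate_left (l f I d1 d2 D1 D2 dz z0 z1 m eps : R) : l < 0 ->
  (f - eps / 4) * (- l) <= I -> - D1 - D2 <= 2 * m ->
  `|D1 - d1 * l| <= eps / 4 * `|l| -> `|D2 - d2 * l| <= eps / 4 * `|l| ->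
  `|z1 - z0 - dz * l| <= eps / 4 * `|l| -> - f <= d1 + d2 + dz ->
  - I <= z0 - z1 + 2 * m + eps * (- l).
Proof.
move=> l0; rewrite (ltr0_norm l0) => Il Dm.
move=> /ler_normlP[h1 h1'] /ler_normlP[h2 h2'] /ler_normlP[h3 h3'] rate.
have l1 : 0 <= - l by rewrite oppr_ge0 ltW.
have := @ler_wpM2r _ (- l) l1 _ _ rate; lra.
Qed.

End Arith.

Section EnergyBound.
Context {R : realType}.
Implicit Types (r t th lo hi : R) (b : bool) (Q : R -> R) (A B : R -> R * R) (z w v : R * R).
Local Notation mu := (@lebesgue_measure R).
Local Notation mu2 := (mu \x mu)%E.
Variables (C : set (R * R)) (s : R * R -> R * R) (p : R * R) (c : R -> R * R).
Variables (P1 P2 P3 : R * R).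
Hypothesis HC : chord_family C s p c P1 P2 P3.

Local Notation q := (q_ C s p).
Local Notation al := (alpha p c).
Local Notation be := (beta p c).
Local Notation ZQ := (potentialQ p P1 P2 P3).
Local Notation FQ := (area_rateQ p).
Local Notation F := (area_rate C s p).
Local Notation Z := (potential C s p c P1 P2 P3).
Local Notation sector := (sector p c).

(** The two determinants are twice the areas of two triangles of the sector,
    which are disjoint because they lie on different rays from [p]. *)
Lemma sector_mass lo hi : 0 <= lo -> hi <= pi ->
  0 < det2 (al lo) (al hi) -> 0 < det2 (be lo) (be hi) ->
  triangle p (c lo) (c hi) `<=`
    [set z | exists t l, [/\ lo < t < hi, 0 < l, l < 1 & z = p + l *: al t]] ->
  triangle p (c (lo + pi)) (c (hi + pi)) `<=`
    [set z | exists t l, [/\ lo + pi < t < hi + pi, 0 < l, l < 1 & z = p + l *: al t]] ->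
  exists S : set (measurableTypeR R * measurableTypeR R), [/\ measurable S,
    S `<=` sector lo hi &
    det2 (al lo) (al hi) + det2 (be lo) (be hi) <= 2 * fine (mu2 S)].
Proof.
move=> lo0 hipi D1 D2 T1 T2.
pose S1 := triangle p (c lo) (c hi) : set (measurableTypeR R * measurableTypeR R).
pose S2 := triangle p (c (lo + pi)) (c (hi + pi)) : set (measurableTypeR R * measurableTypeR R).
have m1 : measurable S1 by exact: triangle_measurable.
have m2 : measurable S2 by exact: triangle_measurable.
have s1 : S1 `<=` sector lo hi.
  by move=> z /T1[t [l [h l0 l1 e]]]; exists t, l; split; rewrite // h.
have s2 : S2 `<=` sector lo hi.
  by move=> z /T2[t [l [h l0 l1 e]]]; exists t, l; split; rewrite // h orbT.
have d12 : [disjoint S1 & S2].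
  apply/disj_setPS => z [/T1[t [l [/andP[h1 h2] l0 l1 e]]] /T2[t' [l' [/andP[h1' h2'] l0' l1' e']]]].
  rewrite e in e'; have te := same_ray HC l0 l0' e'.
  have pi0 := pi_gt0 R.
  have : t = t' by apply: (tau_eq te); apply/andP; split; lra.
  lra.
exists (S1 `|` S2); split.
- exact: measurableU.
- by move=> z [/s1|/s2].
have f1 : mu2 S1 \is a fin_num.
  by apply: (meas_fin HC) => //; apply: subset_trans s1 _; exact: sector_reg HC _ _.
have f2 : mu2 S2 \is a fin_num.
  by apply: (meas_fin HC) => //; apply: subset_trans s2 _; exact: sector_reg HC _ _.
have fin_le (a : \bar R) (x : R) : a \is a fin_num -> (x%:E <= a)%E -> x <= fine a.
  by move=> fa; rewrite -{1}(fineK fa) lee_fin.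
have t1 := fin_le _ _ f1 (measure_triangle D1).
have t2 := fin_le _ _ f2 (measure_triangle D2).
have -> : fine (mu2 (S1 `|` S2)) = fine (mu2 S1) + fine (mu2 S2).
  by rewrite -(fineD f1 f2); congr fine; apply: measureU => //; exact/eqP.
exact: add_halves t1 t2.
Qed.


(** On a short interval at [th], the derivatives in [energy_rate] are replaced
    by increments, and the swept area by the measure of the triangles of
    [sector_mass]. *)
Lemma local_bound th b eps : 0 < eps -> exists A B Q,
  [/\ germ2 b 2 al A th, germ2 b 2 be B th, germ b 2 q Q th &
  \forall r \near th, side b th r -> r != th ->
    [/\ Z r = ZQ A B Q r, ~ jumps C s p r &
    forall lo hi, lo = (if b then th else r) -> hi = (if b then r else th) ->
      0 <= lo -> hi <= pi ->
      mu.-integrable `]lo, hi] (EFin \o F) /\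
      exists S : set (measurableTypeR R * measurableTypeR R), [/\ measurable S,
        S `<=` sector lo hi &
        - (\int[mu]_(x in `]lo, hi]) F x)%R <=
          ZQ A B Q hi - ZQ A B Q lo + 2 * fine (mu2 S) + eps * (hi - lo)]]].
Proof.
move=> eps0.
have [A [B [Q [aA bB qQ [dA dB] [dz Dz rate]]]]] := energy_rate HC th b.
exists A, B, Q; split => //.
have e4 : 0 < eps / 4 by rewrite divr_gt0.
have [CQ _] := qQ.
have CQ' := Ck_D CQ; have CQ'' := Ck_D CQ'.
have CF : Ck 0 (FQ Q) th.
  apply: Ck_det2.
    apply: Ck2D; first exact: Ck2_cst.
    by apply: Ck2D; apply: Ck2Z; [exact: Ck_le CQ | exact: Ck2_normal | exact: Ck_le CQ' | exact: Ck2_tau].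
  by apply: Ck2Z; [apply: CkD; [exact: Ck_le CQ | exact: CQ''] | exact: Ck2_tau].
have cF := Ck_cont1 CF.
have nF : \forall r \near th, FQ Q th - eps / 4 < FQ Q r.
  by apply: (cF [set y | FQ Q th - eps / 4 < y]); apply: lt_nbhsr; rewrite ltrBlDr ltrDl.
have [e e0 He] := near_itv (filterI (filterI (Ck_cont CF) nF) (germ_nearby qQ)).
have DA := Ck2_isd2 (germ2_Ck2 (germ2_le (isT : (1 <= 2)%N) aA)).
have DB := Ck2_isd2 (germ2_Ck2 (germ2_le (isT : (1 <= 2)%N) bB)).
have estA := isd_estimate (isd2_det (isd2_cst (al th) th) DA) e4.
have estB := isd_estimate (isd2_det (isd2_cst (be th) th) DB) e4.
have estZ := isd_estimate Dz e4.
have zero2 (v : R * R) : det2 0 v = 0 by rewrite /det2 !mul0r subrr.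
have tri1 := triangle_in_sector HC th b.
have tri2 : \forall r \near th, side b th r -> r != th ->
    forall lo hi, lo = (if b then th else r) -> hi = (if b then r else th) ->
    0 < det2 (be lo) (be hi) /\
    triangle p (c (lo + pi)) (c (hi + pi)) `<=`
    [set z | exists t l, [/\ lo + pi < t < hi + pi, 0 < l, l < 1 & z = p + l *: al t]].
  have [e' e'0 He'] := near_itv (triangle_in_sector HC (th + pi) b).
  apply: (itv_near e'0) => r /andP[r1 r2] br rth lo hi -> ->.
  have K : side b (th + pi) (r + pi) by move: br; case: (b) => /=; rewrite lerD2r.
  have K2 : r + pi != th + pi by rewrite (inj_eq (addIr _)).
  have [|K3 K4] := He' (r + pi) _ K K2 (if b then th + pi else r + pi) (if b then r + pi else th + pi) erefl erefl.
    exact: itv_shift.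
  by move: K3 K4; case: (b).
have nZ : \forall r \near th, side b th r -> r != th -> Z r = ZQ A B Q r.
  apply: filterS3 (frontR_nearby qQ) (germ2_near aA) (germ2_near bB) => r h1 h2 h3 br rth.
  have [h1' _] := h1 br rth.
  by rewrite /potential /potentialQ /midpt h1' (h2 br) (h3 br).
have nJ : \forall r \near th, side b th r -> r != th -> ~ jumps C s p r.
  by apply: filterS (frontR_nearby qQ) => r h br rth; have [] := h br rth.
have nint : \forall r \near th, th - e <= r <= th + e.
  by apply: (itv_near e0) => r /andP[r1 r2]; rewrite !ltW.
have nA := germ2_near aA; have nB := germ2_near bB.
near=> r => br rth; split.
- by move: br rth; near: r.
- by move: br rth; near: r.
move=> lo hi loE hiE lo0 hipi.
have lh : lo < hi.
  by rewrite loE hiE; move: br rth; case: (b) => /= h1 h2; rewrite lt_neqAle h1 ?h2// eq_sym h2.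
have /andP[re1 re2] : th - e <= r <= th + e by near: r.
have bnd t : lo <= t -> t <= hi -> th - e <= t <= th + e.
  by have [h1 h2] := itv_between t e0 re1 re2; rewrite loE hiE; case: (b).
have [|t|If Ilow] := @Rint_lower _ F (FQ Q) lo hi (FQ Q th - eps / 4) (ltW lh).
- move=> t t1 t2; have [_ h] := He t (bnd _ (ltW t1) (ltW t2)).
  have bt : side b th t by move: loE hiE; case: (b) => /= e1 e2; [rewrite -e1 | rewrite -e2]; exact: ltW.
  have tth : t != th.
    by move: loE hiE; case: (b) => e1 e2; [rewrite -e1 gt_eqF | rewrite -e2 lt_eqF].
  have [qE CQt] := h bt tth.
  rewrite /area_rate /area_rateQ (derive1_front (C := C) (s := s) qE CQt).
  by have [_ ->] := nbhs_singleton (front_nearE qE).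
- move=> t2 t3; have [[h1 h2] _] := He t (bnd _ t2 t3).
  by split => //; exact: ltW.
split => //.
have [D1 T1] : 0 < det2 (al lo) (al hi) /\
  triangle p (c lo) (c hi) `<=`
    [set z | exists t l, [/\ lo < t < hi, 0 < l, l < 1 & z = p + l *: al t]].
  suff K : forall lo hi, lo = (if b then th else r) -> hi = (if b then r else th) -> 0 < det2 (al lo) (al hi) /\
  triangle p (c lo) (c hi) `<=`
    [set z | exists t l, [/\ lo < t < hi, 0 < l, l < 1 & z = p + l *: al t]] by exact: K.
  by move: br rth; near: r.
have [D2 T2] : 0 < det2 (be lo) (be hi) /\
    triangle p (c (lo + pi)) (c (hi + pi)) `<=`
    [set z | exists t l, [/\ lo + pi < t < hi + pi, 0 < l, l < 1 & z = p + l *: al t]].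
  suff K : forall lo hi, lo = (if b then th else r) -> hi = (if b then r else th) ->
    0 < det2 (be lo) (be hi) /\
    triangle p (c (lo + pi)) (c (hi + pi)) `<=`
    [set z | exists t l, [/\ lo + pi < t < hi + pi, 0 < l, l < 1 & z = p + l *: al t]] by exact: K.
  by move: br rth; near: r.
have [S [mS Ssec Sm]] := sector_mass lo0 hipi D1 D2 T1 T2.
exists S; split => //.
have aE : al r = A r by move: br; near: r.
have bE : be r = B r by move: br; near: r.
have h1 : `|det2 (al th) (A r) - det2 (al th) (A th) - (det2 0 (A th) + det2 (al th) (der A th)) * (r - th)|
   <= eps / 4 * `|r - th| by near: r.
have h2 : `|det2 (be th) (B r) - det2 (be th) (B th) - (det2 0 (B th) + det2 (be th) (der B th)) * (r - th)|
   <= eps / 4 * `|r - th| by near: r.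
have h3 : `|ZQ A B Q r - ZQ A B Q th - dz * (r - th)| <= eps / 4 * `|r - th| by near: r.
move: h1 h2; rewrite -aE -bE -(germ2_at aA) -(germ2_at bB) !zero2 !det2vv !subr0 !add0r => h1 h2.
move: loE hiE lh Ilow Sm h1 h2 h3 rate; case: (b) => -> -> lh Ilow Sm h1 h2 h3 rate.
  have l0 : 0 < r - th by rewrite subr_gt0.
  exact: (rate_right l0 Ilow Sm h1 h2 h3 rate).
have l0 : r - th < 0 by rewrite subr_lt0.
rewrite -[th - r]opprB in Ilow *.
rewrite (det2C (al r)) (det2C (be r)) in Sm.
exact: (rate_left l0 Ilow Sm h1 h2 h3 rate).
Unshelve. all: by end_near. Qed.

End EnergyBound.

Section EnergyTotal.
Context {R : realType}.
Implicit Types (r t th lo hi : R) (b : bool) (Q : R -> R) (A B : R -> R * R) (z w v : R * R).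
Local Notation mu := (@lebesgue_measure R).
Local Notation mu2 := (mu \x mu)%E.
Variables (C : set (R * R)) (s : R * R -> R * R) (p : R * R) (c : R -> R * R).
Variables (P1 P2 P3 : R * R).
Hypothesis HC : chord_family C s p c P1 P2 P3.

Local Notation q := (q_ C s p).
Local Notation X := (front C s p).
Local Notation al := (alpha p c).
Local Notation be := (beta p c).
Local Notation mid := (midpt p c).
Local Notation W := (tri_vec p P1 P2 P3).
Local Notation ZQ := (potentialQ p P1 P2 P3).
Local Notation F := (area_rate C s p).
Local Notation Z := (potential C s p c P1 P2 P3).
Local Notation sector := (sector p c).
Local Notation J := (jump_form C s p).
Local Notation jset u v := (jumps C s p `&` `]u, v]%classic).

(** The inequality to be proved on the parameter interval, in a form that is
    additive: the swept area is measured on a subset of the sector, and the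
    sectors of adjacent intervals are disjoint. The term in [eps] absorbs the
    local errors. *)
Definition area_bound_on (eps u v : R) := [/\ mu.-integrable `]u, v] (EFin \o F),
  finite_set (jset u v) &
  exists S : set (measurableTypeR R * measurableTypeR R), [/\ measurable S,
    S `<=` sector u v &
    - (\int[mu]_(x in `]u, v]) F x)%R - \sum_(r \in jset u v) J r
      <= Z v - Z u + 2 * fine (mu2 S) + eps * (v - u)]].

Lemma area_bound_cat (eps u v w : R) : 0 <= u -> u <= v -> v <= w -> w <= pi ->
  area_bound_on eps u v -> area_bound_on eps v w -> area_bound_on eps u w.
Proof.
move=> u0 uv vw wpi [i1 f1 [S1 [m1 s1 b1]]] [i2 f2 [S2 [m2 s2 b2]]].
have [i12 iE] := integrable_cat uv vw i1 i2.
have jE : jset u w = jset u v `|` jset v w.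
  by rewrite -setIUr -itv_bndbnd_setU// bnd_simp.
have jD : jset u v `&` jset v w `<=` set0.
  move=> r [[_ /=]]; rewrite in_itv/= => /andP[_ h1] [_ /=].
  by rewrite in_itv/= => /andP[h2 _]; have := lt_le_trans h2 h1; rewrite ltxx.
have d12 : S1 `&` S2 = set0.
  apply/seteqP; split => // z [/s1 h1 /s2 h2].
  exact: (sector_disj HC u0 uv vw wpi (conj h1 h2)).
have g1 : mu2 S1 \is a fin_num.
  by apply: (meas_fin HC m1); apply: subset_trans s1 _; exact: sector_reg HC _ _.
have g2 : mu2 S2 \is a fin_num.
  by apply: (meas_fin HC m2); apply: subset_trans s2 _; exact: sector_reg HC _ _.
split => //; first by rewrite jE finite_setU.
exists (S1 `|` S2); split; first exact: measurableU.
  move=> z [/s1|/s2]; first exact: sector_sub (lexx _) vw _.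
  exact: sector_sub uv (lexx _) _.
rewrite iE jE fsbigU0//=.
have -> : fine (mu2 (S1 `|` S2)) = fine (mu2 S1) + fine (mu2 S2).
  by rewrite -(fineD g1 g2); congr fine; apply: measureU.
move: b1 b2.
move: (\int[mu]_(x in `]u, v]) F x)%R (\int[mu]_(x in `]v, w]) F x)%R (fine (mu2 S1)) (fine (mu2 S2)).
move: (\sum_(r \in jset u v) J r) (\sum_(r \in jset v w) J r) => *; lra.
Qed.

Lemma dot2_midpt th : dot2 (normal th) (mid th) = q th.
Proof.
rewrite /midpt; have e1 : dot2 (normal th) (al th) = q th by rewrite (cf_q HC).
have e2 := q_beta HC th.
have -> : dot2 (normal th) (2^-1 *: (al th + be th)) =
  2^-1 * (dot2 (normal th) (al th) + dot2 (normal th) (be th)) by rewrite /dot2 !pairE; ring.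
by rewrite e1 -e2; field.
Qed.

(** The front jumps along [tau th], and the midpoint of the chord lies on the
    line of the front with normal [normal th]. Therefore the jump of the
    potential is minus the form of the inserted segment. *)
Lemma jump_cancel Ql th : germ false 2 q Ql th ->
  let D := frontR C s p th - frontQ p Ql th in
  - det2 (frontQ p Ql th) D = det2 D (mid th) - det2 p D.
Proof.
move=> Gl D; set d := q_right C s p th - derive1 Ql th.
have DE : D = d *: tau th.
  rewrite /D /frontR /frontQ /frame (germ_at Gl) /d.
  by move: (normal th) (tau th) (q_right C s p th) (derive1 Ql th) => *; vring.
have mE := dot2_midpt th; rewrite (germ_at Gl) in mE.
have e1 : det2 (d *: tau th) (mid th) = - (d * Ql th) by rewrite det2Zl det2_tau mE mulrN.
rewrite DE e1 /frontQ /frame.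
have := cos2sin2 th; rewrite /det2 !pairE /= => cs.
transitivity (- d * (p.1 * cos th + p.2 * sin th) - d * (Ql th * (cos th * cos th + sin th * sin th))); first by ring.
by rewrite cs; ring.
Qed.

Lemma area_bound_refl eps th : area_bound_on eps th th.
Proof.
have e : `]th, th]%classic = set0 :> set R by apply: set_itv_ge; rewrite bnd_simp ltxx.
split; first by rewrite e; exact: integrable_set0.
  by rewrite e setI0.
exists set0; split; [exact: measurable0 | by [] |].
by rewrite e Rintegral_set0 setI0 fsbig_set0 measure0 /= !subrr !mulr0 !addr0 oppr0.
Qed.

Lemma area_bound_local eps th : 0 < eps -> 0 <= th -> th <= pi ->
  \forall r \near th, (0 <= r -> r <= th -> area_bound_on eps r th) /\
                      (th <= r -> r <= pi -> area_bound_on eps th r).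
Proof.
move=> eps0 th0 thpi.
have [Al [Bl [Ql [aAl bBl qQl Hl]]]] := local_bound HC th false eps0.
have [Ar [Br [Qr [aAr bBr qQr Hr]]]] := local_bound HC th true eps0.
have Zr : Z th = ZQ Ar Br Qr th.
  by rewrite /potential /potentialQ /midpt (frontR_germ qQr) (germ2_at aAr) (germ2_at bBr).
have [e e0 He] := near_itv (filterI Hl Hr).
apply: (itv_near e0) => r /andP[r1 r2]; split => h1 h2.
  have [->|rth] := eqVneq r th; first exact: area_bound_refl.
  have rlt : r < th by rewrite lt_neqAle rth.
  have re : th - e <= r <= th + e by rewrite !ltW.
  have [K _] := He r re; have [ZE _ /(_ r th erefl erefl h1 thpi)[If [S [mS sS bS]]]] := K h2 rth.
  have nj t : r < t -> t < th -> ~ jumps C s p t.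
    move=> t1 t2; have te : th - e <= t <= th + e.
      by apply/andP; split; apply/ltW; [exact: lt_trans t1 | apply: lt_trans t2 _; rewrite ltrDl].
    have [K' _] := He t te; have [_ nj _] := K' (ltW t2) (negbT (lt_eqF t2)).
    exact: nj.
  (* A short interval on the left of [th] contains at most the jump at its
     right end. *)
  have js : jset r th `<=` [set th].
    move=> t [jt /=]; rewrite in_itv/= => /andP[t1 t2].
    apply: contrapT => /eqP tth; apply: (nj t t1) => //.
    by rewrite lt_neqAle tth.
  split => //; first by apply: sub_finite_set js _; exact: finite_set1.
  exists S; split => //.
  set D := frontR C s p th - frontQ p Ql th.
  have jsum : - (\sum_(u \in jset r th) J u) = det2 D (mid th) - det2 p D.
    rewrite -(jump_cancel qQl).
    have [jth|njth] := pselect (jumps C s p th).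
      have -> : jset r th = [set th].
        apply/seteqP; split => // _ ->; split => //=.
        by rewrite in_itv/= lexx rlt.
      by rewrite fsbig_set1 (jump_formE qQl qQr).
    have -> : jset r th = set0.
      by apply/seteqP; split => // t /[dup] /js -> [].
    rewrite fsbig_set0.
    have th01 : th \in `]0, pi].
      by rewrite in_itv/= thpi andbT (le_lt_trans h1).
    by rewrite (front_no_jump qQl qQr th01 njth) subrr /det2 !mulr0 subrr.
  have ZE2 : Z th = ZQ Al Bl Ql th + (det2 D (mid th) - det2 p D).
    rewrite /potential /potentialQ /D -(germ2_at aAl) -(germ2_at bBl) -/(mid th).
    by move: (frontR C s p th) (frontQ p Ql th) (mid th) W => *; rewrite /det2 !pairE; ring.
  rewrite jsum ZE2 ZE.
  by move: bS; move: (\int[mu]_(x in `]r, th]) F x)%R (fine (mu2 S)) => *; lra.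
have [->|rth] := eqVneq r th; first exact: area_bound_refl.
have rlt : th < r by rewrite lt_neqAle eq_sym rth.
have re : th - e <= r <= th + e by rewrite !ltW.
have [_ K] := He r re; have [ZE njr /(_ th r erefl erefl th0 h2)[If [S [mS sS bS]]]] := K h1 rth.
have nj t : th < t -> t <= r -> ~ jumps C s p t.
  move=> t1 t2; have te : th - e <= t <= th + e.
    by apply/andP; split; apply/ltW; [apply: lt_trans t1; rewrite gtrBl | apply: le_lt_trans t2 _].
  have [_ K'] := He t te; have [_ nj _] := K' (ltW t1) (negbT (gt_eqF t1)).
  exact: nj.
have j0 : jset th r = set0.
  apply/seteqP; split => // t [jt /=]; rewrite in_itv/= => /andP[t1 t2].
  exact: (nj t).
split => //; first by rewrite j0.
exists S; split => //; rewrite j0 fsbig_set0 ZE Zr subr0.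
exact: bS.
Qed.

Lemma q_right_pi : q_right C s p pi = - q_right C s p 0.
Proof.
have [_ [_ [Q0 [_ _ G0 _]]]] := local_bound HC 0 true (ltr01 : 0 < 1 :> R).
have [_ [_ [Q1 [_ _ G1 _]]]] := local_bound HC pi true (ltr01 : 0 < 1 :> R).
rewrite /q_right; have := lim_deriv G0; have := lim_deriv G1; rewrite /at_side => -> ->.
have qpi r : q (r + pi) = - q r.
  rewrite (q_beta HC r) (cf_q HC) normal_pi /beta /alpha.
  by rewrite /dot2 !pairE; ring.
have sh : germ true 2 (fun r => r + pi) (fun r => r + pi) 0.
  by apply: germ_Ck; apply: CkD; [exact: Ck_id | exact: Ck_cst].
have G1' : germ true 2 q (fun r => - Q1 (r + pi)) 0.
  have -> : q = fun r => - q (r + pi) by apply/funext => r; rewrite qpi opprK.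
  apply: germN; apply: (germ_comp _ sh); first by rewrite add0r.
  by near=> r => /=; rewrite lerD2r.
have le12 : (1 <= 2)%N by [].
rewrite (germ_unique (germ_le le12 G0) (germ_le le12 G1')).
have [CQ1 _] := G1.
have d1 : is_derive (0 + pi : R) 1 Q1 (derive1 Q1 pi) by rewrite add0r; exact: Ck_derive1 CQ1.
have ds : is_derive (0 : R) 1 (fun r => r + pi) 1.
  by apply: isd_eq (isdD (is_derive_id _ _) (is_derive_cst pi _ _)) _; rewrite addr0.
by rewrite (isd_derive1 (isdN (@isd_comp _ Q1 (fun r => r + pi) _ _ _ d1 ds))) mulr1 opprK.
Unshelve. all: by end_near. Qed.

(** After half a turn the two ends of the chord are exchanged and [q] changes
    sign, so the front and the midpoint are the same as before. *)
Lemma potential_pi : Z pi = Z 0.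
Proof.
have qpi : q pi = - q 0.
  rewrite (q_beta HC 0) (cf_q HC) -[X in normal X]add0r normal_pi /beta /alpha add0r.
  by rewrite /dot2 !pairE; ring.
have mpi : mid pi = mid 0.
  by rewrite /midpt /beta /alpha add0r -[X in c (X + pi)]add0r (cf_2pi HC) addrC.
have fpi : frontR C s p pi = frontR C s p 0.
  rewrite /frontR qpi q_right_pi /frame -[X in normal X]add0r -[X in tau X]add0r normal_pi tau_pi.
  by vring.
by rewrite /potential mpi fpi.
Qed.

(** The increment of the potential over ]0, pi] vanishes, and the set that
    measures the swept area is contained in the region. *)
Theorem oriented_area_ge : - oriented_area C s p <= area C.
Proof.
have pi0 := pi_gt0 R.
have all_ eps : 0 < eps -> area_bound_on eps 0 pi.
  move=> eps0; apply: (@cousin _ (area_bound_on eps)); first exact: ltW.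
    by move=> u v w; exact: area_bound_cat.
  by move=> th th0 thpi; exact: area_bound_local.
have jE : jset 0 pi = jumps C s p.
  apply/seteqP; split => [r []//|r jr]; split => //; have [] := jr.
  by rewrite /= in_itv.
have key eps : 0 < eps -> - oriented_area C s p <= area C + eps * pi.
  move=> eps0; have [If _ [S [mS sS bS]]] := all_ eps eps0.
  have IE : det_form X 0 pi = (\int[mu]_(x in `]0, pi]) F x)%R.
    by rewrite /det_form -Rintegral_itv_obnd_cbnd.
  have SA : fine (mu2 S) <= area C.
    rewrite /area; apply: fine_le.
    - by apply: (meas_fin HC mS); apply: subset_trans sS _; exact: sector_reg HC _ _.
    - by apply: (meas_fin HC) => //; exact: cf_meas HC.
    - apply: le_measure; rewrite ?inE//; first exact: cf_meas HC.
      by apply: subset_trans sS _; exact: sector_reg HC _ _.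
  move: bS; rewrite potential_pi subrr add0r subr0 jE => bS.
  rewrite /oriented_area IE.
  have ep : 0 < eps * pi by rewrite mulr_gt0.
  rewrite -/(jump_form C s p).
  move: bS SA ep.
  move: (\int[mu]_(x in `]0, pi]) F x)%R (fine (mu2 S)) (area C) => I m a bS SA ep.
  rewrite -/(jump_form C s p) in bS *.
  set sj := \sum_(r \in _) _ in bS *.
  by lra.
rewrite -[leRHS]addr0; apply/ler_addgt0Pl => d d0.
have := key (d / pi) (divr_gt0 d0 pi0); rewrite divfK ?gt_eqF// addr0 addrC.
by [].
Qed.

End EnergyTotal.

(** * The density of a pair of parallel parametrisations *)

Section Constant.
Context {R : realType}.

Lemma sin_le_id (y : R) : 0 <= y -> sin y <= y.
Proof.
move=> y0; have [->|yn] := eqVneq y 0; first by rewrite sin0.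
have yp : 0 < y by rewrite lt_neqAle eq_sym yn.
have dsin (z : R) : z \in `]0, y[ -> is_derive (z : R) 1 sin (cos z).
  by move=> _; exact: is_derive_sin.
have csin : {within `[0, y], continuous (@sin R)}.
  by apply: continuous_subspaceT; exact: continuous_sin.
have [c _] := MVT yp dsin csin.
by rewrite sin0 !subr0 => ->; rewrite ler_piMl// cos_le1.
Qed.

(** If [pi / 2] were less than 21/16, the cosine of 21/16 would be negative;
    but cos 2y = 1 - 2 sin^2 y and sin y <= y make it positive. *)
Lemma pi_ge : 21 / 8 <= pi :> R.
Proof.
have c0 : 0 < cos (21 / 16 : R).
  have -> : 21 / 16 = (21 / 32) *+ 2 :> R by rewrite mulr2n; lra.
  rewrite cos_mulr2n.
  have s1 := @sin_le_id (21 / 32) ltac:(lra).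
  have s0 : 0 <= sin (21 / 32 : R).
    by have := pi_ge2 R => p2; apply: sin_ge0_pi; apply/andP; split; lra.
  have : sin (21 / 32 : R) ^+ 2 <= (21 / 32) ^+ 2 by rewrite ler_sqr ?nnegrE//; lra.
  have := cos2Dsin2 (21 / 32 : R); rewrite !mulr2n; lra.
rewrite leNgt; apply/negP => h; have p2 := pi_ge2 R.
move: c0; rewrite -(@cos_pihalf R) ltr_cos ?in_itv /=; lra.
Qed.

Lemma const_ge1 : 1 <= 2 * pi / (3 * Num.sqrt 3) :> R.
Proof.
have s3 : Num.sqrt 3 <= 7 / 4 :> R.
  by rewrite -(@ler_sqr R) ?nnegrE ?sqrtr_ge0 ?sqr_sqrtr //; lra.
have s0 : 0 < Num.sqrt 3 :> R by rewrite sqrtr_gt0.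
have := pi_ge; rewrite ler_pdivlMr ?mulr_gt0//; lra.
Qed.

End Constant.

Section Density.
Context {R : realType}.
Implicit Types (r t th : R) (b : bool) (X A : R -> R * R) (z w p : R * R).
Variables (T : R) (x a : R -> R * R) (C : set (R * R)) (s : R * R -> R * R).
Hypothesis Hx : ccurve T x C.
Hypothesis Ha : ccurve T a C.
Hypothesis Hpar : forall t b X A r, germ2 b 1 x X t -> germ2 b 1 a A t ->
  0 < det2 (der X t) (x r - x t) -> 0 < det2 (der A t) (a r - a t).
Hypothesis sxa : forall t, s (x t) = a t.
Local Notation mu2 := ((@lebesgue_measure R) \x (@lebesgue_measure R))%E.

Lemma regionE p : region C p -> region C = inside a.
Proof.
move=> /(region_inside Ha) pina; apply/seteqP; split => z.
  exact: (region_inside Ha).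
exact: (inside_region Ha pina).
Qed.

Lemma chord_family_tip p : region C p -> (mu2 (region C) < +oo)%E ->
  exists P1 P2 P3, chord_family C s p (chord_tip T x a p) P1 P2 P3.
Proof.
move=> pr fin; have pinx := region_inside Hx pr; have pina := region_inside Ha pr.
have [P1 [P2 [P3 [_ H]]]] := max_triangle Ha pina.
exists P1, P2, P3; split.
- exact: (q_E Hx Ha Hpar pinx sxa).
- move=> th b; have [A [A0 [k [gA k0 gA0 dA]]]] := chord_tip_germ Hx Ha Hpar pinx th b.
  exists A; split; first exact: gA.
  + move=> w Cw; rewrite dA det2Zl; apply: mulr_ge0; first exact: ltW.
    exact: (cc_conv_C Ha Cw gA0).
  + by rewrite dA det2Zl; apply: mulr_gt0 => //; exact: (pina _ _ _ gA0).
  + move=> w Cw; rewrite dA !det2Zl ler_pM2l//.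
    apply: le_trans (H _ _ _ _ Cw gA0) _; rewrite le_eqVlt; apply/orP; left; apply/eqP.
    by rewrite /chord_tip /det2 !pairE; ring.
- exact: (chord_tip_2pi Hx Ha Hpar pinx).
- exact: (chord_tip_chord Hx Ha Hpar pinx).
- exact: (chord_tip_rays Hx Ha Hpar pinx pina).
- exact: (chord_tip_C x p Ha).
- by rewrite (regionE pr); apply: open_measurable2; exact: (inside_open Ha).
- move=> th l l0 l1; rewrite (regionE pr) => t b X gX.
  have h1 := pina _ _ _ gX; have h2 := cc_conv_C Ha (chord_tip_C x p Ha th) gX.
  have -> : p + l *: (chord_tip T x a p th - p) - a t =
    (1 - l) *: (p - a t) + l *: (chord_tip T x a p th - a t) by vring.
  rewrite det2Dr !det2Zr ltr_pwDl//; first by rewrite mulr_gt0// subr_gt0.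
  by rewrite mulr_ge0// ltW.
- exact: fin.
Qed.

Lemma delta_le : (delta_ART C s <= (2 * pi / (3 * Num.sqrt 3))%:E)%E.
Proof.
apply: ge_ereal_sup => _ [p _ <-]; rewrite lee_fin; apply: le_trans const_ge1.
have A0 : 0 <= area C by exact: fine_ge0.
rewrite /energy; case: ifPn => [/set_mem pr|_]; last by rewrite mul0r.
move: A0; rewrite le_eqVlt => /orP[/eqP <-|A0]; first by rewrite invr0 mulr0.
rewrite ler_pdivrMr// mul1r.
(* An infinite measure would make [area C] zero. *)
have fin : (mu2 (region C) < +oo)%E.
  rewrite ltey; apply: contraTneq A0 => E.
  by rewrite /area E ltxx.
have [P1 [P2 [P3 H]]] := chord_family_tip pr fin.
exact: (oriented_area_ge H).
Qed.

End Density.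

(** * Ovals *)

Section Ovals.
Context {R : realType}.
Implicit Types (r s t u : R) (b : bool) (h X A F : R -> R * R) (z : R * R) (k : nat).

Lemma derivable_isd2 h t : derivable h t 1 -> isd2 h t (derive1 h t).
Proof.
move=> dh; have ch : (fun d => d^-1 *: ((h \o shift t) (d *: 1) - h t)) @ 0^' --> derive1 h t.
  by rewrite derive1E; exact: dh.
have c1 : (fun d => d^-1 *: (((fun s => (h s).1) \o shift t) (d *: 1) - (h t).1)) @ 0^' -->
    (derive1 h t).1.
  have l1 : (@fst R R) z @[z --> derive1 h t] --> (@fst R R) (derive1 h t) by exact: cvg_fst.
  exact: (cvg_comp _ _ ch l1).
have c2 : (fun d => d^-1 *: (((fun s => (h s).2) \o shift t) (d *: 1) - (h t).2)) @ 0^' -->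
    (derive1 h t).2.
  have l2 : (@snd R R) z @[z --> derive1 h t] --> (@snd R R) (derive1 h t) by exact: cvg_snd.
  exact: (cvg_comp _ _ ch l2).
split; (apply: DeriveDef; [by apply/cvg_ex; eexists; eassumption | exact: cvg_lim]).
Qed.

Lemma smooth_Ck2 h : (forall k t, derivable (derive1n k h) t 1) ->
  forall k t, Ck2 k h t.
Proof.
move=> sm k; elim: k h sm => [|k IH] h sm t.
  have d s := derivable_isd2 (@sm 0%N s).
  by split; near=> s; have [[d1 _] [d2 _]] := d s; apply: derivable_cont.
have d s : isd2 h s (derive1 h s) by exact: derivable_isd2 (@sm 0%N s).
have [|C1 C2] := IH (derive1 h) _ t.
  by move=> j s; have := @sm j.+1 s; rewrite /derive1n iterSr.
split.
  apply: is_derive_Ck C1; near=> s; exact: (d s).1.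
apply: is_derive_Ck C2; near=> s; exact: (d s).2.
Unshelve. all: by end_near. Qed.

Lemma neg_ratio (c d : R) : c < 0 -> d < 0 -> 0 < c^-1 * d.
Proof. by move=> c0 d0; rewrite nmulr_rgt0// invr_lt0. Qed.

Lemma neg_scale (c d : R) (u w : R * R) : c < 0 -> c *: u = d *: w -> u = (c^-1 * d) *: w.
Proof. by move=> c0 E; rewrite -scalerA -E scalerA mulVf ?scale1r// lt_eqF. Qed.

Variables (g : R -> R * R) (T : R).
Hypothesis Hg : is_oval g T.

Let T0 := oval_period_gt0 Hg.
Let gT := oval_periodic Hg.
Let gsm : forall k t, derivable (derive1n k g) t 1.
Proof. by case: Hg. Qed.
Local Notation v := (derive1 g).

Lemma oval_Ck2 k t : Ck2 k g t.
Proof. exact: smooth_Ck2 (@gsm) k t. Qed.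

Lemma oval_isd2 t : isd2 g t (v t).
Proof. exact: derivable_isd2 (@gsm 0%N t). Qed.

Lemma oval_velocity_isd2 t : isd2 v t (derive1n 2 g t).
Proof. exact: derivable_isd2 (@gsm 1%N t). Qed.

Lemma oval_velocity_Ck2 k t : Ck2 k v t.
Proof.
apply: smooth_Ck2 => j s; have := @gsm j.+1 s.
by rewrite /derive1n iterSr.
Qed.

Lemma oval_germ b k t : germ2 b k g g t.
Proof. by apply: germ2P; [exact: oval_Ck2 | near=> s]. Unshelve. all: by end_near. Qed.

Lemma oval_velocity_germ b k t : germ2 b k v v t.
Proof. by apply: germ2P; [exact: oval_velocity_Ck2 | near=> s]. Unshelve. all: by end_near. Qed.

Lemma oval_velocity_per t : v (t + T) = v t.
Proof.
have dT : is_derive (t : R) 1 (fun s => s + T) 1.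
  by apply: isd_eq (isdD (is_derive_id _ _) (is_derive_cst T _ _)) _; rewrite addr0.
have d := @isd2_comp _ g (fun s => s + T) t _ _ (oval_isd2 (t + T)) dT.
have gE : (fun s => g (s + T)) = g by apply/funext.
by have := isd2_der d; rewrite gE scale1r => <-; rewrite (isd2_der (oval_isd2 t)).
Qed.

Lemma oval_mod t s : g s = g t -> exists n : int, s = t + n%:~R * T.
Proof.
have [n n0] := shift_itv T0 t 0; have [m m0] := shift_itv T0 s 0.
move: n0 m0; rewrite !add0r => n0 m0.
rewrite -(perZ gT n t) -(perZ gT m s) => E.
have := oval_simple Hg _ _ E; rewrite !in_itv /= => /(_ m0 n0) e.
by exists (n - m); rewrite intrD mulrNz; lra.
Qed.

Lemma oval_inj t s : g s = g t -> t <= s -> s < t + T -> s = t.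
Proof.
move=> /oval_mod[n ->] h1 h2.
by rewrite (int_mul_small T0 (n := n)) ?mul0r ?addr0//; lra.
Qed.

Lemma oval_conv t s : 0 <= det2 (v t) (g s - g t).
Proof.
have [->|/eqP ne] := eqVneq (g s) (g t); first by rewrite subrr /det2 !mulr0 subrr.
by apply/ltW/(oval_strictly_convex Hg).
Qed.

Lemma oval_conv0 t s : det2 (v t) (g s - g t) <= 0 -> g s = g t.
Proof.
by have [//|/eqP ne] := eqVneq (g s) (g t); rewrite leNgt (oval_strictly_convex Hg ne).
Qed.

Lemma oval_der b X t : germ2 b 1 g X t -> der X t = v t.
Proof. by move=> /(germ2_unique (oval_germ b 1 t)) <-; exact: isd2_der (oval_isd2 t). Qed.

Lemma oval_ccurve : ccurve T g (range g).
Proof.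
split.
- exact: T0.
- exact: gT.
- by [].
- exact: oval_inj.
- by move=> t b; exists g; exact: oval_germ.
- by move=> t b X /oval_der ->; apply/eqP; exact: (oval_regular Hg).
- by move=> t b X s /oval_der ->; exact: oval_conv.
Qed.

(** The velocity rotates since the curvature is positive. If two velocities
    have the same direction, each of the two points is on the left of the
    parallel tangent at the other, so they coincide by strict convexity. *)
Lemma oval_rotating : rotating T v.
Proof.
split.
- exact: T0.
- exact: oval_velocity_per.
- by move=> t b; exists v; exact: oval_velocity_germ.
- move=> t b F /(germ2_unique (oval_velocity_germ b 1 t)) <-; rewrite (isd2_der (oval_velocity_isd2 t)).
  have := oval_curvature_gt0 Hg t; rewrite /curvature => k0.
  have n0 : 0 <= (norm2 (v t) ^+ 3)^-1 by rewrite invr_ge0 exprn_ge0// sqrtr_ge0.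
  rewrite ltNge; apply/negP => d0; move: k0; rewrite ltNge => /negP; apply.
  by rewrite mulr_le0_ge0.
- move=> t s c c0 vs; apply: oval_inj; apply: oval_conv0.
  have := oval_conv s t; rewrite vs det2Zl pmulr_rge0//.
  by rewrite -opprB det2Nr oppr_ge0.
Qed.

Local Notation j := (opp T v).
Definition oval_opp t := g (j t).
Local Notation a := oval_opp.

Lemma oval_velocity_opp t : exists2 c, c < 0 & v (j t) = c *: v t.
Proof. by have [_ _ H] := oppP oval_rotating t. Qed.

Lemma oval_velocity_eq s t : g s = g t -> v s = v t.
Proof. by move=> /oval_mod[n ->]; rewrite (perZ oval_velocity_per). Qed.

Lemma oval_opp_eq t s : a s = a t -> exists2 c, 0 < c & v s = c *: v t.
Proof.
move=> H; have [c c0 vs] := oval_velocity_opp s; have [d d0 vt] := oval_velocity_opp t.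
have E : c *: v s = d *: v t := etrans (esym vs) (etrans (@oval_velocity_eq (j s) (j t) H) vt).
exists (c^-1 * d); [exact: neg_ratio | exact: neg_scale].
Qed.

Lemma oval_opp_germ t b : exists A, germ2 b 2 a A t /\ exists2 c, 0 < c & der A t = c *: v (j t).
Proof.
have [r [jr r0 rs]] := opp_germ oval_rotating t b.
exists (fun s => g (r s)); split.
  exact: (@germ2_comp _ b 2 g g j r t (oval_germ b 2 (j t)) jr rs).
exists (derive1 r t) => //.
have dg : isd2 g (r t) (v (j t)) by rewrite -(germ_at jr); exact: oval_isd2.
have dr : is_derive (t : R) 1 r (derive1 r t).
  by case: jr => Cr _; exact: Ck_derive1 Cr.
exact: isd2_der (@isd2_comp _ g r t _ _ dg dr).
Qed.

Lemma oval_opp_der b A t : germ2 b 1 a A t -> exists2 c, 0 < c & der A t = c *: v (j t).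
Proof.
have [B [/(germ2_le (isT : (1 <= 2)%N)) aB [c c0 dB]]] := oval_opp_germ t b.
by move=> /(germ2_unique aB) <-; exists c.
Qed.

Lemma oval_opp_ccurve : ccurve T a (range g).
Proof.
split.
- exact: T0.
- by move=> t; rewrite /oval_opp (opp_per oval_rotating) gT.
- apply/seteqP; split => z [t _ <-]; last by exists (j t).
  by exists (j t) => //; rewrite /oval_opp (opp_opp oval_rotating) gT.
- by move=> t s /oval_opp_eq[c c0 vs]; exact: (rot_inj oval_rotating c0 vs).
- by move=> t b; have [A [aA _]] := oval_opp_germ t b; exists A.
- move=> t b X /oval_opp_der[c c0 ->]; rewrite scaler_eq0 gt_eqF//=.
  by apply/eqP; exact: (oval_regular Hg).
- move=> t b X s /oval_opp_der[c c0 ->]; rewrite det2Zl.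
  by apply: mulr_ge0; [exact: ltW | exact: oval_conv].
Qed.

Lemma oval_opp_mono t b X A r : germ2 b 1 g X t -> germ2 b 1 a A t ->
  0 < det2 (der X t) (g r - g t) -> 0 < det2 (der A t) (a r - a t).
Proof.
move=> /oval_der -> /oval_opp_der[c c0 ->] d; rewrite det2Zl; apply: mulr_gt0 => //.
apply: (oval_strictly_convex Hg) => /oval_opp_eq[e e0 vr].
have [n nE] := inj_mod oval_rotating e0 vr.
by move: d; rewrite nE (perZ gT) subrr /det2 !mulr0 subrr ltxx.
Qed.

(** A tangent parallel to the one at [g t] has the same or the opposite
    direction, and in the first case its point is [g t]. *)
Lemma oval_invE t : oval_inv g (g t) = a t.
Proof.
have [c c0 vj] := oval_velocity_opp t.
have v0 : v t != 0 by apply/eqP; exact: (oval_regular Hg).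
have pos_eq d (u : R) : v u = d *: v t -> 0 < d -> g u = g t.
  by move=> vu d0; have [n ->] := inj_mod oval_rotating d0 vu; rewrite (perZ gT).
apply: (@xget_unique _ _ [set y | exists t' u, [/\ g t = g t', y = g u, y <> g t &
                               det2 (v t') (v u) = 0]]) => /=.
  exists t, (j t); split => //; last by rewrite vj det2Zr det2vv mulr0.
  move=> /oval_velocity_eq; rewrite vj => E.
  have : (c - 1) *: v t = 0 by rewrite scalerBl E scale1r subrr.
  move/eqP; rewrite scaler_eq0 (negPf v0) orbF lt_eqF//; lra.
move=> y [t' [u [/oval_velocity_eq <- -> ne d]]].
have vu : v u = (dot2 (v u) (v t) / dot2 (v t) (v t)) *: v t.
  by apply: det2_0P; [exact: v0 | rewrite det2C d oppr0].
move: vu; set e := _ / _ => vu.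
have e0 : e != 0.
  by apply/eqP => e0; apply: (oval_regular Hg (t := u)); rewrite vu e0 scale0r.
have e1 : e < 0.
  by rewrite lt_neqAle e0 leNgt; apply/negP => /(pos_eq _ _ vu).
have vuj : v u = (e / c) *: v (j t) by rewrite vj scalerA divfK ?lt_eqF.
have ec : 0 < e / c by rewrite nmulr_rgt0// invr_lt0.
by have [n ->] := inj_mod oval_rotating ec vuj; rewrite (perZ gT).
Qed.

Lemma oval_delta_le : (delta_ART (range g) (oval_inv g) <= (2 * pi / (3 * Num.sqrt 3))%:E)%E.
Proof. exact: (delta_le oval_ccurve oval_opp_ccurve oval_opp_mono oval_invE). Qed.

End Ovals.

(** * Polygons *)

Section CyclicPolygon.
Context {R : realType}.
Implicit Types (i j k m : int) (l : R).
Variables (n : nat) (P : nat -> R * R).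
Hypothesis HP : is_cppos n P.
Local Notation N := (n.*2)%:Z.

(** Indexing by all integers lets indices decrease. *)
Definition vertex i : R * R := P `|(i %% N)%Z|%N.
Definition side_vec i : R * R := vertex (i + 1) - vertex i.
Local Notation V := vertex.
Local Notation E := side_vec.

Let N0 : N != 0.
Proof. by have := cppos_gt0 HP; case: n. Qed.

Let P_per (m i : nat) : P (i + m * n.*2)%N = P i.
Proof.
elim: m => [|m IH]; first by rewrite mul0n addn0.
by rewrite mulSn addnCA addnC (cppos_periodic HP).
Qed.

Lemma vertex_nat (i : nat) : V i = P i.
Proof. by rewrite /vertex modz_nat absz_nat {2}(divn_eq i n.*2) addnC P_per. Qed.

Lemma vertex_mod i m : V (i + m * N) = V i.
Proof. by rewrite /vertex addrC modzMDl. Qed.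

Lemma side_vec_mod i m : E (i + m * N) = E i.
Proof. by rewrite /side_vec addrAC !vertex_mod. Qed.

Let intS1 (a : nat) : a%:Z + 1 = a.+1%:Z.
Proof. by rewrite addrC -intS. Qed.

Lemma side_vec_nat (i : nat) : E i = edge P i.
Proof. by rewrite /side_vec intS1 !vertex_nat. Qed.

Lemma int_natE i : exists (a : nat) m, i = a%:Z + m * N.
Proof.
exists `|(i %% N)%Z|%N, (i %/ N)%Z.
by rewrite gez0_abs ?modz_ge0// addrC -divz_eq.
Qed.

Lemma vertex_eq i j : V j = V i -> exists m, j = i + m * N.
Proof.
have lt a : (`|(a %% N)%Z| < n.*2)%N.
  by rewrite -ltz_nat gez0_abs ?modz_ge0// ltz_pmod// ltz_nat double_gt0 (cppos_gt0 HP).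
move=> /(cppos_inj HP (lt j) (lt i)) e.
exists ((j %/ N)%Z - (i %/ N)%Z); rewrite {1}(divz_eq j N) {1}(divz_eq i N).
have -> : (j %% N)%Z = (i %% N)%Z by rewrite -[LHS]gez0_abs ?modz_ge0// e gez0_abs ?modz_ge0.
by ring.
Qed.

Lemma side_conv i j : 0 <= det2 (E i) (V j - V i).
Proof.
have [a [m ->]] := int_natE i; have [b [m' ->]] := int_natE j.
by rewrite side_vec_mod !vertex_mod side_vec_nat !vertex_nat; exact: (cppos_convex HP).
Qed.

Lemma vertexS i : V (i + 1) = V i + E i.
Proof. by rewrite /side_vec [RHS]addrC subrK. Qed.

Lemma turn_gt0 i : 0 < det2 (E i) (E (i + 1)).
Proof.
rewrite lt_neqAle; apply/andP; split.
  have [a [m ->]] := int_natE i; rewrite addrAC !side_vec_mod intS1 !side_vec_nat.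
  by rewrite eq_sym; apply/eqP; exact: (cppos_indep HP).
have := side_conv i (i + 1 + 1); rewrite !vertexS.
have -> : V i + E i + E (i + 1) - V i = E i + E (i + 1) by vring.
by rewrite det2Dr det2vv add0r.
Qed.

Lemma side_neq0 i : E i != 0.
Proof.
by apply: contraTneq (turn_gt0 i) => ->; rewrite /det2 !mul0r subrr ltxx.
Qed.

(** For [n = 1] the two edges would be both consecutive and parallel. *)
Lemma two_lt_sides : (1 < n)%N.
Proof.
have := cppos_gt0 HP; case: n HP => [|[|]]// H _.
by case: (@cppos_indep _ _ _ H 0%N); rewrite -addn1 (cppos_parallel H).
Qed.

Let paral (u v w : R * R) : w != 0 -> det2 u w = 0 -> det2 v w = 0 -> det2 u v = 0.
Proof. by move=> w0 /(det2_0P w0) -> /(det2_0P w0) ->; rewrite det2Zl det2Zr det2vv !mulr0. Qed.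

(** The turns at the two ends of the side confine a vertex on its line to the
    side itself. If it were in the interior of the side, the two edges at this
    vertex would both be parallel to the side, although consecutive edges are
    independent. *)
Lemma side_contact i j : det2 (E i) (V j - V i) = 0 -> V j = V i \/ V j = V (i + 1).
Proof.
move=> d; have jE : V j - V i = (dot2 (V j - V i) (E i) / dot2 (E i) (E i)) *: E i.
  by apply: det2_0P; [exact: side_neq0 | rewrite det2C d oppr0].
move: jE; set l := _ / _ => jE.
have e1 : V j = V i + l *: E i by rewrite -jE addrC subrK.
have l1 : l <= 1.
  have := side_conv (i + 1) j; rewrite vertexS.
  have -> : V j - (V i + E i) = (l - 1) *: E i by rewrite e1; vring.
  rewrite det2Zr det2C mulrN -mulNr opprB pmulr_lge0 ?turn_gt0//; lra.
have l0 : 0 <= l.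
  have := side_conv (i - 1) j; have -> : V j - V (i - 1) = E (i - 1) + l *: E i.
    by have := vertexS (i - 1); rewrite subrK e1 => ->; vring.
  rewrite det2Dr det2vv add0r det2Zr pmulr_lge0//.
  by have := turn_gt0 (i - 1); rewrite subrK.
have [l00|ln0] := eqVneq l 0; first by left; rewrite e1 l00 scale0r addr0.
have [l11|ln1] := eqVneq l 1; first by right; rewrite e1 l11 scale1r vertexS.
have lp : 0 < l by rewrite lt_neqAle eq_sym ln0.
have lq : 0 < 1 - l by rewrite subr_gt0 lt_neqAle ln1.
have key (w : R * R) : 0 <= det2 w (V i - V j) -> 0 <= det2 w (V (i + 1) - V j) -> det2 w (E i) = 0.
  have -> : V i - V j = (- l) *: E i by rewrite e1; vring.
  have -> : V (i + 1) - V j = (1 - l) *: E i by rewrite vertexS e1; vring.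
  rewrite !det2Zr mulNr oppr_ge0 pmulr_rle0// pmulr_rge0// => h1 h2.
  by apply/eqP; rewrite eq_le h1 h2.
have d1 : det2 (E j) (E i) = 0 by apply: key; exact: side_conv.
have d2 : det2 (E (j - 1)) (E i) = 0.
  have h (w : int) : det2 (E (j - 1)) (V w - V (j - 1)) = det2 (E (j - 1)) (V w - V j).
    have -> : V w - V (j - 1) = (V w - V j) + E (j - 1).
      by have := vertexS (j - 1); rewrite subrK => ->; vring.
    by rewrite det2Dr det2vv addr0.
  by apply: key; rewrite -h; exact: side_conv.
have := turn_gt0 (j - 1); rewrite subrK.
by rewrite (paral (side_neq0 i) d2 d1) ltxx.
Qed.

(** Excludes that the edge following a given edge ends on it. *)
Lemma not_shift2 i m : i + 1 + 1 != i + m * N /\ i + 1 + 1 != i + 1 + m * N.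
Proof.
have n1 := two_lt_sides.
have H (c : nat) : (0 < c)%N -> (c < n.*2)%N -> c%:Z != m * N.
  move=> c0 cN; apply/eqP => E.
  have : (n.*2 %| c)%N by have := dvdz_mull m (dvdzz N); rewrite -E dvdzE !absz_nat.
  by rewrite gtnNdvd.
split; apply/eqP.
  by rewrite -addrA => /addrI E; have := H 2%N isT ltac:(lia); rewrite -E.
by move=> /addrI E; have := H 1%N isT ltac:(lia); rewrite -E.
Qed.

End CyclicPolygon.

Section PolygonCurve.
Context {R : realType}.
Implicit Types (i j k m : int) (r s t : R) (b : bool) (X A : R -> R * R).
Variables (n : nat) (P : nat -> R * R).
Hypothesis HP : is_cppos n P.
Local Notation N := (n.*2)%:Z.
Local Notation V := (vertex n P).
Local Notation E := (side_vec n P).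
Local Notation T := (n.*2%:R : R).

(** The line of the edge [k], on which the edge itself is the parameter
    interval from [k] to [k + 1]. *)
Definition affine_side k t : R * R := V k + (t - k%:~R) *: E k.
Definition polygon_pt t := affine_side (Num.floor t) t.
Local Notation L := affine_side.
Local Notation x := polygon_pt.

Lemma polygon_period_gt0 : 0 < T.
Proof. by rewrite ltr0n double_gt0; exact: (cppos_gt0 HP). Qed.

Lemma side_end k : L k (k + 1)%:~R = V (k + 1).
Proof. by rewrite /affine_side intrD addrAC subrr add0r scale1r vertexS. Qed.

Lemma polygon_ptE k t : k%:~R <= t <= k%:~R + 1 -> x t = L k t.
Proof.
move=> /andP[kt]; rewrite le_eqVlt => /orP[/eqP ->|tk].
  have -> : k%:~R + 1 = (k + 1)%:~R :> R by rewrite intrD.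
  by rewrite side_end /polygon_pt intrKfloor /affine_side subrr scale0r addr0.
by rewrite /polygon_pt (@floor_def _ t k)// kt intrD.
Qed.

Lemma affine_side_mod k m t : L (k + m * N) (t + m%:~R * T) = L k t.
Proof.
rewrite /affine_side vertex_mod side_vec_mod intrD intrM.
by congr (_ + _ *: _); rewrite -[N%:~R]/T; ring.
Qed.

Lemma polygon_pt_mod m t : x (t + m%:~R * T) = x t.
Proof.
have /andP[f1 f2] := floor_itv t; rewrite intrD in f2.
rewrite [RHS]/polygon_pt -(affine_side_mod _ m); apply: polygon_ptE.
rewrite intrD intrM -[N%:~R]/T; apply/andP; split; lra.
Qed.

(** The edge traversed just after [t] for [b = true], just before [t]
    otherwise. *)
Definition side_of b t : int := if b then Num.floor t else - Num.floor (- t) - 1.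

Lemma side_ofP b t : [/\ (side_of b t)%:~R <= t <= (side_of b t)%:~R + 1,
  b -> t < (side_of b t)%:~R + 1 & ~~ b -> (side_of b t)%:~R < t].
Proof.
case: b => /=.
  by have /andP[f1] := floor_itv t; rewrite intrD => f2; split => //; apply/andP; split => //; exact: ltW.
have /andP[f1 f2] := floor_itv (- t); rewrite intrD in f2.
by rewrite intrD !mulrNz; split => //; [apply/andP; split|move=> _]; lra.
Qed.

Lemma side_ofD b t m : side_of b (t + m%:~R) = side_of b t + m.
Proof.
case: b => /=; first by rewrite floorDrz ?intrKfloor.
by rewrite opprD -mulrNz floorDrz ?intrKfloor// opprD opprK addrAC.
Qed.

Lemma affine_side_Ck2 p k t : Ck2 p (L k) t.
Proof.
apply: Ck2D; first exact: Ck2_cst.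
apply: Ck2Z; last exact: Ck2_cst.
by apply: CkB; [exact: Ck_id | exact: Ck_cst].
Qed.

Lemma affine_side_isd2 k t : isd2 (L k) t (E k).
Proof.
have d : is_derive (t : R) 1 (fun s => s - k%:~R) 1.
  by apply: isd_eq (isdB (is_derive_id _ _) (is_derive_cst (k%:~R : R) _ _)) _; rewrite subr0.
apply: isd2_eq (isd2D (isd2_cst (V k) t) (isd2Z d (isd2_cst (E k) t))) _.
by rewrite scaler0 addr0 add0r scale1r.
Qed.

Lemma polygon_germ p b t : germ2 b p x (L (side_of b t)) t.
Proof.
apply: germ2P; first exact: affine_side_Ck2.
have [/andP[h1 h2] hT hF] := side_ofP b t.
have near1 : \forall s \near t, side b t s ->
    (side_of b t)%:~R <= s <= (side_of b t)%:~R + 1.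
  rewrite /side; case: b h1 h2 hT hF => h1 h2 hT hF.
    have d0 : 0 < (side_of true t)%:~R + 1 - t by have := hT isT; lra.
    apply: (itv_near d0) => s /andP[s1 s2] s3; apply/andP; split; lra.
  have d0 : 0 < t - (side_of false t)%:~R by have := hF isT; lra.
  apply: (itv_near d0) => s /andP[s1 s2] s3; apply/andP; split; lra.
by apply: filterS near1 => s h bs; exact: polygon_ptE (h bs).
Qed.

Lemma polygon_der b X t : germ2 b 1 x X t -> der X t = E (side_of b t).
Proof.
by move=> /(germ2_unique (polygon_germ 1 b t)) <-; exact: isd2_der (affine_side_isd2 _ _).
Qed.

Lemma polygon_pt_convex k r : exists i l, [/\ i%:~R <= r, 0 <= l, l < 1,
  r = i%:~R + l & det2 (E k) (x r - V k) =
    (1 - l) * det2 (E k) (V i - V k) + l * det2 (E k) (V (i + 1) - V k)].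
Proof.
have /andP[f1 f2] := floor_itv r; rewrite intrD in f2.
exists (Num.floor r), (r - (Num.floor r)%:~R); split; [by []|lra|lra|ring|].
by rewrite -!det2Zr -det2Dr /polygon_pt /affine_side vertexS; congr det2; vring.
Qed.

Lemma polygon_side_ge0 k r : 0 <= det2 (E k) (x r - V k).
Proof.
have [i [l [_ l0 l1 _ ->]]] := polygon_pt_convex k r.
have l1' : 0 <= 1 - l by lra.
exact: (addr_ge0 (mulr_ge0 l1' (side_conv HP k i)) (mulr_ge0 l0 (side_conv HP k (i + 1)))).
Qed.

(** Only the two ends of the edge are vertices on its line, so a point of the
    polygon on this line belongs to the edge. *)
Lemma polygon_side0 k r : det2 (E k) (x r - V k) = 0 ->
  exists m, k%:~R <= r + m%:~R * T <= k%:~R + 1.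
Proof.
have [i [l [_ l0 l1 rE ->]]] := polygon_pt_convex k r => d.
have l1' : 0 < 1 - l by lra.
have c1 := side_conv HP k i; have c2 := side_conv HP k (i + 1).
have d1 : det2 (E k) (V i - V k) = 0.
  have p1 := mulr_ge0 (ltW l1') c1; have p2 := mulr_ge0 l0 c2.
  have : (1 - l) * det2 (E k) (V i - V k) = 0 by lra.
  by move/eqP; rewrite mulf_eq0 gt_eqF//= => /eqP.
have [/(vertex_eq HP)[m iE]|/(vertex_eq HP)[m iE]] := side_contact HP d1.
  exists (- m); rewrite rE iE intrD intrM -[N%:~R]/T mulrNz; apply/andP; split; lra.
have [l00|ln0] := eqVneq l 0.
  by exists (- m); rewrite rE iE l00 !intrD intrM -[N%:~R]/T mulrNz; apply/andP; split; lra.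
have d2 : det2 (E k) (V (i + 1) - V k) = 0.
  move/eqP: d; rewrite d1 mulr0 add0r mulf_eq0 (negPf ln0) /= => /eqP //.
have [s1 s2] := not_shift2 HP k (- m).
have e : i + 1 = k + 1 + 1 + m * N by rewrite iE addrAC.
have back j : k + 1 + 1 + m * N = j -> k + 1 + 1 = j + (- m) * N by move=> <-; ring.
have [/(vertex_eq HP)[m' e']|/(vertex_eq HP)[m' e']] := side_contact HP d2.
  have [/eqP s _] := not_shift2 HP k (m' - m); case: s.
  by rewrite (back (k + m' * N)); [ring | rewrite -e e'].
have [_ /eqP s] := not_shift2 HP k (m' - m); case: s.
by rewrite (back (k + 1 + m' * N)); [ring | rewrite -e e'].
Qed.

Lemma affine_side_parallel k t : det2 (E k) (L k t - V k) = 0.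
Proof.
have -> : L k t - V k = (t - k%:~R) *: E k by rewrite /affine_side; vring.
by rewrite det2Zr det2vv mulr0.
Qed.

Lemma polygon_mod t s : x s = x t -> exists m, s = t + m%:~R * T.
Proof.
move=> st; have [h _ _] := side_ofP true t; set k := side_of true t in h.
have xt := polygon_ptE h.
have [m hm] : exists m, k%:~R <= s + m%:~R * T <= k%:~R + 1.
  by apply: polygon_side0; rewrite st xt; exact: affine_side_parallel.
have e : L k (s + m%:~R * T) = L k t by rewrite -xt -st -(polygon_pt_mod m s) (polygon_ptE hm).
exists (- m); have : (s + m%:~R * T - t) *: E k = 0.
  have -> : (s + m%:~R * T - t) *: E k = L k (s + m%:~R * T) - L k t by rewrite /affine_side; vring.
  by rewrite e subrr.
move/eqP; rewrite scaler_eq0 (negPf (side_neq0 HP k)) orbF mulrNz => /eqP; lra.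
Qed.

Lemma polygon_inj t s : x s = x t -> t <= s -> s < t + T -> s = t.
Proof.
move=> /polygon_mod[m ->] h1 h2.
by rewrite (int_mul_small polygon_period_gt0 (n := m)) ?mul0r ?addr0//; lra.
Qed.

Lemma polygon_pt_nat (a : nat) r : 0 <= r <= 1 -> x (a%:R + r) = P a + r *: edge P a.
Proof.
move=> /andP[r0 r1]; rewrite (@polygon_ptE a%:Z).
  by rewrite /affine_side (vertex_nat HP) (side_vec_nat HP) -[(a%:Z)%:~R]/(a%:R) addrAC subrr add0r.
by rewrite -[(a%:Z)%:~R]/(a%:R); apply/andP; split; lra.
Qed.

Lemma polygonE : polygon P = range x.
Proof.
apply/seteqP; split => z.
  by move=> [a [r [r01 ->]]]; exists (a%:R + r) => //; exact: polygon_pt_nat.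
move=> [t _ <-]; have /andP[f1 f2] := floor_itv t; rewrite intrD in f2.
have [a [m fE]] := int_natE HP (Num.floor t).
exists a, (t - (Num.floor t)%:~R); split; first by apply/andP; split; lra.
rewrite /polygon_pt /affine_side fE vertex_mod side_vec_mod.
by rewrite (vertex_nat HP) (side_vec_nat HP).
Qed.

Lemma polygon_conv b t s : 0 <= det2 (E (side_of b t)) (x s - x t).
Proof.
have [h _ _] := side_ofP b t; rewrite (polygon_ptE h).
have -> : x s - L (side_of b t) t = (x s - V (side_of b t)) - (L (side_of b t) t - V (side_of b t)) by vring.
by rewrite det2Br affine_side_parallel subr0; exact: polygon_side_ge0.
Qed.

Lemma polygon_ccurve : ccurve T x (polygon P).
Proof.
split.
- exact: polygon_period_gt0.
- by move=> t; have := polygon_pt_mod 1 t; rewrite mul1r.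
- exact: polygonE.
- exact: polygon_inj.
- by move=> t b; exists (L (side_of b t)); exact: polygon_germ.
- by move=> t b X /polygon_der ->; exact: side_neq0.
- by move=> t b X s /polygon_der ->; exact: polygon_conv.
Qed.

Definition polygon_opp t := x (t + n%:R).
Local Notation a := polygon_opp.

Let shift_isd t : is_derive (t : R) 1 (fun s => s + n%:R) 1.
Proof. by apply: isd_eq (isdD (is_derive_id _ _) (is_derive_cst (n%:R : R) _ _)) _; rewrite addr0. Qed.

Lemma polygon_opp_germ p b t : germ2 b p a (fun s => L (side_of b (t + n%:R)) (s + n%:R)) t.
Proof.
have Cs : Ck p (fun s => s + n%:R) t by apply: CkD; [exact: Ck_id | exact: Ck_cst].
have mono : \forall s \near t, side b t s -> side b (t + n%:R) (s + n%:R).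
  by near=> s; case: b; rewrite /side lerD2r.
exact: (@germ2_comp _ b p x _ (fun s => s + n%:R) (fun s => s + n%:R) t
  (polygon_germ p b (t + n%:R)) (germ_Ck b Cs) mono).
Unshelve. all: by end_near. Qed.

Lemma polygon_opp_der b A t : germ2 b 1 a A t -> der A t = E (side_of b t + n%:Z).
Proof.
move=> /(germ2_unique (polygon_opp_germ 1 b t)) <-.
rewrite -(side_ofD b t n%:Z).
have d := @isd2_comp _ (L (side_of b (t + n%:R))) (fun s => s + n%:R) t 1 _
  (affine_side_isd2 _ _) (shift_isd t).
by rewrite (isd2_der d) scale1r.
Qed.

Lemma polygon_opp_ccurve : ccurve T a (polygon P).
Proof.
have per s : x (s + T) = x s by have := polygon_pt_mod 1 s; rewrite mul1r.
split.
- exact: polygon_period_gt0.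
- by move=> t; rewrite /polygon_opp addrAC per.
- rewrite polygonE; apply/seteqP; split => z [t _ <-]; last by exists (t + n%:R).
  by exists (t - n%:R) => //; rewrite /polygon_opp subrK.
- move=> t s /polygon_inj H h1 h2; suff : s + n%:R = t + n%:R by move=> /addIr.
  by apply: H; [rewrite lerD2r | rewrite addrAC ltrD2r].
- by move=> t b; eexists; exact: polygon_opp_germ.
- by move=> t b X /polygon_opp_der ->; exact: side_neq0.
- move=> t b X s /polygon_opp_der ->.
  by have := polygon_conv b (t + n%:R) (s + n%:R); rewrite (side_ofD b t n%:Z).
Qed.

(** By [polygon_side0], if [a r] is on the line of the edge opposite to the
    one of [x t], then it belongs to that edge, and [x r] belongs to the edge
    of [x t]. *)
Lemma polygon_opp_mono t b X A r : germ2 b 1 x X t -> germ2 b 1 a A t ->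
  0 < det2 (der X t) (x r - x t) -> 0 < det2 (der A t) (a r - a t).
Proof.
move=> /polygon_der -> /polygon_opp_der ->; set k := side_of b t => d.
have kn : side_of b (t + n%:R) = k + n%:Z by exact: (side_ofD b t n%:Z).
have := polygon_conv b (t + n%:R) (r + n%:R); rewrite kn le_eqVlt => /orP[/eqP d0|//].
have [h _ _] := side_ofP b t; rewrite -/k in h.
have [h' _ _] := side_ofP b (t + n%:R); rewrite kn in h'.
have [m hm] : exists m, (k + n%:Z)%:~R <= (r + n%:R) + m%:~R * T <= (k + n%:Z)%:~R + 1.
  apply: polygon_side0; move: d0; rewrite (polygon_ptE h').
  have -> : x (r + n%:R) - L (k + n) (t + n%:R) =
    (x (r + n%:R) - V (k + n)) - (L (k + n) (t + n%:R) - V (k + n)) by vring.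
  by rewrite det2Br affine_side_parallel subr0 => <-.
have hm' : k%:~R <= r + m%:~R * T <= k%:~R + 1.
  by move: hm; rewrite intrD -[(n%:Z)%:~R]/(n%:R) => /andP[m1 m2]; apply/andP; split; lra.
move: d; rewrite -(polygon_pt_mod m r) (polygon_ptE hm') (polygon_ptE h).
have -> : L k (r + m%:~R * T) - L k t =
  (L k (r + m%:~R * T) - V k) - (L k t - V k) by vring.
by rewrite det2Br !affine_side_parallel subrr ltxx.
Qed.

(** Two descriptions of a point of the polygon, as for a vertex, have
    parameters that are equal modulo the period; hence they give the same
    image. *)
Lemma cppos_invE t : cppos_inv n P (x t) = a t.
Proof.
have main (i : nat) r : 0 <= r <= 1 -> x t = P i + r *: edge P i ->
    P (i + n)%N + r *: edge P (i + n)%N = a t.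
  move=> r01; rewrite -(polygon_pt_nat i r01) => /esym /polygon_mod[m e].
  by rewrite -(polygon_pt_nat _ r01) natrD addrAC e addrAC polygon_pt_mod.
apply: (@xget_unique _ _ [set y | exists (i : nat) r, [/\ 0 <= r <= 1,
    x t = P i + r *: edge P i & y = P (i + n)%N + r *: edge P (i + n)%N]]) => /=.
  have [i [r [r01 xi]]] : polygon P (x t) by rewrite polygonE; exists t.
  by exists i, r; split => //; rewrite (main i r).
by move=> y [i [r [r01 xi ->]]]; exact: main.
Qed.

Lemma polygon_delta_le :
  (delta_ART (polygon P) (cppos_inv n P) <= (2 * pi / (3 * Num.sqrt 3))%:E)%E.
Proof. exact: (delta_le polygon_ccurve polygon_opp_ccurve polygon_opp_mono cppos_invE). Qed.

End PolygonCurve.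

Theorem theorem7p2 (R : realType) :
  (forall (g : R -> R * R) (T : R), is_oval g T ->
     (delta_ART (range g) (oval_inv g)
        <= (2 * pi / (3 * Num.sqrt 3))%:E)%E) /\
  (forall (n : nat) (P : nat -> R * R), is_cppos n P ->
     (delta_ART (polygon P) (cppos_inv n P)
        <= (2 * pi / (3 * Num.sqrt 3))%:E)%E).
Proof.
split; [exact: oval_delta_le | exact: polygon_delta_le].
Qed.
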